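(* Let $\Gamma$ be the cluster modular group of the cluster algebra of type $E_7^{(1,1)}$, i.e. with initial quiver $T_{(4,4,2),(1,1,1)}$, and let $\gamma\in\Gamma$ be the class of mutation at $N_\infty$ together with the transposition $(N_1\,N_\infty)$. Then the normal closure $\mathcal N(\gamma)$ of $\gamma$ in $\Gamma$ is a finite index free group. It is isomorphic to the congruence subgroup $\bar\Gamma(4)$ of $\mathrm{PSL}(2,\mathbb Z)$.
   Context: $T_{(4,4,2),(1,1,1)}$ is the quiver with nodes $N_1,N_\infty,1_2,1_3,1_4,2_2,2_3,2_4,3_2$, two arrows $N_\infty\to N_1$, single arrows $N_1\to i_2$ and $i_2\to N_\infty$ for $i=1,2,3$, and single arrows $i_3\to i_2$, $i_3\to i_4$ for $i=1,2$. Cluster modular group. A mutation path $P$ is a word in the nodes of $Q$ (repeated consecutive letters cancel), performed left to right using standard quiver mutation. Pairs $(P,\sigma)$, $\sigma:Q\to P(Q)$ a quiver isomorphism (preserving arrow directions) viewed as a permutation of the nodes, multiply by $(P,\sigma)(R,\tau)=(P\cdot\sigma(R),\sigma\tau)$, and act on cluster variables by sending the variable at $i$ of the initial seed to the variable at $\sigma(i)$ of the seed reached by $P$. $\Gamma$ is the group of pairs modulo those acting trivially on cluster variables. $\bar\Gamma(4)$ is the image in $\mathrm{PSL}(2,\mathbb Z)$ of the principal congruence subgroup of level 4 of $\mathrm{SL}(2,\mathbb Z)$. *)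

(* Defs.v *)
From HB Require Import structures.
From Stdlib Require Import FunctionalExtensionality.
From mathcomp Require Import all_boot all_order all_algebra all_fingroup.
From mathcomp Require Import generic_quotient fraction mpoly zify.

Set Implicit Arguments.
Unset Strict Implicit.
Unset Printing Implicit Defensive.

Import Order.TTheory GRing.Theory Num.Theory.

Local Open Scope quotient_scope.
Local Open Scope group_scope.

(* Infinite groups: subgroups are Prop-valued predicates on a [groupType]. *)

Section Subgroups.
Variable G : groupType.
Implicit Types (H S : G -> Prop).

Definition is_subgroup H := H 1 /\ (forall x y, H x -> H y -> H (x * y^-1)).

Definition is_normal H := forall x g, H x -> H (x ^ g).

Definition normal_closure (a : G) : G -> Prop :=
  fun x => forall H, is_subgroup H -> is_normal H -> H a -> H x.

Definition finite_index H :=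
  exists s : seq G, forall g, exists2 r, r \in s & H (g * r^-1).

(* Group words: [(x, false)] stands for x and [(x, true)] for x^-1. *)
Definition letter_val (l : G * bool) : G := if l.2 then l.1^-1 else l.1.

Definition word_val (w : seq (G * bool)) : G := \prod_(l <- w) letter_val l.

Definition reduced (w : seq (G * bool)) : bool :=
  sorted (fun l m => (l.1 != m.1) || (l.2 == m.2)) w.

Definition word_over S (w : seq (G * bool)) := forall l, l \in w -> S l.1.

(* The map from the group of reduced words over S to G is a bijection to H. *)
Definition free_basis H S :=
  (forall w, word_over S w -> H (word_val w)) /\
  (forall h, H h ->
     exists! w, [/\ word_over S w, reduced w & word_val w = h]).

Definition is_free H := exists S, free_basis H S.

End Subgroups.

Definition subgroup_isomorphic (G K : groupType)
    (H : G -> Prop) (L : K -> Prop) : Prop :=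
  exists f : G -> K,
    [/\ forall x y, H x -> H y -> f (x * y) = f x * f y,
        forall x y, H x -> H y -> f x = f y -> x = y
      & forall z, L z <-> exists2 x, H x & f x = z].

(* [q i j] is the number of arrows from i to j. *)
Definition arrows (n : nat) := 'I_n -> 'I_n -> nat.

Record quiver (n : nat) := Quiver {
  arrows_of :> arrows n;
  (* neither loops (i = j) nor 2-cycles *)
  quiver_no2cycle : forall i j, (arrows_of i j * arrows_of j i = 0)%N
}.

Local Notation "x %:F" := (FracField.tofrac x).

Section Mutation.
Variable n : nat.
Implicit Types (q : arrows n) (i j k : 'I_n) (s : 'S_n) (P R : seq 'I_n).

(* Away from k: add an arrow i -> j for each path i -> k -> j, then cancel
   2-cycles, which is what the truncated subtraction does. *)
Definition mutate_arrows q k : arrows n := fun i j =>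
  if (i == k) || (j == k) then q j i
  else ((q i j + q i k * q k j) - (q j i + q j k * q k i))%N.

Definition quiver_iso q q' s : bool :=
  [forall i, forall j, q' (s i) (s j) == q i j].

Local Open Scope ring_scope.

Record seed (K : fieldType) := Seed {
  seed_arrows : arrows n;
  seed_var : 'I_n -> K
}.

Definition mutate K (S : seed K) k : seed K :=
  let q := seed_arrows S in
  let x := seed_var S in
  Seed (mutate_arrows q k)
    (fun i => if i == k
              then (\prod_j x j ^+ q j k + \prod_j x j ^+ q k j) / x k
              else x i).

Definition mutate_path K (S : seed K) P : seed K := foldl (@mutate K) S P.

(* No frozen variables: clusters live in Q(x_1, ..., x_n). *)
Definition ambient_field : fieldType := {fraction {mpoly rat[n]}}.

Definition initial_var : 'I_n -> ambient_field := fun i => ('X_i)%:F.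

Definition initial_seed q : seed ambient_field := Seed q initial_var.

(* Pairs (P, sigma) with sigma an isomorphism from Q to P(Q).  Words are not
   required to be reduced: cancelling a repeated consecutive letter does not
   change the action (see [mutate_path_cancel]), so it is absorbed by the
   quotient defining the cluster modular group. *)
Definition modular_pair (Q : quiver n) :=
  {p : seq 'I_n * 'S_n |
     quiver_iso Q (seed_arrows (mutate_path (initial_seed Q) p.1)) p.2}.

HB.instance Definition _ Q := Choice.on (modular_pair Q).

Definition pair_path Q (g : modular_pair Q) : seq 'I_n := (val g).1.
Definition pair_perm Q (g : modular_pair Q) : 'S_n := (val g).2.

(* The image under g of the initial cluster variable at i. *)
Definition pair_action Q (g : modular_pair Q) i : ambient_field :=
  seed_var (mutate_path (initial_seed Q) (pair_path g)) (pair_perm g i).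

Definition acts_trivially Q (g : modular_pair Q) : bool :=
  [forall i, pair_action g i == initial_var i].

Definition same_action Q (g h : modular_pair Q) : bool :=
  [forall i, pair_action g i == pair_action h i].

Lemma same_actionP Q (g h : modular_pair Q) :
  reflect (pair_action g =1 pair_action h) (same_action g h).
Proof. exact: 'forall_eqP. Qed.

Fact same_action_equiv Q : equiv_class_of (@same_action Q).
Proof.
split=> [g|g h|h g k].
- exact/same_actionP.
- by apply/same_actionP/same_actionP => e i.
- move=> /same_actionP e /same_actionP e'; apply/same_actionP => i.
  by rewrite e.
Qed.

Canonical same_action_equivRel Q := EquivRelPack (same_action_equiv Q).

(* Pairs modulo those acting trivially: see [modular_class_eq1]. *)
Definition cluster_modular_group Q := {eq_quot (@same_action_equivRel Q)}.

HB.instance Definition _ Q := Choice.on (cluster_modular_group Q).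
HB.instance Definition _ Q := EqQuotient.on (cluster_modular_group Q).

Lemma quiver_isoP q q' s :
  reflect (forall i j, q' (s i) (s j) = q i j) (quiver_iso q q' s).
Proof.
apply: (iffP forallP) => [H i j|H i]; last by apply/forallP=> j; rewrite H.
by move/forallP: (H i) => /(_ j) /eqP.
Qed.

Lemma mutate_path_cat K (S : seed K) P R :
  mutate_path S (P ++ R) = mutate_path (mutate_path S P) R.
Proof. exact: foldl_cat. Qed.

Lemma seed_arrows_path K (S : seed K) P :
  seed_arrows (mutate_path S P) = foldl mutate_arrows (seed_arrows S) P.
Proof. by elim: P S => //= k P IH S; rewrite IH. Qed.

Definition relabel K s (S : seed K) : seed K :=
  Seed (fun i j => seed_arrows S (s i) (s j)) (fun i => seed_var S (s i)).

Lemma mutate_relabel K s (S : seed K) k :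
  mutate (relabel s S) k = relabel s (mutate S (s k)).
Proof.
rewrite /mutate /relabel /=; congr Seed.
  do 2![apply: functional_extensionality => ?].
  by rewrite /mutate_arrows !(inj_eq perm_inj).
apply: functional_extensionality => i.
rewrite (inj_eq perm_inj); case: eqP => // _; congr ((_ + _) / _).
  by rewrite [RHS](reindex_inj (@perm_inj _ s)).
by rewrite [RHS](reindex_inj (@perm_inj _ s)).
Qed.

Lemma mutate_path_relabel K s (S : seed K) R :
  mutate_path (relabel s S) R = relabel s (mutate_path S (map s R)).
Proof. by elim: R S => //= k R IH S; rewrite -IH mutate_relabel. Qed.

Lemma relabel_pair Q (g : modular_pair Q) :
  relabel (pair_perm g) (mutate_path (initial_seed Q) (pair_path g)) =
  Seed Q (pair_action g).
Proof.
rewrite /relabel; congr Seed.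
do 2![apply: functional_extensionality => ?].
by have /quiver_isoP -> := valP g.
Qed.

Lemma relabel_pair_path Q (g : modular_pair Q) R :
  relabel (pair_perm g)
    (mutate_path (initial_seed Q) (pair_path g ++ map (pair_perm g) R)) =
  mutate_path (Seed Q (pair_action g)) R.
Proof. by rewrite -relabel_pair mutate_path_relabel mutate_path_cat. Qed.

(* Cluster variables have a subtraction-free expression, so they take a positive
   value at (1, ..., 1); this is how their nonvanishing is proved. *)

Local Notation one_pt := (fun _ : 'I_n => 1 : rat).

Definition positive (f : ambient_field) :=
  exists a b : {mpoly rat[n]},
    [/\ f = a%:F / b%:F, 0 < a.@[one_pt] & 0 < b.@[one_pt]].

Lemma eval_neq0 (a : {mpoly rat[n]}) : 0 < a.@[one_pt] -> a%:F != 0.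
Proof.
by rewrite tofrac_eq0; apply: contraTneq => ->; rewrite meval0 ltxx.
Qed.

Lemma positive_neq0 f : positive f -> f != 0.
Proof.
by case=> a [b [-> a0 b0]]; rewrite mulf_neq0 ?invr_eq0 ?eval_neq0.
Qed.

Lemma positiveD f g : positive f -> positive g -> positive (f + g).
Proof.
move=> [a [b [-> a0 b0]]] [c [d [-> c0 d0]]].
exists (a * d + c * b), (b * d).
rewrite addf_div ?eval_neq0 // tofracD !tofracM; split=> //.
  by rewrite mevalD !mevalM addr_gt0 ?mulr_gt0.
by rewrite mevalM mulr_gt0.
Qed.

Lemma positiveM f g : positive f -> positive g -> positive (f * g).
Proof.
move=> [a [b [-> a0 b0]]] [c [d [-> c0 d0]]].
by exists (a * c), (b * d); rewrite mulf_div !tofracM !mevalM !mulr_gt0.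
Qed.

Lemma positiveV f : positive f -> positive f^-1.
Proof. by case=> a [b [-> a0 b0]]; exists b, a; rewrite invf_div. Qed.

Lemma positive1 : positive 1.
Proof. by exists 1, 1; rewrite tofrac1 divr1 !meval1. Qed.

Lemma positiveX f m : positive f -> positive (f ^+ m).
Proof.
move=> f0; elim: m => [|m IH]; first exact: positive1.
by rewrite exprS; apply: positiveM.
Qed.

Lemma positive_prod (F : 'I_n -> ambient_field) :
  (forall i, positive (F i)) -> positive (\prod_i F i).
Proof.
move=> F0; elim/big_ind: _ => //; first exact: positive1.
exact: positiveM.
Qed.

Lemma positive_initial i : positive (initial_var i).
Proof.
exists 'X_i, 1; rewrite tofrac1 divr1 mevalXU meval1.
by split; rewrite ?ltr01.
Qed.

Definition positive_seed (S : seed ambient_field) :=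
  forall i, positive (seed_var S i).

Lemma positive_exchange (S : seed ambient_field) k : positive_seed S ->
  let q := seed_arrows S in
  positive (\prod_j seed_var S j ^+ q j k + \prod_j seed_var S j ^+ q k j).
Proof.
by move=> S0 q; apply: positiveD; apply: positive_prod => j; apply: positiveX.
Qed.

Lemma positive_mutate S k : positive_seed S -> positive_seed (mutate S k).
Proof.
move=> S0 i /=; case: eqP => // _.
by apply: positiveM; [apply: positive_exchange | apply: positiveV].
Qed.

Lemma positive_path S P : positive_seed S -> positive_seed (mutate_path S P).
Proof. by elim: P S => //= k P IH S /(positive_mutate k) /IH. Qed.

Lemma positive_initial_seed q : positive_seed (initial_seed q).
Proof. exact: positive_initial. Qed.

Definition no2cycle q := forall i j, (q i j * q j i = 0)%N.


Lemma no2cycle_mutate q k : no2cycle q -> no2cycle (mutate_arrows q k).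
Proof.
move=> q0 i j; rewrite /mutate_arrows (orbC (j == k)).
case: ifP => _; first exact: q0.
move: (_ + _)%N (_ + _)%N => a b.
by apply/eqP; rewrite muln_eq0 !subn_eq0 leq_total.
Qed.

Lemma mutate_arrowsK q k :
  no2cycle q -> mutate_arrows (mutate_arrows q k) k = q.
Proof.
move=> q0; apply: functional_extensionality => i; apply: functional_extensionality => j.
rewrite /mutate_arrows !eqxx !orbT !orTb /= orbC.
case: (eqVneq i k) => [->|ik]; first by rewrite orbT.
case: (eqVneq j k) => [->|jk] //=.
have := q0 i j; have := q0 i k; have := q0 j k.
move/eqP; rewrite muln_eq0 => /orP[]/eqP->;
  move/eqP; rewrite muln_eq0 => /orP[]/eqP->;
  move/eqP; rewrite muln_eq0 => /orP[]/eqP->;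
  rewrite ?muln0 ?mul0n ?addn0 ?add0n ?subn0 ?sub0n ?addn0 ?add0n ?subn0;
  nia.
Qed.

Lemma mutateK (S : seed ambient_field) k :
  no2cycle (seed_arrows S) -> positive_seed S -> mutate (mutate S k) k = S.
Proof.
case: S => q x q0 S0; rewrite /mutate /= mutate_arrowsK //; congr Seed.
apply: functional_extensionality => i; case: eqP => [->|_ //].
rewrite eqxx.
have M0 := positive_neq0 (positive_exchange k S0); rewrite /= in M0.
have /eqP := q0 k k; rewrite muln_eq0 orbb => /eqP /= qkk.
set N := (X in X / _); set M := (X in _ / (X / _)) in M0 *.
suff -> : N = M by rewrite invf_div mulrC divfK.
rewrite /N /M addrC; congr (_ + _); apply: eq_bigr => j _;
  rewrite /mutate_arrows eqxx ?orbT //=; case: eqP => [->|//];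
  by rewrite qkk !expr0.
Qed.

Lemma no2cycle_path q P : no2cycle q -> no2cycle (foldl mutate_arrows q P).
Proof. by elim: P q => //= k P IH q /(no2cycle_mutate k) /IH. Qed.

Lemma mutate_path_cancel (Q : quiver n) P k R :
  mutate_path (initial_seed Q) (P ++ k :: k :: R) =
  mutate_path (initial_seed Q) (P ++ R).
Proof.
rewrite !mutate_path_cat /= mutateK // ?seed_arrows_path.
  exact/no2cycle_path/quiver_no2cycle.
exact/positive_path/positive_initial_seed.
Qed.

Lemma mutate_path_rev (Q : quiver n) P :
  mutate_path (initial_seed Q) (P ++ rev P) = initial_seed Q.
Proof.
elim/last_ind: P => // P k IH.
by rewrite rev_rcons cat_rcons mutate_path_cancel.
Qed.

(* [evaluates y f v] : the rational function f is defined at the point y, with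
   value v. *)

Definition eval (y : 'I_n -> ambient_field) : {mpoly rat[n]} -> ambient_field :=
  mmap (@FracField.tofrac _ \o @mpolyC n rat) y.

Lemma evalD y : {morph eval y : a b / a + b}.
Proof. exact: mmapD. Qed.

Lemma evalM y : {morph eval y : a b / a * b}.
Proof. by move=> a b; rewrite /eval rmorphM. Qed.

Lemma eval1 y : eval y 1 = 1.
Proof. by rewrite /eval rmorph1. Qed.

Definition evaluates (y : 'I_n -> ambient_field) (f v : ambient_field) :=
  exists a b : {mpoly rat[n]},
    [/\ f = a%:F / b%:F, eval y b != 0 & v = eval y a / eval y b].

Lemma tofrac_neq0_eval y b : eval y b != 0 -> b%:F != 0.
Proof. by rewrite tofrac_eq0; apply: contraNneq => ->; rewrite /eval raddf0. Qed.

Lemma evaluates_inj y f v w : evaluates y f v -> evaluates y f w -> v = w.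
Proof.
move=> [a [b [-> b0 ->]]] [c [d [/eqP e d0 ->]]]; apply/eqP.
have [bF dF] := (tofrac_neq0_eval b0, tofrac_neq0_eval d0).
move: e; rewrite (eqr_div _ _ bF dF) (eqr_div _ _ b0 d0).
by rewrite -!tofracM tofrac_eq => /eqP e; rewrite -!evalM e.
Qed.

Lemma evaluatesD y f g v w :
  evaluates y f v -> evaluates y g w -> evaluates y (f + g) (v + w).
Proof.
move=> [a [b [-> b0 ->]]] [c [d [-> d0 ->]]].
have [bF dF] := (tofrac_neq0_eval b0, tofrac_neq0_eval d0).
exists (a * d + c * b), (b * d).
rewrite (addf_div _ _ bF dF) (addf_div _ _ b0 d0) tofracD !tofracM evalD !evalM.
split; [reflexivity | exact: mulf_neq0 b0 d0 | reflexivity].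
Qed.

Lemma evaluatesM y f g v w :
  evaluates y f v -> evaluates y g w -> evaluates y (f * g) (v * w).
Proof.
move=> [a [b [-> b0 ->]]] [c [d [-> d0 ->]]].
exists (a * c), (b * d); rewrite !mulf_div !tofracM !evalM.
split; [reflexivity | exact: mulf_neq0 b0 d0 | reflexivity].
Qed.

Lemma evaluatesV y f v : v != 0 -> evaluates y f v -> evaluates y f^-1 v^-1.
Proof.
move=> v0 [a [b [-> b0 e]]]; exists b, a; rewrite e !invf_div.
split; [reflexivity | | reflexivity].
by clear b0; move: v0; rewrite e mulf_eq0 negb_or => /andP[].
Qed.

Lemma evaluates1 y : evaluates y 1 1.
Proof. by exists 1, 1; rewrite eval1 tofrac1 !divr1 oner_neq0. Qed.

Lemma evaluatesX y f v m : evaluates y f v -> evaluates y (f ^+ m) (v ^+ m).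
Proof.
move=> e; elim: m => [|m IH]; first exact: evaluates1.
by rewrite !exprS; apply: evaluatesM.
Qed.

Lemma evaluates_initial y i : evaluates y (initial_var i) (y i).
Proof.
exists 'X_i, 1; rewrite eval1 tofrac1 !divr1 /eval mmapX mmap1U.
split; [reflexivity | exact: oner_neq0 | reflexivity].
Qed.

Lemma evaluates_mutate y S T k :
  seed_arrows S = seed_arrows T -> seed_var T k != 0 ->
  (forall i, evaluates y (seed_var S i) (seed_var T i)) ->
  forall i, evaluates y (seed_var (mutate S k) i) (seed_var (mutate T k) i).
Proof.
move=> eST Tk0 e i /=; rewrite eST; case: eqP => // _.
apply: evaluatesM; last exact: evaluatesV.
by apply: evaluatesD; elim/big_ind2: _ => *;
  (exact: evaluates1 || exact: evaluatesM || exact: evaluatesX).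
Qed.

Lemma evaluates_path q y P : positive_seed (Seed q y) ->
  forall i, evaluates y (seed_var (mutate_path (initial_seed q) P) i)
                        (seed_var (mutate_path (Seed q y) P) i).
Proof.
move=> y0; elim/last_ind: P => [|P k IH]; first exact: evaluates_initial.
rewrite -!cats1 !mutate_path_cat /=; apply: evaluates_mutate => //.
  by rewrite !seed_arrows_path.
exact/positive_neq0/positive_path.
Qed.

Lemma positive_action Q (g : modular_pair Q) :
  positive_seed (Seed Q (pair_action g)).
Proof. by move=> i; apply/positive_path/positive_initial_seed. Qed.

(* MathComp composes permutations from left to right, so the permutation
   sigma tau of the product (P, sigma) (R, tau) = (P . sigma(R), sigma tau),
   which applies tau first, is [tau * sigma]. *)

Fact trivial_pair_subproof (Q : quiver n) :
  quiver_iso Q (seed_arrows (mutate_path (initial_seed Q) [::])) 1%g.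
Proof. by apply/quiver_isoP => i j; rewrite !perm1. Qed.

Definition trivial_pair Q : modular_pair Q :=
  exist _ ([::], 1%g) (trivial_pair_subproof Q).

Fact comp_pair_subproof Q (g h : modular_pair Q) :
  quiver_iso Q
    (seed_arrows (mutate_path (initial_seed Q)
       (pair_path g ++ map (pair_perm g) (pair_path h))))
    (pair_perm h * pair_perm g)%g.
Proof.
apply/quiver_isoP => i j; rewrite !permM.
have /(congr1 (@seed_arrows _)) := relabel_pair_path g (pair_path h).
rewrite [RHS]seed_arrows_path /=.
move=> /(congr1 (fun q => q (pair_perm h i) (pair_perm h j))) ->.
by have /quiver_isoP/(_ i j) := valP h; rewrite seed_arrows_path.
Qed.

Definition comp_pair Q (g h : modular_pair Q) : modular_pair Q :=
  exist _ (pair_path g ++ map (pair_perm g) (pair_path h),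
           (pair_perm h * pair_perm g)%g)
    (comp_pair_subproof g h).

Fact inverse_pair_subproof Q (g : modular_pair Q) :
  quiver_iso Q
    (seed_arrows (mutate_path (initial_seed Q)
       (map (pair_perm g)^-1%g (rev (pair_path g)))))
    (pair_perm g)^-1%g.
Proof.
apply/quiver_isoP => i j.
have := relabel_pair_path g (map (pair_perm g)^-1%g (rev (pair_path g))).
rewrite -map_comp map_id_in => [|k _]; last by rewrite /= permKV.
rewrite mutate_path_rev => /(congr1 (@seed_arrows _)).
rewrite !seed_arrows_path /= => <-.
by rewrite !permKV.
Qed.

Definition inverse_pair Q (g : modular_pair Q) : modular_pair Q :=
  exist _ (map (pair_perm g)^-1%g (rev (pair_path g)), (pair_perm g)^-1%g)
    (inverse_pair_subproof g).

Lemma comp_pair_action Q (g h : modular_pair Q) i :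
  pair_action (comp_pair g h) i =
  seed_var (mutate_path (Seed Q (pair_action g)) (pair_path h)) (pair_perm h i).
Proof. by rewrite -relabel_pair_path /= -permM. Qed.

Lemma comp_pair_congr Q (g g' h h' : modular_pair Q) :
  pair_action g =1 pair_action g' -> pair_action h =1 pair_action h' ->
  pair_action (comp_pair g h) =1 pair_action (comp_pair g' h').
Proof.
move=> /functional_extensionality eg eh i; rewrite !comp_pair_action -eg.
have gP := positive_action g.
apply: (@evaluates_inj (pair_action g) (pair_action h i)).
  exact: evaluates_path.
by rewrite eh; apply: evaluates_path.
Qed.

Lemma mul1_pair Q (g : modular_pair Q) :
  pair_action (comp_pair (trivial_pair Q) g) =1 pair_action g.
Proof.
move=> i; rewrite comp_pair_action; congr (seed_var (mutate_path _ _) _).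
by congr Seed; apply: functional_extensionality => j; rewrite /pair_action perm1.
Qed.

Lemma comp_pair1 Q (g : modular_pair Q) :
  pair_action (comp_pair g (trivial_pair Q)) =1 pair_action g.
Proof. by move=> i; rewrite comp_pair_action /= perm1. Qed.

Lemma comp_pairA Q : associative (@comp_pair Q).
Proof.
move=> g h k; apply: val_inj; rewrite /= /pair_path /pair_perm /=.
rewrite map_cat catA mulgA -map_comp; congr (_ ++ _, _).
by apply: eq_map => i; rewrite /= permM.
Qed.

Lemma comp_pairV Q (g : modular_pair Q) :
  pair_action (comp_pair g (inverse_pair g)) =1 pair_action (trivial_pair Q).
Proof.
move=> i; rewrite /pair_action /pair_path /pair_perm /= mulVg.
rewrite -map_comp map_id_in => [|k _]; last by rewrite /= permKV.
by rewrite mutate_path_rev.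
Qed.

Lemma mulV_pair Q (g : modular_pair Q) :
  pair_action (comp_pair (inverse_pair g) g) =1 pair_action (trivial_pair Q).
Proof.
move=> i; rewrite /pair_action /pair_path /pair_perm /= mulgV.
set P := (val g).1; set s := (val g).2.
by have := mutate_path_rev Q (rev (map s^-1%g P)); rewrite revK -map_rev => ->.
Qed.

Section Group.
Variable Q : quiver n.
Implicit Types (g h : modular_pair Q).
Implicit Types (x y z : cluster_modular_group Q).

Definition modular_class g : cluster_modular_group Q := \pi g.

Lemma modular_classP g h :
  modular_class g = modular_class h <-> pair_action g =1 pair_action h.
Proof.
split=> [/eqmodP|] e; first exact/same_actionP.
exact/eqmodP/same_actionP.
Qed.

Lemma modular_classK x : modular_class (repr x) = x.
Proof. exact: reprK. Qed.

Lemma repr_action g : pair_action (repr (modular_class g)) =1 pair_action g.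
Proof. by apply/modular_classP; rewrite modular_classK. Qed.

Definition mul_class x y := modular_class (comp_pair (repr x) (repr y)).
Definition inv_class x := modular_class (inverse_pair (repr x)).
Definition one_class := modular_class (trivial_pair Q).

Lemma mul_classE g h :
  mul_class (modular_class g) (modular_class h) = modular_class (comp_pair g h).
Proof. by apply/modular_classP/comp_pair_congr; apply: repr_action. Qed.

Fact mul_classA : associative mul_class.
Proof.
move=> x y z; rewrite -[x]modular_classK -[y]modular_classK -[z]modular_classK.
by rewrite !mul_classE comp_pairA.
Qed.

Fact mul1_class : left_id one_class mul_class.
Proof.
move=> x; rewrite -[x]modular_classK mul_classE.
exact/modular_classP/mul1_pair.
Qed.

Fact mul_class1 : right_id one_class mul_class.
Proof.
move=> x; rewrite -[x]modular_classK mul_classE.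
exact/modular_classP/comp_pair1.
Qed.

Fact mulV_class : left_inverse one_class inv_class mul_class.
Proof.
move=> x; rewrite /inv_class -{2}[x]modular_classK mul_classE.
exact/modular_classP/mulV_pair.
Qed.

Fact mul_classV : right_inverse one_class inv_class mul_class.
Proof.
move=> x; rewrite /inv_class -{1}[x]modular_classK mul_classE.
exact/modular_classP/comp_pairV.
Qed.

HB.instance Definition _ := isGroup.Build (cluster_modular_group Q)
  mul_classA mul1_class mul_class1 mulV_class mul_classV.

Lemma modular_classM g h :
  (modular_class (comp_pair g h) = modular_class g * modular_class h)%g.
Proof. exact/esym/mul_classE. Qed.

Lemma modular_class_eq1 g : (modular_class g = 1%g) <-> acts_trivially g.
Proof.
split=> [/modular_classP e|/forallP e].
  by apply/forallP => i; rewrite e /pair_action perm1.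
by apply/modular_classP => i; rewrite (eqP (e i)) /pair_action perm1.
Qed.

End Group.

End Mutation.

(* The quiver of type E_7^(1,1), that is T_{(4,4,2),(1,1,1)}. *)

Definition N_1 : 'I_9 := @Ordinal 9 0 isT.
Definition N_oo : 'I_9 := @Ordinal 9 1 isT.
Definition n1_2 : 'I_9 := @Ordinal 9 2 isT.
Definition n1_3 : 'I_9 := @Ordinal 9 3 isT.
Definition n1_4 : 'I_9 := @Ordinal 9 4 isT.
Definition n2_2 : 'I_9 := @Ordinal 9 5 isT.
Definition n2_3 : 'I_9 := @Ordinal 9 6 isT.
Definition n2_4 : 'I_9 := @Ordinal 9 7 isT.
Definition n3_2 : 'I_9 := @Ordinal 9 8 isT.

Definition T442_arrow_list : seq ('I_9 * 'I_9) :=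
  [:: (N_oo, N_1); (N_oo, N_1);
      (N_1, n1_2); (N_1, n2_2); (N_1, n3_2);
      (n1_2, N_oo); (n2_2, N_oo); (n3_2, N_oo);
      (n1_3, n1_2); (n1_3, n1_4); (n2_3, n2_2); (n2_3, n2_4)].

Definition T442_arrows : arrows 9 := fun i j => count_mem (i, j) T442_arrow_list.

Lemma forall_ord9 (P : 'I_9 -> Prop) :
  P N_1 -> P N_oo -> P n1_2 -> P n1_3 -> P n1_4 -> P n2_2 -> P n2_3 ->
  P n2_4 -> P n3_2 -> forall i, P i.
Proof.
move=> p0 p1 p2 p3 p4 p5 p6 p7 p8 [m lt_m].
by do 9![case: m lt_m => [|m] lt_m; first by rewrite (bool_irrelevance lt_m isT)].
Qed.

Fact T442_no2cycle i j : (T442_arrows i j * T442_arrows j i = 0)%N.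
Proof. by move: i j; apply: forall_ord9; apply: forall_ord9. Qed.

Definition T442 : quiver 9 := Quiver T442_no2cycle.

Fact gamma_subproof :
  quiver_iso T442 (seed_arrows (mutate_path (initial_seed T442) [:: N_oo]))
    (tperm N_1 N_oo).
Proof.
apply/quiver_isoP => i j; rewrite !permE.
by move: i j; apply: forall_ord9; apply: forall_ord9.
Qed.

Definition gamma_pair : modular_pair T442 :=
  exist _ ([:: N_oo], tperm N_1 N_oo) gamma_subproof.

Definition gamma : cluster_modular_group T442 := modular_class gamma_pair.

Section ModularGroup.
Local Open Scope ring_scope.

Definition SL2Z := {A : 'M[int]_2 | \det A == 1}.

HB.instance Definition _ := Choice.on SL2Z.

Implicit Types A B C : SL2Z.

Lemma SL2Z_det A : \det (val A) = 1.
Proof. exact/eqP/(valP A). Qed.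

Lemma SL2Z_unit A : val A \in unitmx.
Proof. by rewrite unitmxE SL2Z_det unitr1. Qed.

Fact SL2Z_one_subproof : \det (1%:M : 'M[int]_2) == 1.
Proof. by rewrite det1. Qed.

Fact SL2Z_mul_subproof A B : \det (val A *m val B) == 1.
Proof. by rewrite det_mulmx !SL2Z_det mulr1. Qed.

Fact SL2Z_inv_subproof A : \det (invmx (val A)) == 1.
Proof. by rewrite det_inv SL2Z_det invr1. Qed.

Fact SL2Z_opp_subproof A : \det (- val A) == 1.
Proof. by rewrite -scaleN1r detZ SL2Z_det mulr1. Qed.

Definition SL2Z_one : SL2Z := exist _ 1%:M SL2Z_one_subproof.
Definition SL2Z_mul A B : SL2Z := exist _ (val A *m val B) (SL2Z_mul_subproof A B).
Definition SL2Z_inv A : SL2Z := exist _ (invmx (val A)) (SL2Z_inv_subproof A).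
Definition SL2Z_opp A : SL2Z := exist _ (- val A) (SL2Z_opp_subproof A).

Fact SL2Z_mulA : associative SL2Z_mul.
Proof. by move=> A B C; apply: val_inj; rewrite /= mulmxA. Qed.

Fact SL2Z_mul1l : left_id SL2Z_one SL2Z_mul.
Proof. by move=> A; apply: val_inj; rewrite /= mul1mx. Qed.

Fact SL2Z_mul1r : right_id SL2Z_one SL2Z_mul.
Proof. by move=> A; apply: val_inj; rewrite /= mulmx1. Qed.

Fact SL2Z_mulVl : left_inverse SL2Z_one SL2Z_inv SL2Z_mul.
Proof. by move=> A; apply: val_inj; rewrite /= mulVmx ?SL2Z_unit. Qed.

Fact SL2Z_mulVr : right_inverse SL2Z_one SL2Z_inv SL2Z_mul.
Proof. by move=> A; apply: val_inj; rewrite /= mulmxV ?SL2Z_unit. Qed.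

HB.instance Definition _ := isGroup.Build SL2Z
  SL2Z_mulA SL2Z_mul1l SL2Z_mul1r SL2Z_mulVl SL2Z_mulVr.

Definition eq_up_to_sign A B : bool := (A == B) || (A == SL2Z_opp B).

Lemma SL2Z_oppK : involutive SL2Z_opp.
Proof. by move=> A; apply: val_inj; rewrite /= opprK. Qed.

Fact eq_up_to_sign_equiv : equiv_class_of eq_up_to_sign.
Proof.
split=> [A|A B|B A C]; rewrite /eq_up_to_sign.
- by rewrite eqxx.
- by rewrite (eq_sym B A) -(can_eq SL2Z_oppK B) SL2Z_oppK (eq_sym _ A).
- by case/orP=> /eqP-> /orP[]/eqP->; rewrite ?SL2Z_oppK eqxx ?orbT.
Qed.

Canonical eq_up_to_sign_equivRel := EquivRelPack eq_up_to_sign_equiv.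

Definition PSL2Z := {eq_quot eq_up_to_sign_equivRel}.

HB.instance Definition _ := Choice.on PSL2Z.
HB.instance Definition _ := EqQuotient.on PSL2Z.

Definition SL2Z_class A : PSL2Z := \pi A.

Lemma SL2Z_classP A B : reflect (SL2Z_class A = SL2Z_class B) (eq_up_to_sign A B).
Proof. by apply: (iffP idP) => /eqmodP. Qed.

Lemma SL2Z_classK (x : PSL2Z) : SL2Z_class (repr x) = x.
Proof. exact: reprK. Qed.

Definition PSL2Z_mul (x y : PSL2Z) := SL2Z_class (repr x * repr y)%g.
Definition PSL2Z_inv (x : PSL2Z) := SL2Z_class (repr x)^-1%g.
Definition PSL2Z_one := SL2Z_class 1%g.

Lemma repr_SL2Z_class A : eq_up_to_sign (repr (SL2Z_class A)) A.
Proof. by apply/SL2Z_classP; rewrite SL2Z_classK. Qed.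

Lemma PSL2Z_mulE A B :
  PSL2Z_mul (SL2Z_class A) (SL2Z_class B) = SL2Z_class (A * B)%g.
Proof.
apply/SL2Z_classP.
have mulN C D : (SL2Z_opp C * D = SL2Z_opp (C * D))%g.
  by apply: val_inj; rewrite /= mulNmx.
have mulrN C D : (C * SL2Z_opp D = SL2Z_opp (C * D))%g.
  by apply: val_inj; rewrite /= mulmxN.
case/orP: (repr_SL2Z_class A) => /eqP->; case/orP: (repr_SL2Z_class B) => /eqP->;
  by rewrite ?mulN ?mulrN ?SL2Z_oppK /eq_up_to_sign eqxx ?orbT.
Qed.

Fact PSL2Z_mulA : associative PSL2Z_mul.
Proof.
move=> x y z; rewrite -[x]SL2Z_classK -[y]SL2Z_classK -[z]SL2Z_classK.
by rewrite !PSL2Z_mulE mulgA.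
Qed.

Fact PSL2Z_mul1l : left_id PSL2Z_one PSL2Z_mul.
Proof. by move=> x; rewrite -[x]SL2Z_classK PSL2Z_mulE mul1g. Qed.

Fact PSL2Z_mul1r : right_id PSL2Z_one PSL2Z_mul.
Proof. by move=> x; rewrite -[x]SL2Z_classK PSL2Z_mulE mulg1. Qed.

Fact PSL2Z_mulVl : left_inverse PSL2Z_one PSL2Z_inv PSL2Z_mul.
Proof. by move=> x; rewrite /PSL2Z_inv -{2}[x]SL2Z_classK PSL2Z_mulE mulVg. Qed.

Fact PSL2Z_mulVr : right_inverse PSL2Z_one PSL2Z_inv PSL2Z_mul.
Proof. by move=> x; rewrite /PSL2Z_inv -{1}[x]SL2Z_classK PSL2Z_mulE mulgV. Qed.

HB.instance Definition _ := isGroup.Build PSL2Z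
  PSL2Z_mulA PSL2Z_mul1l PSL2Z_mul1r PSL2Z_mulVl PSL2Z_mulVr.

Definition principal_congruence (N : nat) : SL2Z -> Prop :=
  fun A => forall i j, (val A i j = (1%:M : 'M[int]_2) i j %[mod N%:Z])%Z.

Definition projective_congruence (N : nat) : PSL2Z -> Prop :=
  fun x => exists2 A, principal_congruence N A & SL2Z_class A = x.

End ModularGroup.

(* Main.v *)
Require Import Defs.
From Stdlib Require Import FunctionalExtensionality ClassicalEpsilon PArith FMapPositive.
From mathcomp Require Import all_boot all_order all_algebra all_fingroup.
From mathcomp Require Import generic_quotient fraction mpoly ring zify.

Set Implicit Arguments.
Unset Strict Implicit.
Unset Printing Implicit Defensive.

Import Order.TTheory GRing.Theory Num.Theory.

(* The mutation class of T_{(4,4,2),(1,1,1)} consists of 506 quivers.  A spanning tree of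
   the quotient of the exchange graph by Gamma, five further edges (the first one is gamma)
   and chains of squares and pentagons present every edge of the quotient as a word in
   five elements gamma, a, c, t, e, and other squares and pentagons give the relations
   [modular_relations] between them: Gamma is an extension of PSL(2, Z), generated by the
   images of t and e, by a group of order 16.  A rewriting system for these relations
   shows that the normal closure of gamma = t^-4 is generated by t^-4 and its conjugates
   by t^j e, 0 <= j <= 3, and has at most 384 cosets.

   The only lower bound needed is that these five elements are free.  Tropicalizing the
   cluster variables, Gamma acts on the integral functions v |-> |det (x, v)|, where x
   runs through nine vectors of Z^2; on v this is an action of SL(2, Z) up to sign, where
   the five elements are parabolic and pair the sides of an ideal decagon, so that ping-pong
   applies.  The same rewriting argument inside PSL(2, Z), where a = 1, shows that the five
   parabolic matrices generate the image of the level 4 congruence subgroup: the 24 coset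
   representatives are distinct modulo 4 up to sign. *)

(** * Square and pentagon relations of mutations *)

(** Elements of Gamma are tuples of rational functions in nine variables, far too large to compute
    with. Squares and pentagons are therefore proved once for arbitrary seeds, and all computation
    concerns quivers, permutations and words in five unknown group elements. A relation arises when
    one labelled seed is reached in two ways, because Gamma acts freely on labelled seeds. The
    numbers come from the modular curve of level 4, a sphere with six cusps on which the quotient of
    order 24 acts. Its fundamental group is free of rank five, generated by loops around five of the
    cusps. The slopes oo, 2, 3, 4, 5 represent these cusps, and the other five vertices of the
    decagon form the sixth; the area 8 pi of the decagon is 24 times the area pi/3 of the modular
    surface. The 384 cosets are 24 times the order 16 of the kernel. Normal closure and congruence
    subgroup are both free on the same five expressions in t and e, so the isomorphism is read off
    from words. *)

Section Exchange.
Variable n : nat.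
Implicit Types (q : arrows n) (i j k : 'I_n).
Local Open Scope ring_scope.

(** The skew-symmetric exchange matrix. Passing to it removes truncated subtraction ([net_mutate])
    and loses nothing on quivers without 2-cycles ([net_inj]). *)
Definition net q i j : int := (q i j)%:Z - (q j i)%:Z.

Lemma net_inj q q' : no2cycle q -> no2cycle q' ->
  (forall i j, net q i j = net q' i j) -> q = q'.
Proof.
move=> q0 q0' e; apply: functional_extensionality => i.
apply: functional_extensionality => j.
move: (q0 i j) (q0' i j) (e i j); rewrite /net.
by move=> /eqP; rewrite muln_eq0 => /orP[]/eqP-> /eqP;
  rewrite muln_eq0 => /orP[]/eqP->; lia.
Qed.

Lemma net_mutate q k i j : i != k -> j != k ->
  net (mutate_arrows q k) i j =
  net q i j + (q i k * q k j)%N%:Z - (q j k * q k i)%N%:Z.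
Proof.
move=> /negPf ik /negPf jk; rewrite /net /mutate_arrows ik jk /=; lia.
Qed.

Lemma mutate_into q k i : mutate_arrows q k i k = q k i.
Proof. by rewrite /mutate_arrows eqxx orbT. Qed.

Lemma mutate_from q k i : mutate_arrows q k k i = q i k.
Proof. by rewrite /mutate_arrows eqxx. Qed.

Lemma mutate_away q k i j : i != k -> j != k -> mutate_arrows q k i j =
  ((q i j + q i k * q k j) - (q j i + q j k * q k i))%N.
Proof. by move=> /negPf ik /negPf jk; rewrite /mutate_arrows ik jk. Qed.

Lemma no2cycle_loop q i : no2cycle q -> q i i = 0%N.
Proof. by move/(_ i i)/eqP; rewrite muln_eq0 orbb => /eqP. Qed.

(** A path through i neither starts nor ends at k, so mutation at i leaves the arrows at k alone. *)
Lemma mutate_unlinked q i k a : no2cycle q -> i != k ->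
  q i k = 0%N -> q k i = 0%N ->
  (mutate_arrows q i a k = q a k) * (mutate_arrows q i k a = q k a).
Proof.
move=> q0 ik e1 e2; case: (eqVneq a i) => [->|ai].
  by rewrite mutate_from mutate_into e1 e2.
have ki : k != i by rewrite eq_sym.
have := q0 a k; rewrite !mutate_away // e1 e2 !muln0 !mul0n.
by move/eqP; rewrite muln_eq0 => /orP[]/eqP->; split; lia.
Qed.

Lemma square_arrows q i k : no2cycle q -> i != k ->
  q i k = 0%N -> q k i = 0%N ->
  mutate_arrows (mutate_arrows q i) k = mutate_arrows (mutate_arrows q k) i.
Proof.
move=> q0 ik e1 e2; have ki : k != i by rewrite eq_sym.
apply: net_inj; try by do 2!apply: no2cycle_mutate.
(* The arrows at one of the two nodes are reversed by its own mutation and untouched by the other,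
   in either order: [swap] mutates at k' last, [far] first. *)
have swap i' k' a b : i' != k' -> q i' k' = 0%N -> q k' i' = 0%N ->
    b != i' -> net (mutate_arrows (mutate_arrows q i') k') k' b = net q b k' /\
    net (mutate_arrows (mutate_arrows q i') k') b k' = net q k' b.
  by move=> ik' e1' e2' bi; rewrite /net !mutate_from !mutate_into
    !(mutate_unlinked _ q0 ik' e1' e2').
have far i' k' b : i' != k' -> q i' k' = 0%N -> q k' i' = 0%N ->
    b != k' -> net (mutate_arrows (mutate_arrows q k') i') k' b = net q b k' /\
    net (mutate_arrows (mutate_arrows q k') i') b k' = net q k' b.
  move=> ik' e1' e2' bk; have q1 := no2cycle_mutate k' q0.
  have m1 : mutate_arrows q k' i' k' = 0%N by rewrite mutate_into.
  have m2 : mutate_arrows q k' k' i' = 0%N by rewrite mutate_from.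
  by rewrite /net !(mutate_unlinked _ q1 ik' m1 m2) !mutate_from !mutate_into.
move=> a b.
case: (eqVneq a k) => [->|ak].
  case: (eqVneq b k) => [->|bk]; first by rewrite /net !subrr.
  rewrite (far i k b ik e1 e2 bk).1 /net !mutate_from !mutate_into.
  by rewrite !(mutate_unlinked _ q0 ik e1 e2).
case: (eqVneq b k) => [->|bk].
  rewrite (far i k a ik e1 e2 ak).2 /net !mutate_from !mutate_into.
  by rewrite !(mutate_unlinked _ q0 ik e1 e2).
case: (eqVneq a i) => [->|ai].
  case: (eqVneq b i) => [->|bi]; first by rewrite /net !subrr.
  rewrite (far k i b ki e2 e1 bi).1 /net !mutate_from !mutate_into.
  by rewrite !(mutate_unlinked _ q0 ki e2 e1).
case: (eqVneq b i) => [->|bi].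
  rewrite (far k i a ki e2 e1 ai).2 /net !mutate_from !mutate_into.
  by rewrite !(mutate_unlinked _ q0 ki e2 e1).
rewrite !net_mutate // !(mutate_unlinked _ q0 ik e1 e2).
by rewrite !(mutate_unlinked _ q0 ki e2 e1); ring.
Qed.

Section Pentagon.
Variables (q : arrows n) (i k : 'I_n).
Hypotheses (q0 : no2cycle q) (qik : q i k = 1%N).

Let ik : i != k.
Proof. by apply/eqP => e; move: (no2cycle_loop i q0); rewrite {2}e qik. Qed.

Let ki : k != i. Proof. by rewrite eq_sym. Qed.

Let qki : q k i = 0%N. Proof. by move: (q0 i k); rewrite qik mul1n. Qed.

(** The indices record the mutations performed: the long way i, k, i and the short way k, i round
    the pentagon end at the same quiver up to the transposition of i and k. *)
Let q_i := mutate_arrows q i.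
Let q_ik := mutate_arrows q_i k.
Let q_iki := mutate_arrows q_ik i.
Let q_k := mutate_arrows q k.
Let q_ki := mutate_arrows q_k i.

Let link_i : (q_i i k = 0%N) * (q_i k i = 1%N).
Proof. by rewrite /q_i mutate_from mutate_into qik qki. Qed.
Let link_ik : (q_ik i k = 1%N) * (q_ik k i = 0%N).
Proof. by rewrite /q_ik mutate_from mutate_into !link_i. Qed.
Let link_k : (q_k i k = 0%N) * (q_k k i = 1%N).
Proof. by rewrite /q_k mutate_from mutate_into qik qki. Qed.
Let link_ki : (q_ki i k = 1%N) * (q_ki k i = 0%N).
Proof. by rewrite /q_ki mutate_from mutate_into !link_k. Qed.
Let link_iki : (q_iki i k = 0%N) * (q_iki k i = 1%N).
Proof. by rewrite /q_iki mutate_from mutate_into !link_ik. Qed.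

Section Column.
Variable a : 'I_n.
Hypotheses (ai : a != i) (ak : a != k).

Let arrow_i :
  (q_i a k = q a k + q a i - q k a)%N * (q_i k a = q k a - (q a k + q a i))%N.
Proof. by rewrite /q_i !mutate_away // qik qki muln1 mul0n addn0. Qed.

Let arrow_ik : (q_ik a i = q i a + q_i a k - q a i)%N *
  (q_ik i a = q a i - (q i a + q_i a k))%N.
Proof.
rewrite /q_ik (mutate_away _ ak ik) (mutate_away _ ik ak) !link_i.
by rewrite /q_i mutate_from mutate_into muln1 mul0n addn0.
Qed.

Let arrow_k : (q_k a i = q a i - (q i a + q k a))%N *
  (q_k i a = q i a + q k a - q a i)%N.
Proof.
by rewrite /q_k !mutate_away // qik qki muln0 mul1n addn0.
Qed.

Let no2 : ((q a i == 0%N) || (q i a == 0%N)) /\ ((q a k == 0%N) || (q k a == 0%N)).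
Proof. by split; rewrite -muln_eq0 q0. Qed.

(* The five sign patterns of a column, with all truncated subtractions solved. *)
Lemma pentagon_column : exists x y : nat,
  [\/ [/\ (q a i, q i a, q a k, q k a) = (x, 0, y, 0)%N,
          (q_i a k, q_i k a, q_ik a i, q_ik i a) = (x + y, 0, y, 0)%N
        & (q_k a i, q_k i a) = (x, 0)%N],
      [/\ (q a i, q i a, q a k, q k a) = (0, x, 0, y)%N,
          (q_i a k, q_i k a, q_ik a i, q_ik i a) = (0, y, x, 0)%N
        & (q_k a i, q_k i a) = (0, x + y)%N],
      [/\ (q a i, q i a, q a k, q k a) = (y + x, 0, 0, y)%N,
          (q_i a k, q_i k a, q_ik a i, q_ik i a) = (x, 0, 0, y)%N
        & (q_k a i, q_k i a) = (x, 0)%N]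
    | [/\ (q a i, q i a, q a k, q k a) = (y, 0, 0, y + x)%N,
          (q_i a k, q_i k a, q_ik a i, q_ik i a) = (0, x, 0, y)%N
        & (q_k a i, q_k i a) = (0, x)%N] \/
      [/\ (q a i, q i a, q a k, q k a) = (0, x, y, 0)%N,
          (q_i a k, q_i k a, q_ik a i, q_ik i a) = (y, 0, x + y, 0)%N
        & (q_k a i, q_k i a) = (0, x)%N]].
Proof.
rewrite !arrow_ik !arrow_i !arrow_k.
case: no2 => /orP[]/eqP-> /orP[]/eqP->.
- exists (q i a), (q k a); apply: Or42; split; repeat congr (_, _); lia.
- exists (q i a), (q a k); apply: Or44; right; split; repeat congr (_, _); lia.
- case: (leqP (q k a) (q a i)) => [le|lt].
    exists (q a i - q k a)%N, (q k a); apply: Or43; split; repeat congr (_, _); lia.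
  exists (q k a - q a i)%N, (q a i); apply: Or44; left; split; repeat congr (_, _); lia.
- exists (q a i), (q a k); apply: Or41; split; repeat congr (_, _); lia.
Qed.

Lemma pentagon_into_i : q_iki a i = q_ki a k.
Proof.
rewrite /q_iki mutate_into arrow_ik /q_ki mutate_away // !link_k mul1n muln0.
rewrite /q_k mutate_into mutate_from -/q_k arrow_i arrow_k.
by case: no2 => /orP[]/eqP-> /orP[]/eqP->; lia.
Qed.

Lemma pentagon_from_i : q_iki i a = q_ki k a.
Proof.
rewrite /q_iki mutate_from arrow_ik /q_ki mutate_away // !link_k mul1n muln0.
rewrite /q_k mutate_into mutate_from -/q_k arrow_i arrow_k.
by case: no2 => /orP[]/eqP-> /orP[]/eqP->; lia.
Qed.

Lemma pentagon_into_k : q_iki a k = q_ki a i.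
Proof.
rewrite /q_iki mutate_away // !link_ik muln1 mul0n.
rewrite {1 3}/q_ik mutate_into mutate_from /q_ki mutate_into arrow_ik !arrow_i arrow_k.
by case: no2 => /orP[]/eqP-> /orP[]/eqP->; lia.
Qed.

Lemma pentagon_from_k : q_iki k a = q_ki i a.
Proof.
rewrite /q_iki mutate_away // !link_ik muln1 mul0n.
rewrite {1 2}/q_ik mutate_into mutate_from /q_ki mutate_from arrow_ik !arrow_i arrow_k.
by case: no2 => /orP[]/eqP-> /orP[]/eqP->; lia.
Qed.

End Column.

(** The change between two outside nodes depends only on their columns; five patterns for each leave
    25 polynomial identities. *)
Let pentagon_away a b : a != i -> a != k -> b != i -> b != k ->
  net q_iki a b = net q_ki a b.
Proof.
move=> ai ak bi bk; rewrite !net_mutate //.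
have [x [y ha]] := pentagon_column ai ak; have [z [t hb]] := pentagon_column bi bk.
rewrite -/q_ik -/q_k -/q_i.
by case: ha => [|||[]] [] [-> -> -> ->] [-> -> -> ->] [-> ->];
  case: hb => [|||[]] [] [-> -> -> ->] [-> -> -> ->] [-> ->]; lia.
Qed.

Lemma pentagon_arrows :
  q_iki = fun a b => q_ki (tperm i k a) (tperm i k b).
Proof.
have loops q' : no2cycle q' -> (q' i i = 0%N) * (q' k k = 0%N).
  by move=> q'0; rewrite !no2cycle_loop.
have q1 := no2cycle_mutate i q0.
have [l l'] : no2cycle q_iki /\ no2cycle q_ki by split; do !apply: no2cycle_mutate.
apply: net_inj => // a b.
rewrite /net; case: tpermP => [->|->|/eqP ai /eqP ak];
  case: tpermP => [->|->|/eqP bi /eqP bk];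
  rewrite ?(loops _ l) ?(loops _ l') ?link_iki ?link_ki //.
- by rewrite pentagon_into_i // pentagon_from_i.
- by rewrite pentagon_into_k // pentagon_from_k.
- by rewrite pentagon_into_i // pentagon_from_i.
- by rewrite pentagon_into_k // pentagon_from_k.
- exact: pentagon_away.
Qed.

End Pentagon.
End Exchange.

(** * Squares and pentagons of seeds *)

Section Cells.
Variable n : nat.
Local Open Scope ring_scope.
Implicit Types (i k : 'I_n) (S : seed n (ambient_field n)).

Lemma positive_var S i : positive_seed S -> seed_var S i != 0.
Proof. by move=> S0; apply/positive_neq0/S0. Qed.

(** As no arrow joins i and k, the exchange polynomial at one node omits the variable of the other,
    and its exponents survive the other mutation. *)
Lemma square_seed S i k : no2cycle (seed_arrows S) -> i != k ->
  seed_arrows S i k = 0%N -> seed_arrows S k i = 0%N ->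
  mutate (mutate S i) k = mutate (mutate S k) i.
Proof.
case: S => q x /= q0 ik e1 e2; have ki : k != i by rewrite eq_sym.
have prod_eq (i' k' : 'I_n) z (f : 'I_n -> nat) : f i' = 0%N ->
    \prod_j (if j == i' then z else x j) ^+ f j = \prod_j x j ^+ f j.
  by move=> f0; apply: eq_bigr => j _; case: eqP => // ->; rewrite f0 !expr0.
rewrite /mutate /=; congr Seed; first exact: square_arrows.
apply: functional_extensionality => j; rewrite (negPf ik) (negPf ki).
have step (i' k' : 'I_n) z : i' != k' -> q i' k' = 0%N -> q k' i' = 0%N ->
    \prod_j (if j == i' then z else x j) ^+ mutate_arrows q i' j k' +
    \prod_j (if j == i' then z else x j) ^+ mutate_arrows q i' k' j =
    \prod_j x j ^+ q j k' + \prod_j x j ^+ q k' j.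
  move=> h h1 h2; have c := mutate_unlinked _ q0 h h1 h2.
  rewrite !prod_eq ?c //.
  by congr (_ + _); apply: eq_bigr => a _; rewrite c.
rewrite !step //.
by case: (eqVneq j k) => [->|//]; rewrite (negPf ki).
Qed.

(** The five exchange relations of a pentagon: from xi and xk, the way i, k, i creates y, z, w and
    the way k, i creates u, v. Capital letters are monomials in the outside variables. Both
    equations are checked after multiplication by old variables. *)
Lemma pentagon_identity (F : fieldType)
    (xi xk y z w u v A A' B B' D D' E E' P P' : F) :
  xi != 0 -> xk != 0 -> y != 0 ->
  y * xi = A + xk * A' -> z * xk = D + y * D' -> w * y = E + z * E' ->
  u * xk = xi * B + B' -> v * xi = u * P + P' ->
  D = P * B -> D' * A = P * B' -> D' * A' = P' ->
  E' * D = B * A -> E = B * A' -> E' * D' = B' ->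
  w = u /\ z = v.
Proof.
move=> xi0 xk0 y0 e1 e2 e3 e4 e5 m1 m2 m3 m4 m5 m6; split.
  apply: (mulIf y0); apply: (mulIf xk0).
  have -> : w * y * xk = E * xk + z * xk * E' by rewrite e3; ring.
  have -> : E * xk + z * xk * E' = E * xk + E' * D + y * (E' * D').
    by rewrite e2; ring.
  have -> : u * y * xk = (u * xk) * y by ring.
  rewrite m4 m6 m5 e4.
  have -> : B * A' * xk + B * A + y * B' = B * (A + xk * A') + y * B' by ring.
  by rewrite -e1; ring.
apply: (mulIf xi0); apply: (mulIf xk0).
have -> : z * xi * xk = z * xk * xi by ring.
have -> : v * xi * xk = u * xk * P + P' * xk by rewrite e5; ring.
have -> : z * xk * xi = D * xi + D' * (y * xi) by rewrite e2; ring.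
have -> : D * xi + D' * (y * xi) = D * xi + D' * A + D' * A' * xk.
  by rewrite e1; ring.
by rewrite m1 m2 m3 e4; ring.
Qed.

Section Pentagon.
Variable S : seed n (ambient_field n).
Variables (i k : 'I_n).
Let q := seed_arrows S.
Let x := seed_var S.
Hypotheses (q0 : no2cycle q) (S0 : positive_seed S) (qik : q i k = 1%N).

Let ik : i != k.
Proof. by apply/eqP => e; move: (no2cycle_loop i q0); rewrite {2}e qik. Qed.

Let ki : k != i. Proof. by rewrite eq_sym. Qed.

Let monomial (f : 'I_n -> nat) := \prod_(a | (a != i) && (a != k)) x a ^+ f a.

Let monomialM f g :
  monomial f * monomial g = monomial (fun a => f a + g a)%N.
Proof.
by rewrite -big_split /=; apply: eq_bigr => a _; rewrite -exprD.
Qed.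

Let eq_monomial f g : (forall a, a != i -> a != k -> f a = g a) ->
  monomial f = monomial g.
Proof. by move=> e; apply: eq_bigr => a /andP[ai ak]; rewrite e. Qed.

Let split_prod (y : 'I_n -> ambient_field n) f :
    (forall a, a != i -> a != k -> y a = x a) ->
  \prod_j y j ^+ f j = y i ^+ f i * y k ^+ f k * monomial f.
Proof.
move=> e; rewrite (bigD1 i) //= (bigD1 k) //= mulrA; congr (_ * _).
by apply: eq_bigr => a /andP[ai ak]; rewrite e.
Qed.

Let exchange (T : seed n (ambient_field n)) l f g :
    positive_seed T ->
    (forall a, a != i -> a != k -> seed_var T a = x a) ->
    (forall a, seed_arrows T a l = f a) -> (forall a, seed_arrows T l a = g a) ->
  seed_var (mutate T l) l * seed_var T l =
    seed_var T i ^+ f i * seed_var T k ^+ f k * monomial f +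
    seed_var T i ^+ g i * seed_var T k ^+ g k * monomial g.
Proof.
move=> T0 eT ef eg; rewrite /= eqxx divfK; last exact: positive_var.
by rewrite -!(split_prod _ eT); congr (_ + _); apply: eq_bigr => a _;
  rewrite ?ef ?eg.
Qed.

(** The identities hold exponent by exponent, and [pentagon_column] lists the possible exponents at
    an outside node. *)
Let exponent_identities :
  let q1 := mutate_arrows q i in let q2 := mutate_arrows q1 k in
  let p1 := mutate_arrows q k in
  [/\ monomial (fun a => q1 a k) =
        monomial (fun a => p1 a i) * monomial (fun a => q a k),
      monomial (q1 k) * monomial (fun a => q a i) =
        monomial (fun a => p1 a i) * monomial (q k),
      monomial (q1 k) * monomial (q i) = monomial (p1 i)
    & [/\ monomial (q2 i) * monomial (fun a => q1 a k) =
            monomial (fun a => q a k) * monomial (fun a => q a i),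
          monomial (fun a => q2 a i) = monomial (fun a => q a k) * monomial (q i)
        & monomial (q2 i) * monomial (q1 k) = monomial (q k)]].
Proof.
move=> q1 q2 p1.
have e a : a != i -> a != k ->
  [/\ (p1 a i + q a k = q1 a k)%N, (q1 k a + q a i = p1 a i + q k a)%N,
      (q1 k a + q i a = p1 i a)%N
    & [/\ (q2 i a + q1 a k = q a k + q a i)%N, (q a k + q i a = q2 a i)%N
        & (q2 i a + q1 k a = q k a)%N]].
  move=> ai ak; have [z [t]] := pentagon_column q0 qik ai ak.
  rewrite -/q1 -/q2 -/p1.
  by case=> [|||[]] [] [-> -> -> ->] [-> -> -> ->] [-> ->];
    rewrite ?addn0 ?add0n; do !split; rewrite // addnC.
split; [..|split]; rewrite ?monomialM; apply: eq_monomial => a ai ak;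
  by case: (e a ai ak) => ? ? ? [].
Qed.

Lemma pentagon_seed :
  mutate_path S [:: i; k; i] = relabel (tperm i k) (mutate_path S [:: k; i]).
Proof.
have qki : q k i = 0%N by move: (q0 i k); rewrite qik mul1n.
have qii : q i i = 0%N by exact: no2cycle_loop.
have qkk : q k k = 0%N by exact: no2cycle_loop.
pose q1 := mutate_arrows q i; pose q2 := mutate_arrows q1 k.
pose p1 := mutate_arrows q k.
have q1_0 : no2cycle q1 by exact: no2cycle_mutate.
have q2_0 : no2cycle q2 by exact: no2cycle_mutate.
have p1_0 : no2cycle p1 by exact: no2cycle_mutate.
have lq1 : (q1 i k = 0%N) * (q1 k i = 1%N) by rewrite /q1 mutate_from mutate_into.
have lq2 : (q2 i k = 1%N) * (q2 k i = 0%N).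
  by rewrite /q2 mutate_from mutate_into !lq1.
have lp1 : (p1 i k = 0%N) * (p1 k i = 1%N) by rewrite /p1 mutate_from mutate_into.
pose S1 := mutate S i; pose S2 := mutate S1 k; pose S3 := mutate S2 i.
pose T1 := mutate S k; pose T2 := mutate T1 i.
have [P1 Q1] : positive_seed S1 /\ positive_seed T1 by split; exact: positive_mutate.
have [P2 Q2] : positive_seed S2 /\ positive_seed T2 by split; exact: positive_mutate.
have S1k : seed_var S1 k = x k by rewrite /= (negPf ki).
have S2i : seed_var S2 i = seed_var S1 i by rewrite /= (negPf ik).
have T1i : seed_var T1 i = x i by rewrite /= (negPf ik).
have oS1 a : a != i -> a != k -> seed_var S1 a = x a.
  by move=> /negPf ai _; rewrite /= ai.
have oT1 a : a != i -> a != k -> seed_var T1 a = x a.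
  by move=> _ /negPf ak; rewrite /= ak.
have oS2 a : a != i -> a != k -> seed_var S2 a = x a.
  by move=> ai ak; rewrite -oS1 //= (negPf ak).
have E1 := @exchange S i (fun a => q a i) (q i) S0 (fun _ _ _ => erefl)
  (fun=> erefl) (fun=> erefl).
have E2 := @exchange S1 k (fun a => q1 a k) (q1 k) P1 oS1 (fun=> erefl) (fun=> erefl).
have E3 := @exchange S2 i (fun a => q2 a i) (q2 i) P2 oS2 (fun=> erefl) (fun=> erefl).
have E4 := @exchange S k (fun a => q a k) (q k) S0 (fun _ _ _ => erefl)
  (fun=> erefl) (fun=> erefl).
have E5 := @exchange T1 i (fun a => p1 a i) (p1 i) Q1 oT1 (fun=> erefl) (fun=> erefl).
rewrite -/S1 -/T1 -/S2 -/T2 -/S3 -/x in E1 E2 E3 E4 E5.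
cbv beta in E1, E2, E3, E4, E5.
rewrite qki qii qik expr0 expr1 !mul1r in E1.
rewrite (no2cycle_loop k q1_0) !lq1 expr0 expr1 mul1r !mulr1 mul1r in E2.
rewrite (no2cycle_loop i q2_0) !lq2 expr0 expr1 !mul1r S2i in E3.
rewrite qki qkk qik expr0 expr1 !mulr1 mul1r in E4.
rewrite (no2cycle_loop i p1_0) !lp1 expr0 expr1 !mul1r T1i in E5.
rewrite S1k in E2.
have [m1 m2 m3 [m4 m5 m6]] := exponent_identities.
have [wu zv] : seed_var S3 i = seed_var T1 k /\ seed_var S2 k = seed_var T2 i.
  exact: (pentagon_identity (positive_var i S0) (positive_var k S0)
    (positive_var i P1) E1 E2 E3 E4 E5).
rewrite /relabel; congr Seed; first by rewrite /= -/q pentagon_arrows.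
apply: functional_extensionality => j.
rewrite -[LHS]/(seed_var S3 j) -[RHS]/(seed_var T2 (tperm i k j)).
case: tpermP => [->|->|/eqP ji /eqP jk].
- rewrite wu -[RHS]/(if k == i then _ else seed_var T1 k).
  by rewrite (negPf ki).
- rewrite -zv -[LHS]/(if k == i then _ else seed_var S2 k).
  by rewrite (negPf ki).
- by rewrite /S3 /T2 /= (negPf ji) (negPf jk).
Qed.

End Pentagon.

(** Exchange relations are symmetric in their two monomials, so mutation commutes with reversing all
    arrows. This transfers the pentagon from an arrow i -> k to an arrow k -> i. *)
Definition opposite S : seed n (ambient_field n) :=
  Seed (fun i j => seed_arrows S j i) (seed_var S).

Lemma mutate_opposite S k : mutate (opposite S) k = opposite (mutate S k).
Proof.
rewrite /mutate /opposite /=; congr Seed.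
  do 2!apply: functional_extensionality => ?.
  by rewrite /mutate_arrows orbC; case: ifP => // _; rewrite ![in RHS](mulnC (_ _ k)).
by apply: functional_extensionality => i; rewrite addrC.
Qed.

Lemma mutate_path_opposite S P :
  mutate_path (opposite S) P = opposite (mutate_path S P).
Proof. by elim: P S => //= k P IH S; rewrite mutate_opposite IH. Qed.

Lemma opposite_inj : injective opposite.
Proof.
case=> q x [q' x'] [e ->]; congr Seed.
do 2!apply: functional_extensionality => ?.
exact: (congr1 (fun r => r _ _) e).
Qed.

(** One side of the cell is expressed by the others: the form in which a missing edge is added to
    the table. *)
Lemma square_cell S i k : no2cycle (seed_arrows S) -> positive_seed S ->
  i != k -> seed_arrows S i k = 0%N -> seed_arrows S k i = 0%N ->
  mutate S k = mutate_path S [:: i; k; i].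
Proof.
move=> q0 S0 ik e1 e2; rewrite /= (square_seed q0 ik e1 e2) mutateK //.
  exact: no2cycle_mutate.
exact: positive_mutate.
Qed.

Lemma pentagon_cell S i k : no2cycle (seed_arrows S) -> positive_seed S ->
  seed_arrows S i k = 1%N \/ seed_arrows S k i = 1%N ->
  mutate S k = relabel (tperm i k) (mutate_path S [:: i; k; i; k]).
Proof.
move=> q0 S0 e.
have {e} : mutate_path S [:: i; k; i] = relabel (tperm i k) (mutate_path S [:: k; i]).
  case: e => [|e]; first exact: pentagon_seed.
  have q0' : no2cycle (seed_arrows (opposite S)) by move=> a b; rewrite mulnC q0.
  have := @pentagon_seed (opposite S) i k q0' S0 e.
  by rewrite !mutate_path_opposite => h; apply: opposite_inj.
(* A further mutation at k on the long way is, through the transposition, a second mutation at i on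
   the short way, where it cancels the first. *)
move=> e; have -> := mutate_path_cat S [:: i; k; i] [:: k]; rewrite e.
rewrite -[mutate_path _ [:: k]]/(mutate _ k) -[mutate_path _ _]/(mutate (mutate S k) i).
rewrite mutate_relabel tpermR mutateK; last exact: positive_mutate.
  by rewrite /relabel /=; congr Seed;
    repeat apply: functional_extensionality => ?; rewrite !tpermK.
exact: no2cycle_mutate.
Qed.

End Cells.

(** * Seeds reached by the cluster modular group *)

Section Seeds.
Variables (n : nat) (Q : quiver n).
Local Open Scope group_scope.
Implicit Types (x y : cluster_modular_group Q) (g : modular_pair Q).
Implicit Types (P : seq 'I_n) (p : 'S_n) (S : seed n (ambient_field n)).

(** The image of the initial seed under x, with nodes renamed so that its quiver is [Q] itself. *)
Definition class_seed x : seed n (ambient_field n) := Seed Q (pair_action (repr x)).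

Lemma class_seedE g : class_seed (modular_class g) = Seed Q (pair_action g).
Proof. by congr Seed; apply: functional_extensionality => i; rewrite repr_action. Qed.

Lemma class_seed_inj : injective class_seed.
Proof.
move=> x y [e]; rewrite -[x]modular_classK -[y]modular_classK.
by apply/modular_classP => i; rewrite e.
Qed.

Lemma class_seed1 : class_seed 1 = initial_seed Q.
Proof.
rewrite (class_seedE (trivial_pair Q)); congr Seed.
by apply: functional_extensionality => i; rewrite /pair_action perm1.
Qed.

Lemma relabelM p p' S : relabel p (relabel p' S) = relabel (p * p') S.
Proof.
by rewrite /relabel /=; congr Seed;
  repeat (apply: functional_extensionality => ?); rewrite !permM.
Qed.

Lemma relabel1 S : relabel 1 S = S.
Proof.
case: S => q x; rewrite /relabel /=; congr Seed;
  repeat (apply: functional_extensionality => ?); by rewrite !perm1.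
Qed.

Lemma class_seedM x g : class_seed (x * modular_class g) =
  relabel (pair_perm g) (mutate_path (class_seed x) (pair_path g)).
Proof.
rewrite -{1}[x]modular_classK -modular_classM class_seedE -relabel_pair /=.
rewrite -/(pair_path (repr x)) -/(pair_path g) -/(pair_perm g) -/(pair_perm (repr x)).
by rewrite -relabelM relabel_pair_path.
Qed.

Lemma positive_class_seed x : positive_seed (class_seed x).
Proof. exact: positive_action. Qed.

Lemma no2cycle_class_path x P : no2cycle (seed_arrows (mutate_path (class_seed x) P)).
Proof. by rewrite seed_arrows_path; apply/no2cycle_path/quiver_no2cycle. Qed.

(** Substituting the cluster of [class_seed x] for the initial variables turns an identity at the
    initial seed into one at [class_seed x]. Positivity of the cluster keeps the denominators
    nonzero. *)
Lemma class_path_transport P p P' p' :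
    relabel p (mutate_path (initial_seed Q) P) =
    relabel p' (mutate_path (initial_seed Q) P') ->
  forall x, relabel p (mutate_path (class_seed x) P) =
            relabel p' (mutate_path (class_seed x) P').
Proof.
move=> e x; have ev R := evaluates_path R (positive_class_seed x).
rewrite /relabel; congr Seed.
  have /(congr1 (@seed_arrows _ _)) := e; rewrite /relabel /=.
  by rewrite !seed_arrows_path.
apply: functional_extensionality => i.
apply: evaluates_inj (ev P (p i)) _.
by have := ev P' (p' i); move/(congr1 (fun S => seed_var S i)): e => /= ->.
Qed.

Lemma class_path_transportM x y P p P' p' :
    relabel p (mutate_path (initial_seed Q) P) =
    relabel p' (mutate_path (class_seed y) P') ->
  relabel p (mutate_path (class_seed x) P) =
  relabel p' (mutate_path (class_seed (x * y)) P').
Proof.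
rewrite -[y]modular_classK; set g := repr y.
have cs z : mutate_path (class_seed (z * modular_class g)) P' = relabel (pair_perm g)
    (mutate_path (class_seed z) (pair_path g ++ map (pair_perm g) P')).
  by rewrite class_seedM mutate_path_relabel mutate_path_cat.
rewrite cs relabelM -{1}[modular_class g]mul1g cs class_seed1 relabelM.
by move=> e; apply: class_path_transport.
Qed.

Lemma mutate_pathK S P : no2cycle (seed_arrows S) -> positive_seed S ->
  mutate_path (mutate_path S P) (rev P) = S.
Proof.
elim/last_ind: P => // P k IH q0 S0.
rewrite rev_rcons -cats1 mutate_path_cat /= mutateK ?IH //.
  by rewrite seed_arrows_path; apply: no2cycle_path.
exact: positive_path.
Qed.

(** The element goes out along P and back along P' renamed by the inverse of p; the isomorphism of
    the two end quivers is what makes this return to a copy of [Q]. *)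
Lemma class_path_exists P P' p :
    seed_arrows (mutate_path (initial_seed Q) P) =
    seed_arrows (relabel p (mutate_path (initial_seed Q) P')) ->
  exists y, mutate_path (initial_seed Q) P =
            relabel p (mutate_path (class_seed y) P').
Proof.
move=> e; pose A := relabel p^-1 (mutate_path (initial_seed Q) P).
pose R := P ++ map p^-1 (rev P').
have RE : relabel p^-1 (mutate_path (initial_seed Q) R) = mutate_path A (rev P').
  by rewrite mutate_path_relabel mutate_path_cat.
have qA : seed_arrows A = seed_arrows (mutate_path (initial_seed Q) P').
  rewrite /A /relabel /= e /=.
  by do 2!(apply: functional_extensionality => ?); rewrite !permKV.
have A0 : no2cycle (seed_arrows A).
  by rewrite qA seed_arrows_path; apply/no2cycle_path/quiver_no2cycle.
have Apos : positive_seed A.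
  by move=> i; apply: positive_path; apply: positive_initial_seed.
have arr : seed_arrows (mutate_path A (rev P')) = Q.
  by rewrite seed_arrows_path qA -seed_arrows_path -mutate_path_cat mutate_path_rev.
have ok : quiver_iso Q (seed_arrows (mutate_path (initial_seed Q) R)) p^-1.
  by apply/quiver_isoP => i j; rewrite -[RHS](congr1 (fun q => q i j) arr) -RE.
exists (modular_class (exist _ (R, p^-1) ok : modular_pair Q)).
rewrite class_seedE -relabel_pair RE.
have := mutate_pathK (rev P') A0 Apos; rewrite revK => ->.
by rewrite relabelM mulgV relabel1.
Qed.

End Seeds.

(** * Words in signed generators, with free cancellation *)

Section Words.
Variables (I : eqType) (G : groupType).
Implicit Types (l m : I * bool) (u v w : seq (I * bool)) (rho : I -> G).
Local Open Scope group_scope.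

Definition word_at rho w : G := word_val [seq (rho l.1, l.2) | l <- w].

Definition letter_at rho l : G := letter_val (rho l.1, l.2).

Definition flip l := (l.1, ~~ l.2).

Lemma flipK : involutive flip.
Proof. by case=> i b; rewrite /flip negbK. Qed.

Lemma letter_flip rho l : letter_at rho (flip l) = (letter_at rho l)^-1.
Proof. by case: l => i [] /=; rewrite /letter_at /letter_val //= invgK. Qed.

Lemma word_at_nil rho : word_at rho [::] = 1.
Proof. by rewrite /word_at /word_val big_nil. Qed.

Lemma word_at_cons rho l w : word_at rho (l :: w) = letter_at rho l * word_at rho w.
Proof. by rewrite /word_at /word_val big_cons. Qed.

Lemma word_at_cat rho u v : word_at rho (u ++ v) = word_at rho u * word_at rho v.
Proof. by rewrite /word_at /word_val map_cat big_cat. Qed.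

Definition push l w :=
  if w is m :: w' then if m == flip l then w' else l :: w else [:: l].

Definition mul_word u v := foldr push v u.

Definition inv_word w := rev (map flip w).

Lemma word_at_push rho l w : word_at rho (push l w) = letter_at rho l * word_at rho w.
Proof.
case: w => [|m w] /=; first by rewrite word_at_cons.
case: eqP => [->|_]; rewrite !word_at_cons // letter_flip.
by rewrite mulgA mulgV mul1g.
Qed.

Lemma word_at_mul rho u v : word_at rho (mul_word u v) = word_at rho u * word_at rho v.
Proof.
elim: u => [|l u IH] /=; first by rewrite word_at_nil mul1g.
by rewrite word_at_push IH word_at_cons mulgA.
Qed.

Lemma word_at_inv rho w : word_at rho (inv_word w) = (word_at rho w)^-1.
Proof.
elim: w => [|l w IH]; first by rewrite /inv_word word_at_nil invg1.
rewrite /inv_word /= rev_cons -cats1 word_at_cat IH !word_at_cons word_at_nil.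
by rewrite mulg1 letter_flip invgM.
Qed.

End Words.

(** * Certified presentations of cluster modular groups *)

Module PM := PositiveMap.

Section Checker.
Variable n' : nat.
Local Notation n := n'.+1.

Implicit Types (s : 'S_n) (p : seq nat).

Definition perm_list (s : 'S_n) : seq nat := [seq val (s i) | i <- enum 'I_n].

Lemma nth_perm_list s (i : 'I_n) : nth 0 (perm_list s) i = s i.
Proof. by rewrite (nth_map i) ?size_enum_ord // nth_ord_enum. Qed.

Lemma eq_perm_list s p : size p = n -> (forall i : 'I_n, nth 0 p i = s i) ->
  perm_list s = p.
Proof.
move=> sz e; apply: (@eq_from_nth _ 0).
  by rewrite size_map size_enum_ord sz.
rewrite size_map size_enum_ord => i lt_i.
by rewrite (nth_perm_list s (Ordinal lt_i)) -(e (Ordinal lt_i)).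
Qed.

Definition identity_list := iota 0 n.
Definition compose_list (p r : seq nat) := [seq nth 0 r i | i <- p].
Definition inverse_list (p : seq nat) := [seq index i p | i <- iota 0 n].
Definition swap_list i k := [seq if a == i then k else if a == k then i else a | a <- iota 0 n].
Definition is_perm_list p := [&& size p == n, uniq p & all (fun a => a < n) p].

Lemma size_perm_list s : size (perm_list s) = n.
Proof. by rewrite size_map size_enum_ord. Qed.

Lemma perm_list1 : perm_list 1 = identity_list.
Proof.
apply: eq_perm_list => [|i]; first by rewrite size_iota.
by rewrite nth_iota // perm1.
Qed.

Lemma perm_listM s r : perm_list (s * r) = compose_list (perm_list s) (perm_list r).
Proof.
apply: eq_perm_list => [|i]; first by rewrite size_map size_perm_list.
by rewrite (nth_map 0) ?size_perm_list // !nth_perm_list permM.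
Qed.

Lemma perm_listV s : perm_list s^-1 = inverse_list (perm_list s).
Proof.
apply: eq_perm_list => [|i]; first by rewrite size_map size_iota.
rewrite (nth_map 0) ?size_iota // nth_iota //.
have -> : 0 + i = s (s^-1%g i) :> nat by rewrite permKV.
have inj_s : injective (fun a => val (s a)) by move=> a b /val_inj /perm_inj.
by rewrite (index_map inj_s) index_enum_ord.
Qed.

Lemma perm_list_swap (i k : 'I_n) : perm_list (tperm i k) = swap_list i k.
Proof.
apply: eq_perm_list => [|a]; first by rewrite size_map size_iota.
rewrite (nth_map 0) ?size_iota // nth_iota // add0n.
case: tpermP => [->|->|/eqP ai /eqP ak]; rewrite ?eqxx //.
  by case: eqP => // ->.
by rewrite !(inj_eq val_inj) (negPf ai) (negPf ak).
Qed.

Lemma is_perm_listP p : is_perm_list p -> exists s, perm_list s = p.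
Proof.
case/and3P=> /eqP sz up /allP lt_p.
pose f (i : 'I_n) : 'I_n := inord (nth 0 p i).
have fE i : f i = nth 0 p i :> nat by rewrite inordK // lt_p // mem_nth ?sz.
have f_inj : injective f.
  move=> i j /(congr1 val); rewrite /= !fE => /eqP.
  by rewrite nth_uniq ?sz // => /eqP/val_inj.
by exists (perm f_inj); apply: eq_perm_list => // i; rewrite permE fE.
Qed.

Definition arrow_lists := seq (seq nat).
Definition entry (q : arrow_lists) i j := nth 0 (nth [::] q i) j.

Definition mutate_lists (q : arrow_lists) k : arrow_lists :=
  [seq [seq if (i == k) || (j == k) then entry q j i else
        (entry q i j + entry q i k * entry q k j) -
        (entry q j i + entry q j k * entry q k i)
       | j <- iota 0 n] | i <- iota 0 n].

Definition lists_of (q : arrows n) : arrow_lists :=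
  [seq [seq q i j | j <- enum 'I_n] | i <- enum 'I_n].

Lemma entry_lists_of q (i j : 'I_n) : entry (lists_of q) i j = q i j.
Proof.
rewrite /entry (nth_map i) ?size_enum_ord // (nth_map i) ?size_enum_ord //.
by rewrite !nth_ord_enum.
Qed.

Lemma eq_lists_of q (r : arrow_lists) : (forall i j : 'I_n, q i j = entry r i j) ->
  lists_of q = [seq [seq entry r i j | j <- iota 0 n] | i <- iota 0 n].
Proof.
rewrite -val_enum_ord -map_comp => e; apply: eq_map => i /=.
by rewrite -map_comp; apply: eq_map => j /=.
Qed.

Lemma mutate_listsE q (k : 'I_n) :
  lists_of (mutate_arrows q k) = mutate_lists (lists_of q) k.
Proof.
rewrite /mutate_lists -val_enum_ord -map_comp; apply: eq_map => i /=.
rewrite -map_comp; apply: eq_map => j /=.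
by rewrite !entry_lists_of.
Qed.

Variable Q : quiver n.
Local Notation Gamma := (cluster_modular_group Q).
Variable rho : nat -> Gamma.

Definition word := seq (nat * bool).

(* A position (w, j, p) stands for the image of the j-th reference seed under the
   value of w, with nodes renamed by p. *)
Definition position := (word * positive * seq nat)%type.

Definition node := (seq nat * arrow_lists)%type.
Variable nodes : PM.t node.

Definition ref_path j : seq 'I_n :=
  if PM.find j nodes is Some (P, _) then map inord P else [::].

Definition ref_seed (x : Gamma) j := mutate_path (class_seed x) (ref_path j).

Definition at_position (T : seed n (ambient_field n)) (a : position) :=
  let: (w, j, p) := a in
  exists2 s, perm_list s = p & T = relabel s (ref_seed (word_at rho w) j).

Definition edge_table := PM.t (seq (option position)).
Implicit Types (E : edge_table) (a : position) (j : positive) (k i : nat).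

Definition find_edge E j k : option position :=
  if PM.find j E is Some row then nth None row k else None.

Definition set_edge E j k a : edge_table :=
  PM.add j (set_nth None (odflt [::] (PM.find j E)) k (Some a)) E.

Lemma find_set_edge E j k a j' k' : find_edge (set_edge E j k a) j' k' =
  if Pos.eqb j j' && (k' == k) then Some a else find_edge E j' k'.
Proof.
rewrite /find_edge /set_edge; case: Pos.eqb_spec => [<-|ne] /=; last by rewrite PM.gso // => /esym.
rewrite PM.gss nth_set_nth /=; case: eqP => // _.
by case: (PM.find j E) => //=; rewrite nth_nil.
Qed.

(** Node k of the current seed is node p(k) of the reference seed, whose recorded edge is translated
    by w. *)
Definition step E a k : option position :=
  let: (w, j, p) := a in
  if find_edge E j (nth 0 p k) is Some (w', j', p')
  then Some (mul_word w w', j', compose_list p p') else None.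

Definition walk E a (P : seq nat) : option position :=
  foldl (fun o k => if o is Some b then step E b k else None) (Some a) P.

Definition start j : position := ([::], j, identity_list).

Definition arrows_at j : arrow_lists := if PM.find j nodes is Some (_, q) then q else [::].

(* The edge (j, k) closes a square or a pentagon in the directions i and k whose
   other edges are already in the table. *)
Definition cell_position E j k i : option position :=
  let q := arrows_at j in
  if [|| i == k, n <= i | n <= k] then None else
  match entry q i k, entry q k i with
  | 0, 0 => walk E (start j) [:: i; k; i]
  | 1, _ | _, 1 =>
      if walk E (start j) [:: i; k; i; k] is Some (w, j', p)
      then Some (w, j', compose_list (swap_list i k) p) else None
  | _, _ => None
  end.

(** The edge is recorded from both ends; from the far end it carries the inverse word and the
    inverse permutation. *)
Definition add_edge E j k a : edge_table :=
  let: (w, j', p) := a in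
  set_edge (set_edge E j k a) j' (nth 0 p k) (inv_word w, j, inverse_list p).

Definition add_cell E (c : positive * nat * nat) : edge_table :=
  let: (j, k, i) := c in
  if cell_position E j k i is Some a then add_edge E j k a else E.

Definition edges_valid E := forall j k a, find_edge E j k = Some a ->
  k < n /\ at_position (mutate (ref_seed 1%g j) (inord k)) a.

Definition nodes_valid := forall j P q, PM.find j nodes = Some (P, q) ->
  q = lists_of (foldl (@mutate_arrows n) Q (map inord P)).

(** Gamma acts freely on labelled seeds, since retracing the path recovers the image of the initial
    cluster. Coincident positions thus become relations. *)
Lemma ref_seed_inj x y j : ref_seed x j = ref_seed y j -> x = y.
Proof.
move=> /(congr1 (fun S => mutate_path S (rev (ref_path j)))).
have back z : mutate_path (ref_seed z j) (rev (ref_path j)) = class_seed z.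
  apply: mutate_pathK; last exact: positive_class_seed.
  exact: quiver_no2cycle.
by rewrite !back => /class_seed_inj.
Qed.

Lemma step_valid E T a k b : edges_valid E -> k < n ->
  at_position T a -> step E a k = Some b -> at_position (mutate T (inord k)) b.
Proof.
case: a => [[w j] p] EV lt_k [s <- ->] /=.
have -> : nth 0 (perm_list s) k = s (inord k).
  by rewrite -[in LHS](inordK lt_k) nth_perm_list.
case e : find_edge => [[[w' j'] p']|] // [<-] {b}.
have [_ [s' <- e']] := EV _ _ _ e; rewrite inord_val in e'.
exists (s * s')%g; first by rewrite perm_listM.
rewrite mutate_relabel -relabelM; congr relabel.
rewrite word_at_mul.
(* The table records edges at the untranslated reference seeds; transport moves them to the
   translate by [word_at rho w]. *)
have := @class_path_transportM n Q (word_at rho w) (word_at rho w')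
  (ref_path j ++ [:: s (inord k)]) 1%g (ref_path j') s'.
rewrite !relabel1 !mutate_path_cat -class_seed1 /=; exact.
Qed.

Lemma walk_valid E T a P b : edges_valid E -> all (fun k => k < n) P ->
  at_position T a -> walk E a P = Some b ->
  at_position (mutate_path T (map inord P)) b.
Proof.
move=> EV; elim: P a T => [|k P IH] a T /=; first by move=> _ h [<-].
case/andP=> lt_k lt_P Ta; rewrite /walk /=.
case e : step => [c|]; first by apply: IH lt_P _; apply: step_valid e.
by move=> h; suff: @None position = Some b by []; rewrite -h; elim: (P).
Qed.

Lemma start_valid j : at_position (ref_seed 1%g j) (start j).
Proof.
by exists 1%g; rewrite ?perm_list1 // relabel1 word_at_nil.
Qed.

Lemma arrows_atE j (i k : 'I_n) : nodes_valid -> PM.find j nodes <> None ->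
  entry (arrows_at j) i k = seed_arrows (ref_seed 1%g j) i k.
Proof.
move=> NV; rewrite /arrows_at /ref_seed /ref_path.
case e : PM.find => [[P q]|] // _.
by rewrite (NV _ _ _ e) entry_lists_of seed_arrows_path.
Qed.

Lemma cell_valid E j k i a : nodes_valid -> edges_valid E ->
    PM.find j nodes <> None ->
    cell_position E j k i = Some a ->
  k < n /\ at_position (mutate (ref_seed 1%g j) (inord k)) a.
Proof.
move=> NV EV jn; rewrite /cell_position.
case: ifPn => // /norP[ik /norP[]]; rewrite -!ltnNge => lt_i lt_k e; split=> //.
have q0 : no2cycle (seed_arrows (ref_seed 1%g j)) by exact: no2cycle_class_path.
have S0 : positive_seed (ref_seed 1%g j).
  by apply: positive_path; exact: positive_class_seed.
pose i' : 'I_n := inord i; pose k' : 'I_n := inord k.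
have ik' : i' != k' by rewrite -(inj_eq val_inj) /= !inordK.
have lt4 : all (fun k => k < n) [:: i; k; i; k] by rewrite /= lt_i lt_k.
have lt3 : all (fun k => k < n) [:: i; k; i] by rewrite /= lt_i lt_k.
have eq1 : entry (arrows_at j) i k = seed_arrows (ref_seed 1%g j) i' k'.
  by rewrite -arrows_atE // !inordK.
have eq2 : entry (arrows_at j) k i = seed_arrows (ref_seed 1%g j) k' i'.
  by rewrite -arrows_atE // !inordK.
have pent : seed_arrows (ref_seed 1%g j) i' k' = 1 \/
    seed_arrows (ref_seed 1%g j) k' i' = 1 ->
    (if walk E (start j) [:: i; k; i; k] is Some (w, j', p)
      then Some (w, j', compose_list (swap_list i k) p) else None) = Some a ->
    at_position (mutate (ref_seed 1%g j) k') a.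
  move=> h; case ew : walk => [[[w j'] p]|] // [<-].
  have [s <- es] := walk_valid EV lt4 (start_valid j) ew.
  rewrite (pentagon_cell q0 S0 h); exists (tperm i' k' * s)%g.
    by rewrite perm_listM perm_list_swap !inordK.
  by rewrite -relabelM -es.
move: e pent (square_cell q0 S0 ik'); rewrite {}eq1 {}eq2 -/k'.
move: (seed_arrows _ i' k') (seed_arrows _ k' i') => [|[|x]] [|[|y]] // e pent sq;
  try by apply: pent; auto.
rewrite sq //; exact: walk_valid EV lt3 (start_valid j) e.
Qed.

Lemma add_edge_valid E j k a : edges_valid E ->
    k < n -> at_position (mutate (ref_seed 1%g j) (inord k)) a ->
  edges_valid (add_edge E j k a).
Proof.
move=> EV lt_k h; rewrite /add_edge; case: a h => [[w j1] p] h j' k' b.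
rewrite !find_set_edge; case: ifP => [|_]; last first.
  by case: ifP => [/andP[/Pos.eqb_eq <- /eqP->] [<-]|_ /EV].
case/andP=> /Pos.eqb_eq <- /eqP-> [<-] {b}.
case: h => s <- e; rewrite -[in nth 0 _ k](inordK lt_k) nth_perm_list; split=> //.
exists s^-1%g; first exact: perm_listV.
rewrite inord_val word_at_inv.
move/(congr1 (@mutate _ _ ^~ (inord k))): e.
rewrite mutateK ?mutate_relabel; first last.
- by apply: positive_path; exact: positive_class_seed.
- exact: no2cycle_class_path.
move=> /(congr1 (relabel s^-1%g)); rewrite relabelM mulVg.
(* The mutation has been undone at the far end, which is a translate by [word_at rho w]; transport
   by the inverse brings it back to the reference seed. *)
have := @class_path_transportM n Q (word_at rho w)^-1%g (word_at rho w)
  (ref_path j) s^-1%g (ref_path j1 ++ [:: s (inord k)]) 1%g.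
rewrite !relabel1 !mutate_path_cat -class_seed1 mulVg /= => h e.
by rewrite -h.
Qed.

Lemma add_cell_valid E c : nodes_valid -> PM.find c.1.1 nodes <> None ->
  edges_valid E -> edges_valid (add_cell E c).
Proof.
case: c => [[j k] i] NV /= jn EV; case e : cell_position => [a|] //.
by have [lt_k h] := cell_valid NV EV jn e; apply: add_edge_valid.
Qed.

End Checker.

Arguments add_edge : simpl never.
Arguments identity_list : simpl never.

Lemma all_In (T : Type) (a : pred T) x s : List.In x s -> all a s -> a x.
Proof. by elim: s => //= y s IH [->|/IH h] /andP[]. Qed.

(** * Building the table of edges, reading off relations, and recognising quivers *)

Section Certificate.
Variable n' : nat.
Local Notation n := n'.+1.
Variable Q : quiver n.
Local Notation Gamma := (cluster_modular_group Q).
Implicit Types (E : edge_table) (j : positive) (k i : nat) (p : seq nat).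

Definition add_node (st : PM.t node * positive) (c : positive * nat) :=
  let: (nodes, child) := st in
  (if PM.find c.1 nodes is Some (P, q)
   then if c.2 < n then PM.add child (rcons P c.2, mutate_lists n' q c.2) nodes else nodes
   else nodes, Pos.succ child).

Definition build_nodes (q : arrow_lists) (tree : seq (positive * nat)) : PM.t node :=
  (foldl add_node (PM.add 1%positive ([::], q) (PM.empty node), 2%positive) tree).1.

Lemma build_nodes_valid q tree : q = lists_of Q -> nodes_valid Q (build_nodes q tree).
Proof.
move=> eq; rewrite /build_nodes; set nodes0 := PM.add _ _ _.
have : nodes_valid Q nodes0.
  move=> j P r; rewrite /nodes0; case: (Pos.eqb_spec j 1) => [->|ne].
    by rewrite PM.gss => -[<- <-].
  by rewrite PM.gso // PM.gempty.
elim: tree nodes0 2%positive => //= -[j k] tree IH nodes child NV; apply: IH => /=.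
case e : PM.find => [[P r]|] //; case: ifP => // lt_k j' P' r'.
case: (Pos.eqb_spec j' child) => [->|ne]; last by rewrite PM.gso //; apply: NV.
rewrite PM.gss => -[<- <-]; rewrite map_rcons -cats1 foldl_cat /=.
by rewrite mutate_listsE -(NV _ _ _ e) inordK.
Qed.

Section Table.
Variables (nodes : PM.t node).
Hypothesis NV : nodes_valid Q nodes.

(** Reference seeds are chosen along the tree, so its edges carry the empty word and the identity
    permutation. *)
Definition add_tree_edge (st : edge_table * positive) (c : positive * nat) :=
  let: (E, child) := st in
  (if (PM.find c.1 nodes, PM.find child nodes) is (Some (P, _), Some (P', _))
   then if (c.2 < n) && (P' == rcons P c.2)
        then add_edge n' E c.1 c.2 ([::], child, identity_list n') else E
   else E, Pos.succ child).

Definition tree_table (tree : seq (positive * nat)) : edge_table :=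
  (foldl add_tree_edge (PM.empty _, 2%positive) tree).1.

Definition generator_edge := (positive * nat * positive * seq nat)%type.

(** Only the quivers at both ends are compared. Once p matches them, [class_path_exists] supplies an
    element of Gamma as the holonomy of the edge. *)
Definition generator_ok (c : generator_edge) :=
  let: (j, k, j', p) := c in
  if (PM.find j nodes, PM.find j' nodes) is (Some (_, q), Some (_, q')) then
  [&& k < n, is_perm_list n' p &
   all (fun a => all (fun b =>
      entry (mutate_lists n' q k) a b == entry q' (nth 0 p a) (nth 0 p b))
    (iota 0 n)) (iota 0 n)] else false.

Definition generator_valid (x : Gamma) (c : generator_edge) :=
  let: (j, k, j', p) := c in
  k < n /\ exists2 s, perm_list s = p &
    mutate (ref_seed nodes (1%g : Gamma) j) (inord k) = relabel s (ref_seed nodes x j').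

Lemma generator_exists c : generator_ok c -> exists x, generator_valid x c.
Proof.
case: c => [[[j k] j'] p]; rewrite /generator_ok /generator_valid.
case e : (PM.find j nodes) => [[P q]|] //; case e' : (PM.find j' nodes) => [[P' q']|] //.
case/and3P=> lt_k /is_perm_listP[s sp] /allP h.
have [|x ex] := @class_path_exists n Q (ref_path n' nodes j ++ [:: inord k])
  (ref_path n' nodes j') s.
  rewrite mutate_path_cat !seed_arrows_path /relabel /=.
  rewrite /ref_path e e' /=.
  apply: functional_extensionality => a; apply: functional_extensionality => b.
  have mem_n (u : 'I_n) : val u \in iota 0 n by rewrite mem_iota /= ltn_ord.
  have /allP hb := h _ (mem_n a); have /eqP := hb _ (mem_n b).
  rewrite -sp !nth_perm_list (NV e) (NV e').
  rewrite -[k in mutate_lists _ _ k](inordK lt_k) -mutate_listsE !entry_lists_of.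
  by rewrite !seed_arrows_path.
exists x; split=> //; exists s => //.
by rewrite /ref_seed class_seed1 -ex mutate_path_cat.
Qed.

Definition add_generator (st : edge_table * nat) (c : generator_edge) :=
  let: (E, l) := st in let: (j, k, j', p) := c in
  (add_edge n' E j k ([:: (l, false)], j', p), l.+1).

Definition generator_table E (gens : seq generator_edge) : edge_table :=
  (foldl add_generator (E, 0) gens).1.

Lemma generators_exist gens : all generator_ok gens -> exists2 s : seq Gamma,
  size s = size gens & forall l c0, l < size gens ->
    generator_valid (nth 1%g s l) (nth c0 gens l).
Proof.
elim: gens => [|c gens IH] /=; first by exists [::].
case/andP=> /generator_exists[x hx] /IH[s ss hs].
by exists (x :: s); [rewrite /= ss | case].
Qed.

Section Valid.
Variable rho : nat -> Gamma.

Lemma tree_table_valid tree : edges_valid rho nodes (tree_table tree).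
Proof.
rewrite /tree_table; set st := (PM.empty _, _).
have : edges_valid rho nodes st.1.
  by move=> j k a; rewrite /find_edge PM.gempty.
elim: tree st => //= -[j k] tree IH [E child] EV; apply: IH => /=.
case e : PM.find => [[P r]|] //; case e' : PM.find => [[P' r']|] //.
case: ifP => // /andP[lt_k /eqP eP]; apply: add_edge_valid => //.
exists 1%g; first exact: perm_list1.
rewrite relabel1 word_at_nil /ref_seed /ref_path e e' eP map_rcons -cats1.
by rewrite mutate_path_cat.
Qed.

Lemma generator_table_valid E gens : edges_valid rho nodes E ->
    (forall l c0, l < size gens -> generator_valid (rho l) (nth c0 gens l)) ->
  edges_valid rho nodes (generator_table E gens).
Proof.
move=> EV gv; rewrite /generator_table.
have {gv} : forall l c0, l < size gens -> generator_valid (rho (0 + l)) (nth c0 gens l).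
  by [].
move: (0).
elim: gens E EV => //= c gens IH E EV l gv.
have := gv 0 c isT; rewrite addn0 /=.
case: c gv => [[[j k] j'] p] gv [lt_k [s sp es]]; apply: IH.
  apply: add_edge_valid => //; exists s => //.
  by rewrite word_at_cons word_at_nil mulg1 /letter_at /letter_val.
by move=> m c0 lt_m; have := gv m.+1 c0; rewrite addSnnS; apply.
Qed.

Lemma add_cells_valid E (cells : seq (positive * nat * nat)) :
  all (fun c => if PM.find c.1.1 nodes is Some _ then true else false) cells ->
  edges_valid rho nodes E -> edges_valid rho nodes (foldl (add_cell n' nodes) E cells).
Proof.
elim: cells E => //= c cells IH E /andP[jn cn] EV; apply: IH => //.
by apply: add_cell_valid => // e; move: jn; rewrite e.
Qed.

Variable E : edge_table.
Hypothesis EV : edges_valid rho nodes E.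

(** A cell gives a second position for the seed at the end of a known edge. If quiver and
    permutation agree, the two words have the same value. *)
Definition relation (c : positive * nat * nat) : option word :=
  let: (j, k, i) := c in
  if PM.find j nodes is None then None else
  if (cell_position n' nodes E j k i, find_edge E j k) is
    (Some (w, j1, p), Some (w', j1', p'))
  then if Pos.eqb j1 j1' && (p == p') then Some (mul_word (inv_word w) w') else None
  else None.

Lemma perm_list_inj : injective (@perm_list n').
Proof.
move=> s r e; apply/permP => a; apply: val_inj.
by rewrite /= -!nth_perm_list e.
Qed.

Lemma relationP c w : relation c = Some w -> word_at rho w = 1%g.
Proof.
case: c => [[j k] i]; rewrite /relation; case e : PM.find => [x|] //.
case e1 : cell_position => [[[w1 j1] p1]|] //; case e2 : find_edge => [[[w2 j2] p2]|] //.
case: ifP => // /andP[/Pos.eqb_eq e12 /eqP ep] [<-].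
have jn : PM.find j nodes <> None by rewrite e.
have [_ [s es eS]] := cell_valid NV EV jn e1.
have [_ [s' es' eS']] := EV e2.
have ss' : s = s' by apply: perm_list_inj; rewrite es es'.
move: eS; rewrite eS' ss' -e12 => /(congr1 (relabel s'^-1)).
rewrite !relabelM !mulVg !relabel1 => /ref_seed_inj.
by rewrite word_at_mul word_at_inv => ->; rewrite mulVg.
Qed.

(** Here both positions lie over the initial quiver but their permutations may differ; the
    discrepancy is an automorphism of the quiver that acts as a known word. *)
Definition root_symmetry (c : positive * nat * nat) : option (word * seq nat) :=
  let: (j, k, i) := c in
  if PM.find j nodes is None then None else
  if (cell_position n' nodes E j k i, find_edge E j k) is
    (Some (w, 1%positive, p), Some (w', 1%positive, p'))
  then Some (mul_word (inv_word w) w', compose_list (inverse_list n' p') p)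
  else None.

Lemma root_symmetryP c w s x : ref_path n' nodes 1%positive = [::] ->
  root_symmetry c = Some (w, perm_list s) ->
  relabel s (class_seed x) = class_seed (x * word_at rho w)%g.
Proof.
case: c => [[j k] i] r1; rewrite /root_symmetry; case e : PM.find => [y|] //.
case e1 : cell_position => [[[w1 []] p1]|] //.
case e2 : find_edge => [[[w2 []] p2]|] // e3.
have ew : mul_word (inv_word w1) w2 = w := congr1 (fun o => odflt w (omap fst o)) e3.
have : compose_list (inverse_list n' p2) p1 = perm_list s :=
  congr1 (fun o => odflt p1 (omap snd o)) e3.
move: {e3}ew => <-.
have jn : PM.find j nodes <> None by rewrite e.
have [_ [s1 <- eS]] := cell_valid NV EV jn e1.
have [_ [s2 <- eS']] := EV e2.
rewrite -perm_listV -perm_listM => /perm_list_inj <-.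
move: eS; rewrite eS' /ref_seed r1 /= => /(congr1 (relabel s2^-1)).
rewrite !relabelM mulVg relabel1; set r := (_ * s1)%g => eS.
have ok : quiver_iso Q (seed_arrows (mutate_path (initial_seed Q) [::])) r.
  apply/quiver_isoP => a b.
  exact: (congr1 (fun T => seed_arrows T a b) (esym eS)).
pose h : modular_pair Q := exist _ ([::], r) ok.
have hE z : class_seed (z * modular_class h)%g = relabel r (class_seed z).
  exact: class_seedM.
rewrite word_at_mul word_at_inv.
have -> : word_at rho w2 = (word_at rho w1 * modular_class h)%g.
  by apply: class_seed_inj; rewrite hE eS.
by rewrite mulKg hE.
Qed.

Definition complete :=
  all (fun jx : positive * node => all (fun k =>
    if find_edge E jx.1 k is Some (_, j', _)
    then if PM.find j' nodes is Some _ then true else false else false)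
  (identity_list n')) (PM.elements nodes).

(** With no edge missing, the position can be followed through every mutation of P. *)
Lemma complete_reach P : complete -> PM.find 1%positive nodes <> None ->
  ref_path n' nodes 1%positive = [::] ->
  exists w j p, at_position rho nodes (mutate_path (initial_seed Q) P) (w, j, p) /\
    PM.find j nodes <> None.
Proof.
move=> comp n1 r1; elim/last_ind: P => [|P k [w [j [p [h jn]]]]].
  exists [::], 1%positive, (identity_list n'); split=> //.
  have := start_valid rho nodes 1%positive.
  by rewrite {1}/ref_seed r1 /= class_seed1.
case e : (PM.find j nodes) jn => [x|] // _.
have jx := PM.elements_correct nodes j e.
case: (h) => s sp _; pose sk : nat := s k.
have : find_edge E j sk <> None /\ forall w' j' p',
    find_edge E j sk = Some (w', j', p') -> PM.find j' nodes <> None.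
  have mem_n : sk \in identity_list n' by rewrite mem_iota /= ltn_ord.
  have := allP (all_In jx comp) _ mem_n; rewrite /=.
  by case: find_edge => [[[w' j'] p']|] // H; split=> // ? ? ? [_ <- _] e'; rewrite e' in H.
case eE : find_edge => [[[w' j'] p']|] [] // _ /(_ _ _ _ erefl) jn.
exists (mul_word w w'), j', (compose_list p p'); split=> //.
rewrite -cats1 mutate_path_cat /= -[k in mutate _ k]inord_val.
apply: (step_valid (b := (mul_word w w', j', compose_list p p')) EV (ltn_ord k) h) => /=.
by rewrite -sp nth_perm_list -/sk eE.
Qed.

End Valid.
End Table.

(** The multiset of degree pairs is an isomorphism invariant, cheap to compute and sharp enough to
    single out the initial quiver. *)
Definition degrees (q : arrow_lists) : seq (nat * nat) :=
  [seq (sumn [seq entry q i k | k <- iota 0 n], sumn [seq entry q k i | k <- iota 0 n])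
     | i <- iota 0 n].

Lemma degrees_relabel (q : arrows n) (s : 'S_n) :
  perm_eq (degrees (lists_of (fun i j : 'I_n => q (s i) (s j))))
          (degrees (lists_of q)).
Proof.
have sE f : sumn [seq f k | k <- iota 0 n] = \sum_(k < n) f k.
  by rewrite sumnE big_map -[iota 0 n]/(index_iota 0 n) big_mkord.
have dE r : degrees (lists_of r) =
    [seq (\sum_j r i j, \sum_j r j i) | i : 'I_n].
  rewrite /degrees -val_enum_ord -map_comp; apply: eq_map => i /=.
  by rewrite val_enum_ord !sE; congr (_, _); apply: eq_bigr => k _;
    rewrite entry_lists_of.
rewrite !dE.
have -> : [seq (\sum_j q (s u) (s j), \sum_j q (s j) (s u)) | u : 'I_n] =
    [seq (\sum_j q u j, \sum_j q j u) | u <- [seq s u | u : 'I_n]].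
  rewrite -map_comp; apply: eq_map => u /=.
  by congr (_, _); rewrite [RHS](reindex_inj (@perm_inj _ s)).
apply: perm_map; apply: uniq_perm; rewrite ?(map_inj_uniq perm_inj) ?enum_uniq //.
move=> i; rewrite mem_enum; apply/mapP; exists (s^-1%g i); rewrite ?mem_enum //.
by rewrite permKV.
Qed.

(** Backtracking search: x holds the images of the first nodes, and the image of the next one must
    be compatible with all arrows to them. *)
Definition extensions (q : arrow_lists) (x : seq nat) : seq (seq nat) :=
  [seq rcons x v | v <- iota 0 n & (v \notin x) &&
     all (fun u => (entry q u (size x) == entry q (nth 0 x u) v) &&
                   (entry q (size x) u == entry q v (nth 0 x u))) (iota 0 (size x))].

Definition partial_automorphisms (q : arrow_lists) (m : nat) : seq (seq nat) :=
  iter m (fun r => flatten [seq extensions q x | x <- r]) [:: [::]].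

Lemma automorphism_in (q : arrows n) (s : 'S_n) : (forall u v : 'I_n, q (s u) (s v) = q u v) ->
  perm_list s \in partial_automorphisms (lists_of q) n.
Proof.
move=> qs; rewrite -[perm_list s](@take_oversize _ n) ?size_perm_list //.
have: n <= n by [].
elim: {1 3 4}n => [|m IH] lt_m; first by rewrite take0 mem_head.
rewrite (take_nth 0) ?size_perm_list //.
apply/flatten_mapP; exists (take m (perm_list s)); first exact/IH/ltnW.
apply/mapP; exists (nth 0 (perm_list s) m) => //.
have sm : nth 0 (perm_list s) m = s (Ordinal lt_m) := nth_perm_list s (Ordinal lt_m).
have sz : size (take m (perm_list s)) = m by rewrite size_takel // size_perm_list ltnW.
rewrite mem_filter mem_iota sm add0n ltn_ord !andbT sz; apply/andP; split.
  have : uniq (take m.+1 (perm_list s)).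
    rewrite take_uniq // map_inj_uniq ?enum_uniq //.
    by move=> x y /val_inj/perm_inj.
  by rewrite (take_nth 0) ?size_perm_list // rcons_uniq sm => /andP[].
apply/allP => u; rewrite mem_iota /= => lt_u.
have lt_un := ltn_trans lt_u lt_m.
rewrite nth_take // (nth_perm_list s (Ordinal lt_un)).
have eE (x y : 'I_n) : entry (lists_of q) (s x) (s y) = entry (lists_of q) x y.
  by rewrite !entry_lists_of.
by rewrite -(eE (Ordinal lt_un) (Ordinal lt_m)) -(eE (Ordinal lt_m) (Ordinal lt_un)) !eqxx.
Qed.

End Certificate.

(** * Groups with the modular relations *)

Section Rewriting.
Variables (G : groupType) (H : G -> Prop) (value : nat -> G).
Hypotheses (subH : is_subgroup H) (normH : is_normal H).
Local Open Scope group_scope.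
Implicit Types (w todo done : seq nat) (rules : seq (seq nat * seq nat)).

Definition string_val w : G := \prod_(x <- w) value x.

Lemma string_val_cons x w : string_val (x :: w) = value x * string_val w.
Proof. by rewrite /string_val big_cons. Qed.

Lemma string_val_cat w w' : string_val (w ++ w') = string_val w * string_val w'.
Proof. by rewrite /string_val big_cat. Qed.

Lemma string_val_nil : string_val [::] = 1.
Proof. by rewrite /string_val big_nil. Qed.

Fixpoint find_rule rules w : option (seq nat * seq nat) :=
  if rules is (l, r) :: rules' then
    if prefix l w then Some (r, drop (size l) w) else find_rule rules' w
  else None.

(* [done] is in normal form; the letters of [todo], which is reversed, are still
   to be put in front of it. *)
Fixpoint rewrite_loop fuel rules todo done : seq nat :=
  if fuel is fuel'.+1 then
    if todo is x :: todo' then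
      if find_rule rules (x :: done) is Some (r, rest)
      then rewrite_loop fuel' rules (catrev r todo') rest
      else rewrite_loop fuel' rules todo' (x :: done)
    else done
  else catrev todo done.

(** Every rewriting step preserves the value modulo [H], and exhausted fuel puts the remaining
    letters back unchanged. Equality of two normal forms is therefore a proof of congruence. *)
Definition normal_form rules w := rewrite_loop 5000 rules (rev w) [::].

(** One development serves two purposes: [H] trivial for relations in the group, and [H] the
    parabolic subgroup for its cosets. *)
Definition congruent x y := H (x * y^-1).

Lemma congruent_refl x : congruent x x.
Proof. by rewrite /congruent mulgV; case: subH. Qed.

Lemma subgroupV x : H x -> H x^-1.
Proof. by case: subH => H1 HM /(HM _ _ H1); rewrite mul1g. Qed.

Lemma subgroupM x y : H x -> H y -> H (x * y).
Proof. by case: subH => H1 HM Hx /subgroupV /(HM _ _ Hx); rewrite invgK. Qed.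

Lemma normal_conj g x : H x -> H (g * x * g^-1).
Proof. by move=> Hx; have := normH g^-1 Hx; rewrite /conjg invgK mulgA. Qed.

Lemma congruent_sym x y : congruent x y -> congruent y x.
Proof. by move=> /subgroupV; rewrite /congruent invgM invgK. Qed.

Lemma congruent_trans y x z : congruent x y -> congruent y z -> congruent x z.
Proof. by move=> h /(subgroupM h); rewrite /congruent -!mulgA mulKg. Qed.

Lemma congruentM x x' y y' : congruent x x' -> congruent y y' ->
  congruent (x * y) (x' * y').
Proof.
move=> hx /(normal_conj x') hy; have := subgroupM hx hy.
by rewrite /congruent invgM -!mulgA mulKg !mulgA.
Qed.

Definition rules_valid rules := forall l r, (l, r) \in rules ->
  congruent (string_val l) (string_val r).

Lemma find_ruleP rules w r rest : rules_valid rules ->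
  find_rule rules w = Some (r, rest) ->
  congruent (string_val w) (string_val (r ++ rest)).
Proof.
elim: rules => //= -[l r'] rules IH valid; case: ifP => [|_ /IH]; last first.
  by apply=> l0 r0 in0; apply: valid; rewrite inE in0 orbT.
case/prefixP=> w' -> [<- <-]; rewrite drop_size_cat // !string_val_cat.
by apply: congruentM; [apply: valid; rewrite mem_head | exact: congruent_refl].
Qed.

Lemma normal_formP rules w : rules_valid rules ->
  congruent (string_val w) (string_val (normal_form rules w)).
Proof.
move=> valid; rewrite /normal_form -{1}[w]revK -[rev (rev w)]/(catrev (rev w) [::]).
elim: 5000%N (rev w) [::] => [|fuel IH] todo done /=; first exact: congruent_refl.
case: todo => [|x todo]; first exact: congruent_refl.
case e : find_rule => [[r rest]|]; last exact: (IH todo (x :: done)).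
apply: congruent_trans (IH (catrev r todo) rest); rewrite !catrevE rev_cat revK -catA.
rewrite rev_cons cat_rcons !(string_val_cat (rev _)).
apply: congruentM; first exact: congruent_refl.
exact: find_ruleP e.
Qed.

Lemma normal_form_congruent rules w w' : rules_valid rules ->
  normal_form rules w == normal_form rules w' ->
  congruent (string_val w) (string_val w').
Proof.
move=> valid /eqP e; apply: congruent_trans (normal_formP w valid) _.
by rewrite e; apply: congruent_sym; apply: normal_formP.
Qed.

End Rewriting.

Section Trivial.
Variable G : groupType.
Local Open Scope group_scope.

Lemma trivial_subgroup : is_subgroup (fun x : G => x = 1).
Proof. by split=> // x y -> ->; rewrite mulgV. Qed.

Lemma trivial_normal : is_normal (fun x : G => x = 1).
Proof. by move=> x g ->; rewrite conj1g. Qed.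

End Trivial.

(** Setting a = 1 forces c = t^2 and leaves e^2 = (e t^-1)^3 = 1, the presentation of PSL(2, Z),
    with g = t^-4. *)
Record modular_relations (G : groupType) (g a c t e : G) : Prop := ModularRelations {
  rel_aa : (a * a = 1)%g;
  rel_ee : (e * e = 1)%g;
  rel_ccg : (c * c * g = 1)%g;
  rel_tttt : (t * t * t * t = c * c)%g;
  rel_ac : (a * c = c * a)%g;
  rel_ct : (c * t = t * c)%g;
  rel_tata : (t * (a * t * a) = a * t * a * t)%g;
  rel_eae : (e * a * e = c^-1 * t * t)%g;
  rel_eta : (e * t^-1 * a * e * t^-1 * a * e * t^-1 * a = 1)%g
}.

(** Numbers from 6 on get the value 1, so every list of numbers is a string with a value. *)
Definition modular_value (G : groupType) (a t e : G) (i : nat) : G :=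
  let u := (t * (a * t * a)^-1)%g in
  nth 1%g [:: e; t^-1 * e; e * t; u; e * a * e; a]%g i.

Local Notation xe := 0%N (only parsing).
Local Notation xf := 1%N (only parsing).
Local Notation xF := 2 (only parsing).
Local Notation xu := 3 (only parsing).
Local Notation xz := 4 (only parsing).
Local Notation xa := 5 (only parsing).

(* Normal forms are an element u^i z^j a^k of a normal subgroup of order 16 followed
   by a word in e, f = t^-1 e, F = e t without ee, ff, fF, Ff, FF: a normal form in the
   free product of groups of orders 2 and 3. *)
Definition modular_rules : seq (seq nat * seq nat) :=
  [:: ([:: xe; xe], [::]); ([:: xf; xF], [::]); ([:: xF; xf], [::]);
      ([:: xf; xf], [:: xu; xz; xF]); ([:: xF; xF], [:: xu; xu; xu; xz; xf]);
      ([:: xu; xu; xu; xu], [::]); ([:: xz; xz], [::]); ([:: xa; xa], [::]);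
      ([:: xz; xu], [:: xu; xz]); ([:: xa; xu], [:: xu; xu; xu; xa]);
      ([:: xa; xz], [:: xu; xu; xz; xa]);
      ([:: xe; xu], [:: xu; xz; xa; xe]); ([:: xf; xu], [:: xz; xa; xf]);
      ([:: xF; xu], [:: xu; xz; xa; xF]); ([:: xe; xz], [:: xa; xe]);
      ([:: xf; xz], [:: xu; xu; xu; xa; xf]); ([:: xF; xz], [:: xa; xF]);
      ([:: xe; xa], [:: xz; xe]); ([:: xf; xa], [:: xz; xf]);
      ([:: xF; xa], [:: xu; xu; xu; xa; xF])].

Section Relations.
Local Open Scope group_scope.
Variables (G : groupType) (g a c t e : G).
Hypothesis R : modular_relations g a c t e.

(** Variables with defining equations, so that rewriting treats s, u and z as atoms. *)
Variables s u z : G.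
Hypotheses (s_def : s = a * t * a) (u_def : u = t * s^-1) (z_def : z = e * a * e).

Let aV : a^-1 = a. Proof. by rewrite -[LHS]mulg1 -(rel_aa R) mulKg. Qed.
Let eV : e^-1 = e. Proof. by rewrite -[LHS]mulg1 -(rel_ee R) mulKg. Qed.
Let zV : z^-1 = z. Proof. by rewrite z_def !invgM aV eV mulgA. Qed.
Let zz : z * z = 1. Proof. by rewrite -{2}zV mulgV. Qed.
Let aa x : a * (a * x) = x. Proof. by rewrite mulgA (rel_aa R) mul1g. Qed.
Let ee x : e * (e * x) = x. Proof. by rewrite mulgA (rel_ee R) mul1g. Qed.
Let zzx x : z * (z * x) = x. Proof. by rewrite mulgA zz mul1g. Qed.
Let sV : s^-1 = a * t^-1 * a. Proof. by rewrite s_def !invgM aV mulgA. Qed.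
Let ts : commute t s. Proof. by rewrite /commute s_def (rel_tata R). Qed.
Let ct : commute c t := rel_ct R.
Let ca : commute c a := esym (rel_ac R).
Let cs : commute c s.
Proof. by rewrite s_def; exact: (commuteM (commuteM ca ct) ca). Qed.
Let zE : z = c^-1 * t * t. Proof. by rewrite z_def (rel_eae R). Qed.
Let tz : commute t z.
Proof.
have tc : commute t c^-1 by apply/commuteV/commute_sym.
rewrite zE; exact: (commuteM (commuteM tc (commute_refl t)) (commute_refl t)).
Qed.
Let tu : commute t u.
Proof. by rewrite u_def; exact: (commuteM (commute_refl t) (commuteV ts)). Qed.
Let sz : commute s z.
Proof.
have sc : commute s c^-1 by apply/commuteV/commute_sym.
have st := commute_sym ts; rewrite zE; exact: (commuteM (commuteM sc st) st).
Qed.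
Let zu : commute z u.
Proof.
rewrite u_def; exact: (commuteM (commute_sym tz) (commuteV (commute_sym sz))).
Qed.
Let uV : u^-1 = a * u * a.
Proof. by rewrite u_def invgM invgK sV s_def -!mulgA (rel_aa R) mulg1. Qed.
Let acc x : a * (c * x) = c * (a * x).
Proof. by rewrite !mulgA (rel_ac R). Qed.
Let t4 x : t * (t * (t * (t * x))) = c * (c * x).
Proof. by rewrite !mulgA (rel_tttt R). Qed.
Let s4 x : s * (s * (s * (s * x))) = c * (c * x).
Proof. by rewrite s_def -!mulgA !aa t4 !acc aa. Qed.
(** The elements t and s commute and have the same fourth power: s^4 = a t^4 a = a c^2 a = c^2. *)
Let u4 : u ^+ 4 = 1.
Proof.
have h x : (forall y, x * (x * (x * (x * y))) = c * (c * y)) -> x ^+ 4 = c * c.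
  by move=> e1; rewrite !expgS expg0 e1 mulg1.
rewrite u_def expgMn; last exact: commuteV.
by rewrite expVgn (h _ t4) (h _ s4) mulgV.
Qed.
Let u4x x : u * (u * (u * (u * x))) = x.
Proof. by rewrite -[RHS]mul1g -u4 !expgS expg0 mulg1 -!mulgA. Qed.
Let u3 : u^-1 = u * (u * u).
Proof. by rewrite -[LHS]mulg1 -u4 !expgS expg0 mulKg mulg1. Qed.
Let aux x : a * (u * x) = u * (u * (u * (a * x))).
Proof.
have -> : a * (u * x) = u^-1 * (a * x) by rewrite uV -!mulgA aa.
by rewrite u3 -!mulgA.
Qed.
Let ttx x : t * (t * x) = c * (z * x).
Proof. by rewrite zE -!mulgA mulVKg. Qed.
Let ssx x : s * (s * x) = c * (a * (z * (a * x))).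
Proof. by rewrite s_def -!mulgA !aa ttx acc. Qed.
Let swap (x y w : G) : commute x y -> x * (y * w) = y * (x * w).
Proof. by move=> xy; rewrite !mulgA xy. Qed.
Let su : commute s u.
Proof.
by rewrite u_def; exact: (commuteM (commute_sym ts) (commuteV (commute_refl s))).
Qed.
Let cu : commute c u.
Proof. by rewrite u_def; exact: (commuteM ct (commuteV cs)). Qed.
Let tE : t = u * s. Proof. by rewrite u_def mulgKV. Qed.
(** Compare t^2 = c z with s^2 = c (a z a) by means of t = u s: this gives z = u^2 (a z a), and u^2
    is its own inverse. *)
Let azax x : a * (z * (a * x)) = u * (u * (z * x)).
Proof.
have h : u * (u * (a * (z * (a * x)))) = z * x.
  apply: (mulgI c); rewrite -ttx (swap _ cu) (swap _ cu) -ssx tE -!mulgA.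
  by rewrite (swap _ su).
by rewrite -[LHS]u4x h.
Qed.
Let azx x : a * (z * x) = u * (u * (z * (a * x))).
Proof. by rewrite -azax aa. Qed.
Let eax x : e * (a * x) = z * (e * x). Proof. by rewrite z_def -!mulgA ee. Qed.
Let ezx x : e * (z * x) = a * (e * x). Proof. by rewrite z_def -!mulgA ee. Qed.
Let zux x : z * (u * x) = u * (z * x) := swap x zu.
Let tzx x : t * (z * x) = z * (t * x) := swap x tz.
Let tux x : t * (u * x) = u * (t * x) := swap x tu.
Let tVz x : t^-1 * (z * x) = z * (t^-1 * x).
Proof. exact/swap/commute_sym/commuteV/commute_sym. Qed.
Let tVu x : t^-1 * (u * x) = u * (t^-1 * x).
Proof. exact/swap/commute_sym/commuteV/commute_sym. Qed.
Let tax x : t * (a * x) = u * (a * (t * x)).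
Proof. by rewrite u_def sV -!mulgA aa mulKg. Qed.
Let tVax x : t^-1 * (a * x) = u * (u * (u * (a * (t^-1 * x)))).
Proof.
apply: (mulgI t); rewrite mulVKg !tux tax mulVKg.
by rewrite u4x.
Qed.
Let aex x : a * (e * x) = e * (z * x). Proof. by rewrite z_def -!mulgA ee. Qed.
(* The cubic relation reads e t^-1 e (z t^-1 e z t^-1 a) = 1. *)
Let etex x : e * (t * (e * x)) = z * (t^-1 * (e * (z * (t^-1 * (a * x))))).
Proof.
have h := rel_eta R; rewrite -!mulgA !aex in h.
have {}h : z * (t^-1 * (e * (z * (t^-1 * a)))) = e * (t * e).
  apply: (mulgI e); rewrite ee; apply: (mulgI t^-1); rewrite mulKg.
  by apply: (mulgI e); rewrite (rel_ee R).
have -> : z * (t^-1 * (e * (z * (t^-1 * (a * x))))) =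
    z * (t^-1 * (e * (z * (t^-1 * a)))) * x by rewrite -!mulgA.
by rewrite h -!mulgA.
Qed.
Let etVex x : e * (t^-1 * (e * x)) = a * (t * (z * (e * (t * (z * x))))).
Proof.
apply: (mulgI e); apply: (mulgI t); apply: (mulgI e).
by rewrite ee mulVKg ee etex aa mulKg zzx ee mulKg zzx.
Qed.
Let aE x : a * x = e * (z * (e * x)). Proof. by rewrite ezx ee. Qed.
Let zazx x : z * (a * (z * (a * x))) = u * (u * x).
Proof. by rewrite azax !zux zzx. Qed.
(** The element u^2 equals z a z a, and conjugation by e exchanges a and z. *)
Let euux x : e * (u * (u * x)) = u * (u * (e * x)).
Proof. by rewrite -[in LHS]zazx ezx eax ezx eax azax zzx. Qed.
Let auux x : a * (u * (u * x)) = u * (u * (a * x)).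
Proof. by rewrite !aux u4x. Qed.
(** With u = t a t^-1 a and a = e z e, the product contains e t e and e t^-1 e, which the two forms
    of the cubic relation rewrite. *)
Let eux x : e * (u * x) = u * (z * (a * (e * x))).
Proof.
have uE y : u * y = t * (a * (t^-1 * (a * y))).
  by rewrite u_def sV -!mulgA.
rewrite {1}uE [a * (t^-1 * _)]aE etex [a * x]aE etVex azax.
rewrite !tVu tVz mulKg !zzx ezx euux ee auux !tVu tVax mulKg u4x.
by rewrite zux.
Qed.

Lemma modular_rules_valid :
  rules_valid (fun x => x = 1) (modular_value a t e) modular_rules.
Proof.
suff /allP h : all (fun lr => string_val (modular_value a t e) lr.1 ==
    string_val (modular_value a t e) lr.2) modular_rules.
  by move=> l r /h /eqP /= e1; rewrite /congruent e1 mulgV.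
rewrite /= !andbT !string_val_cons !string_val_nil.
rewrite /modular_value /= -s_def -u_def -z_def -!mulgA.
(* These rules move u, z and a to the left of e, t and t^-1, and sort them among themselves. *)
pose push := (aa, ee, zzx, u4x, mulKg, mulVKg, aux, azx, zux, eux, ezx, eax,
  tux, tzx, tax, tVu, tVz, tVax).
repeat (apply/andP; split); apply/eqP.
1-3: by rewrite !push.
- by rewrite etVex !push.
- by rewrite etex !push.
all: by rewrite !push.
Qed.
End Relations.

(** * The subgroup generated by t^-4 and four conjugates: normality and cosets *)

Section Parabolic.
Local Open Scope group_scope.
Variables (G : groupType) (g a c t e : G).
Hypothesis R : modular_relations g a c t e.
Hypothesis generated : forall H : G -> Prop,
  is_subgroup H -> H a -> H t -> H e -> forall x, H x.

Local Notation value := (modular_value a t e).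
Local Notation sval := (string_val value).

Let rules_ok : rules_valid (fun x => x = 1) value modular_rules :=
  modular_rules_valid R erefl erefl erefl.

Lemma nf_eq v w : normal_form modular_rules v == normal_form modular_rules w ->
  sval v = sval w.
Proof.
move=> e1; apply/divg1_eq.
exact: (normal_form_congruent (trivial_subgroup G) (@trivial_normal G) rules_ok).
Qed.

Definition letter_inverse (i : nat) : seq nat :=
  nth [::] [:: [:: xe]; [:: xF]; [:: xf]; [:: xu; xu; xu]; [:: xz]; [:: xa]] i.

Definition string_inverse (w : seq nat) := flatten [seq letter_inverse i | i <- rev w].

Lemma string_inverseP w : sval (string_inverse w) = (sval w)^-1.
Proof.
elim: w => [|i w IH]; first by rewrite /sval /= !big_nil invg1.
rewrite /string_inverse rev_cons map_rcons -cats1 flatten_cat string_val_cat IH.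
rewrite string_val_cons invgM; congr (_ * _); rewrite /= cats0.
apply: (mulIg (value i)); rewrite mulVg.
have -> : sval (letter_inverse i) * value i = sval (rcons (letter_inverse i) i).
  by rewrite -cats1 string_val_cat string_val_cons string_val_nil mulg1.
case: (ltnP i 6) => [|le_i]; last first.
  rewrite /letter_inverse nth_default // string_val_cons string_val_nil mulg1.
  by rewrite /modular_value nth_default.
rewrite -(string_val_nil value).
by do 6![case: i => [|i]; first by move=> _; apply: nf_eq; vm_compute].
Qed.

Definition parabolic (i : 'I_5) : G :=
  if val i is j.+1 then t ^+ j * e * (t ^- 4) * e * t ^- j else t ^- 4.

Definition parabolic_string (i : nat) (b : bool) : seq nat :=
  let base := flatten (nseq 4 (if b then [:: xe; xF] else [:: xf; xe])) in
  if i is j.+1 then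
    flatten (nseq j [:: xe; xF]) ++ xe :: base ++ xe :: flatten (nseq j [:: xf; xe])
  else base.

Let sval_t : sval [:: xe; xF] = t.
Proof.
by rewrite !string_val_cons string_val_nil mulg1 mulgA (rel_ee R) mul1g.
Qed.

Let sval_tV : sval [:: xf; xe] = t^-1.
Proof.
by rewrite !string_val_cons string_val_nil mulg1 -mulgA (rel_ee R) mulg1.
Qed.

Let sval_flatten n w : sval (flatten (nseq n w)) = sval w ^+ n.
Proof.
elim: n => [|n IH]; first by rewrite expg0 string_val_nil.
by rewrite /= string_val_cat IH expgS.
Qed.

Let eV : e^-1 = e. Proof. by rewrite -[LHS]mulg1 -(rel_ee R) mulKg. Qed.

Lemma parabolic_stringP (l : 'I_5 * bool) :
  sval (parabolic_string l.1 l.2) = letter_at parabolic l.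
Proof.
have base b : sval (flatten (nseq 4 (if b then [:: xe; xF] else [:: xf; xe]))) =
    letter_val (t ^- 4, b).
  by rewrite sval_flatten /letter_val; case: b; rewrite /= ?sval_t ?sval_tV ?invgK ?expVgn.
case: l => i b; rewrite /letter_at /parabolic /parabolic_string /=.
case: (val i) => [|j]; first exact: base.
rewrite string_val_cat !string_val_cons string_val_cat base string_val_cons.
rewrite !sval_flatten sval_t sval_tV /value /= expVgn /letter_val.
by case: b; rewrite /= ?invgM ?invgK ?eV !mulgA.
Qed.

Definition parabolic_word := seq (nat * bool).

Definition index_word (w : parabolic_word) : seq ('I_5 * bool) :=
  [seq (inord l.1, l.2) | l <- w].

Definition word_string (w : parabolic_word) : seq nat :=
  flatten [seq parabolic_string l.1 l.2 | l <- w].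

Definition good_word (w : parabolic_word) := all (fun l => l.1 < 5) w.

Lemma word_stringP w : good_word w ->
  sval (word_string w) = word_at parabolic (index_word w).
Proof.
elim: w => [|[i b] w IH] /=; first by rewrite string_val_nil word_at_nil.
case/andP=> lt_i /IH {}IH.
rewrite string_val_cat IH word_at_cons; congr (_ * _).
by rewrite -parabolic_stringP /= inordK.
Qed.

Definition parabolic_subgroup x := exists w, x = word_at parabolic w.

Lemma parabolic_is_subgroup : is_subgroup parabolic_subgroup.
Proof.
split; first by exists [::]; rewrite word_at_nil.
move=> _ _ [v ->] [w ->]; exists (v ++ inv_word w).
by rewrite word_at_cat word_at_inv.
Qed.

(* For each of t, t^-1, e, a, its conjugates of the five parabolic elements. *)
Definition conjugation_table : seq (seq nat * seq parabolic_word) :=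
  ([:: ([:: xe; xF], [:: [:: (0, false)]; [:: (2, false)]; [:: (3, false)];
         [:: (4, false)]; [:: (0, true); (1, false); (0, false)]]);
      ([:: xf; xe], [:: [:: (0, false)]; [:: (0, false); (4, false); (0, true)];
         [:: (1, false)]; [:: (2, false)]; [:: (3, false)]]);
      ([:: xe], [:: [:: (1, false)]; [:: (0, false)];
         [:: (0, false); (4, false); (0, true)];
         (* This conjugate fixes the slope 3/2, a vertex over the sixth cusp, so all five generators
            enter: the loops around the six cusps satisfy one product relation. *)
         [:: (1, true); (2, true); (3, true); (4, true); (0, true)];
         [:: (1, true); (2, false); (1, false)]]);
      ([:: xa], [seq [:: (i, false)] | i <- iota 0 5])])%N.

Lemma conjugation_table_ok :
  all (fun xw : seq nat * seq parabolic_word =>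
    all (fun i => let w := nth [::] xw.2 i in good_word w &&
      (normal_form modular_rules
         (xw.1 ++ parabolic_string i false ++ string_inverse xw.1) ==
       normal_form modular_rules (word_string w))) (iota 0 5)) conjugation_table.
Proof. by vm_compute. Qed.

Lemma parabolic_conj_table x xs : (x, xs) \in conjugation_table ->
  forall y, parabolic_subgroup y -> parabolic_subgroup (sval x * y * (sval x)^-1).
Proof.
move=> inT _ [w ->]; have ok := allP (allP conjugation_table_ok _ inT : is_true (all _ _)).
have [M1 MM] := parabolic_is_subgroup.
have MV y : parabolic_subgroup y -> parabolic_subgroup y^-1.
  by move=> /(MM _ _ M1); rewrite mul1g.
have gen i : parabolic_subgroup (sval x * parabolic i * (sval x)^-1).
  have in_i : val i \in iota 0 5 by rewrite mem_iota /= ltn_ord.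
  have /andP[gw /nf_eq] := ok _ in_i.
  rewrite !string_val_cat string_inverseP (parabolic_stringP (i, false)) mulgA.
  by rewrite word_stringP // => ->; eexists.
elim: w => [|[i b] w IH].
  by rewrite word_at_nil mulg1 mulgV.
rewrite word_at_cons.
have -> : sval x * (letter_at parabolic (i, b) * word_at parabolic w) * (sval x)^-1 =
    sval x * letter_at parabolic (i, b) * (sval x)^-1 *
    ((sval x * word_at parabolic w * (sval x)^-1)^-1)^-1.
  by rewrite invgK !mulgA mulgKV.
apply: MM (MV _ IH).
case: b; rewrite /letter_at /letter_val //=.
by have := MV _ (gen i); rewrite !invgM invgK mulgA.
Qed.

Lemma parabolic_normal : is_normal parabolic_subgroup.
Proof.
(* Both inclusions are demanded so that [N] is closed under inverses. This is why t needs two rows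
   of the table, whereas e and a are involutions. *)
pose N x := (forall y, parabolic_subgroup y -> parabolic_subgroup (x * y * x^-1)) /\
            (forall y, parabolic_subgroup y -> parabolic_subgroup (x^-1 * y * x)).
have NH : is_subgroup N.
  split; first by split=> y; rewrite ?invg1 ?mulg1 ?mul1g.
  move=> x y [x1 x2] [y1 y2]; split=> h Mh; rewrite invgM invgK.
    by have := x1 _ (y2 _ Mh); rewrite !mulgA.
  by have := y1 _ (x2 _ Mh); rewrite !mulgA.
have tab i : i < 4 -> forall y, parabolic_subgroup y ->
    let x := sval (nth [::] (unzip1 conjugation_table) i) in
    parabolic_subgroup (x * y * x^-1).
  move=> lt_i y My.
  apply: (parabolic_conj_table (xs := nth [::] (unzip2 conjugation_table) i)) My.
  by do 4![case: i lt_i => [|i] lt_i; first by rewrite !inE eqxx ?orbT].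
have one x : sval [:: x] = value x.
  by rewrite string_val_cons string_val_nil mulg1.
have Nt : N t.
  split=> y My; first by have := tab 0 isT y My; rewrite /= sval_t.
  by have := tab 1%N isT y My; rewrite /= sval_tV invgK.
have Ne : N e by split=> y My; have := tab 2 isT y My; rewrite /= one /= eV.
have aV : a^-1 = a by rewrite -[LHS]mulg1 -(rel_aa R) mulKg.
have Na : N a by split=> y My; have := tab 3 isT y My; rewrite /= one /= aV.
move=> x h Mx; have [_ /(_ _ Mx)] := generated NH Na Nt Ne h.
by rewrite /conjg mulgA.
Qed.

(** The first generator t^-4 is g, since c^2 g = 1 and t^4 = c^2; the others are conjugates of it,
    and [parabolic_normal] gives the converse inclusion. *)
Theorem normal_closure_parabolic x : normal_closure g x <-> parabolic_subgroup x.
Proof.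
have g0 : parabolic ord0 = g.
  apply: (mulgI (c * c)); rewrite (rel_ccg R) -(rel_tttt R) /parabolic /=.
  by rewrite [X in X * _](_ : _ = t ^+ 4) ?mulgV // !expgS expg0 mulg1 !mulgA.
split=> [h|[w ->]].
  apply: h parabolic_is_subgroup parabolic_normal _.
  by exists [:: (ord0, false)]; rewrite word_at_cons word_at_nil mulg1 -g0.
move=> H SH NH Hg.
have HV y : H y -> H y^-1 := @subgroupV _ _ SH y.
have HM y z : H y -> H z -> H (y * z) := @subgroupM _ _ SH y z.
have Hp i : H (parabolic i).
  move: Hg; rewrite -g0 /parabolic /=; case: (val i) => // j Hg.
  have -> : t ^+ j * e * t ^- 4 * e * t ^- j = (t ^- 4) ^ (t ^+ j * e)^-1.
    by rewrite /conjg invgK (invgM _ e) eV !mulgA.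
  exact: NH.
elim: w => [|[i b] w IH]; first by rewrite word_at_nil; case: SH.
rewrite word_at_cons; apply: HM => //.
by case: b; rewrite /letter_at /letter_val /=; [apply: HV|].
Qed.

(** Strings have no inverse letters; [letter_inverse] makes up for this, so the coset enumeration
    only has to append letters. *)
Lemma string_exists x : exists w, x = sval w.
Proof.
have H : is_subgroup (fun y => exists w, y = sval w).
  split; first by exists [::]; rewrite string_val_nil.
  move=> _ _ [v ->] [w ->]; exists (v ++ string_inverse w).
  by rewrite string_val_cat string_inverseP.
have one i : sval [:: i] = value i by rewrite string_val_cons string_val_nil mulg1.
apply: (generated H); first by exists [:: xa]; rewrite one.
  by exists [:: xe; xF].
by exists [:: xe]; rewrite one.
Qed.

(* Modulo the parabolic subgroup, t^4 = 1 gives six more rewriting rules; each one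
   comes with the element by which its two sides differ. *)
Definition coset_relations : seq (seq nat * seq nat * parabolic_word) :=
  ([:: ([:: xf; xe; xf; xe], [:: xe; xF; xe; xF], [:: (0, false)]);
      ([:: xF; xe; xF; xe], [:: xe; xf; xe; xf], [:: (1, true)]);
      ([:: xf; xe; xF; xe; xF], [:: xu; xz; xF; xe; xf; xe],
        [:: (0, false); (4, true); (0, true)]);
      ([:: xF; xe; xf; xe; xf], [:: xu; xu; xu; xz; xf; xe; xF; xe],
        [:: (0, false); (4, false); (0, true)]);
      ([:: xf; xe; xF; xe; xf; xe], [:: xu; xu; xe; xF; xe; xf; xe; xF],
        [:: (0, false); (3, false)]);
      ([:: xF; xe; xf; xe; xF], [:: xu; xu; xf; xe; xF; xe; xf],
        [:: (0, false); (4, false); (0, true)])])%N.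

Definition coset_rules := modular_rules ++ unzip1 coset_relations.

Lemma coset_relations_ok : all (fun lrw : seq nat * seq nat * parabolic_word =>
  good_word lrw.2 && (normal_form modular_rules lrw.1.1 ==
    normal_form modular_rules (word_string lrw.2 ++ lrw.1.2))) coset_relations.
Proof. by vm_compute. Qed.

Lemma coset_rules_valid : rules_valid parabolic_subgroup value coset_rules.
Proof.
have [M1 _] := parabolic_is_subgroup.
move=> l r; rewrite mem_cat => /orP[/rules_ok|].
  by rewrite /congruent => ->.
case/mapP=> [[[l' r'] w] inR [-> ->]].
have /andP[gw /nf_eq e1] := allP coset_relations_ok _ inR.
exists (index_word w); rewrite /congruent /= in e1 *.
by rewrite e1 string_val_cat word_stringP // mulgK.
Qed.

(** One normal form for each of the 24 elements of PSL(2, Z) modulo its level 4 subgroup. *)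
Definition projective_strings : seq (seq nat) :=
  [:: [::]; [:: xe]; [:: xf]; [:: xF]; [:: xF; xe]; [:: xf; xe]; [:: xe; xF];
      [:: xe; xf]; [:: xe; xf; xe]; [:: xf; xe; xf]; [:: xF; xe; xf];
      [:: xF; xe; xF]; [:: xf; xe; xF]; [:: xe; xF; xe]; [:: xe; xf; xe; xf];
      [:: xF; xe; xf; xe]; [:: xe; xF; xe; xF]; [:: xf; xe; xF; xe];
      [:: xe; xF; xe; xf]; [:: xe; xf; xe; xF]; [:: xe; xF; xe; xf; xe];
      [:: xe; xf; xe; xF; xe]; [:: xf; xe; xF; xe; xf]; [:: xe; xf; xe; xF; xe; xf]].

Definition kernel_strings : seq (seq nat) :=
  [seq nseq i xu ++ jk | i <- iota 0 4,
    jk <- [:: [::]; [:: xa]; [:: xz]; [:: xz; xa]]].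

Definition coset_strings : seq (seq nat) :=
  [seq k ++ p | k <- kernel_strings, p <- projective_strings].

(** Coset enumeration: the list contains the empty string and is stable under appending a letter and
    normalizing, so it meets every coset. *)
Lemma coset_strings_closed : all (fun r => all (fun i =>
  normal_form coset_rules (rcons r i) \in coset_strings) (iota 0 6)) coset_strings.
Proof. by vm_compute. Qed.

Theorem parabolic_cosets x :
  exists2 r, r \in coset_strings & parabolic_subgroup (x * (sval r)^-1).
Proof.
have [w ->] := string_exists x; elim/last_ind: w => [|w i [r rL IH]].
  exists [::]; first by vm_compute.
  by rewrite mulgV; case: parabolic_is_subgroup.
case: (ltnP i 6) => [lt_i|le_i]; last first.
  exists r => //; rewrite -cats1 string_val_cat string_val_cons string_val_nil mulg1.
  by rewrite /= /modular_value nth_default // mulg1.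
exists (normal_form coset_rules (rcons r i)).
  by apply: (allP (allP coset_strings_closed _ rL : is_true (all _ _))); rewrite mem_iota.
apply: (congruent_trans parabolic_is_subgroup (y := sval (rcons r i))); last first.
  exact: (normal_formP parabolic_is_subgroup parabolic_normal _ coset_rules_valid).
rewrite -!cats1 !string_val_cat.
apply: (congruentM parabolic_is_subgroup parabolic_normal) => //.
exact: (congruent_refl parabolic_is_subgroup).
Qed.

End Parabolic.

(** * A presentation of the cluster modular group of type E_7^(1,1) *)

Local Notation tree_edge j k := (j%positive, k) (only parsing).
Local Notation gen_edge j k j2 p := (j%positive, k, j2%positive, p) (only parsing).
Local Notation cell j k i := (j%positive, k, i) (only parsing).

(* The quivers in the mutation class, up to isomorphism, are numbered from 1, the
   initial quiver, to 506; the l-th entry (j, k) of the spanning tree says that quiver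
   l + 2 is the mutation of quiver j at k. *)
Definition T442_tree : seq (positive * nat) := [::
  tree_edge 1 2; tree_edge 1 3; tree_edge 1 4; tree_edge 1 8; tree_edge 2 0;
  tree_edge 2 3; tree_edge 2 4; tree_edge 2 5; tree_edge 2 6; tree_edge 2 7;
  tree_edge 2 8; tree_edge 3 2; tree_edge 3 4; tree_edge 3 6; tree_edge 3 7;
  tree_edge 3 8; tree_edge 4 3; tree_edge 4 7; tree_edge 4 8; tree_edge 6 3;
  tree_edge 6 5; tree_edge 6 6; tree_edge 6 7; tree_edge 6 8; tree_edge 7 1;
  tree_edge 7 4; tree_edge 7 5; tree_edge 7 6; tree_edge 7 7; tree_edge 7 8;
  tree_edge 8 5; tree_edge 8 6; tree_edge 8 7; tree_edge 8 8; tree_edge 9 0;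
  tree_edge 9 1; tree_edge 9 8; tree_edge 10 5; tree_edge 10 7; tree_edge 10 8;
  tree_edge 11 6; tree_edge 11 8; tree_edge 12 0; tree_edge 13 6;
  tree_edge 13 7; tree_edge 13 8; tree_edge 14 6; tree_edge 14 7;
  tree_edge 14 8; tree_edge 15 8; tree_edge 16 6; tree_edge 16 8;
  tree_edge 18 2; tree_edge 18 7; tree_edge 18 8; tree_edge 19 8;
  tree_edge 21 5; tree_edge 21 6; tree_edge 21 7; tree_edge 21 8;
  tree_edge 22 6; tree_edge 22 7; tree_edge 22 8; tree_edge 23 5;
  tree_edge 23 7; tree_edge 23 8; tree_edge 24 6; tree_edge 24 8;
  tree_edge 26 5; tree_edge 26 6; tree_edge 26 7; tree_edge 26 8;
  tree_edge 27 5; tree_edge 27 6; tree_edge 27 7; tree_edge 27 8;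
  tree_edge 28 0; tree_edge 28 1; tree_edge 28 6; tree_edge 28 7;
  tree_edge 28 8; tree_edge 29 5; tree_edge 29 7; tree_edge 29 8;
  tree_edge 30 6; tree_edge 30 8; tree_edge 31 0; tree_edge 31 1;
  tree_edge 32 0; tree_edge 32 1; tree_edge 32 7; tree_edge 32 8;
  tree_edge 33 5; tree_edge 33 7; tree_edge 33 8; tree_edge 34 6;
  tree_edge 34 8; tree_edge 35 0; tree_edge 36 1; tree_edge 36 8;
  tree_edge 37 3; tree_edge 37 8; tree_edge 38 0; tree_edge 38 1;
  tree_edge 39 8; tree_edge 40 8; tree_edge 41 0; tree_edge 42 5;
  tree_edge 42 8; tree_edge 43 0; tree_edge 44 5; tree_edge 45 5;
  tree_edge 45 7; tree_edge 45 8; tree_edge 46 6; tree_edge 46 8;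
  tree_edge 48 7; tree_edge 48 8; tree_edge 49 6; tree_edge 49 8;
  tree_edge 52 5; tree_edge 52 8; tree_edge 54 7; tree_edge 54 8;
  tree_edge 55 6; tree_edge 55 8; tree_edge 58 2; tree_edge 58 6;
  tree_edge 58 7; tree_edge 58 8; tree_edge 59 5; tree_edge 59 7;
  tree_edge 59 8; tree_edge 60 6; tree_edge 60 8; tree_edge 61 2;
  tree_edge 62 0; tree_edge 62 7; tree_edge 62 8; tree_edge 63 6;
  tree_edge 63 8; tree_edge 64 0; tree_edge 64 2; tree_edge 65 8;
  tree_edge 66 8; tree_edge 68 5; tree_edge 68 8; tree_edge 70 6;
  tree_edge 70 7; tree_edge 70 8; tree_edge 71 5; tree_edge 71 7;
  tree_edge 71 8; tree_edge 72 6; tree_edge 72 8; tree_edge 74 0;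
  tree_edge 74 6; tree_edge 74 7; tree_edge 74 8; tree_edge 75 5;
  tree_edge 75 7; tree_edge 75 8; tree_edge 76 6; tree_edge 76 8;
  tree_edge 77 0; tree_edge 78 1; tree_edge 78 6; tree_edge 78 7;
  tree_edge 78 8; tree_edge 79 6; tree_edge 79 7; tree_edge 79 8;
  tree_edge 80 1; tree_edge 80 8; tree_edge 81 8; tree_edge 82 0;
  tree_edge 82 1; tree_edge 83 0; tree_edge 83 1; tree_edge 83 8;
  tree_edge 84 8; tree_edge 85 0; tree_edge 85 1; tree_edge 86 5;
  tree_edge 86 8; tree_edge 87 0; tree_edge 87 1; tree_edge 88 5;
  tree_edge 89 5; tree_edge 90 7; tree_edge 90 8; tree_edge 91 7;
  tree_edge 91 8; tree_edge 92 8; tree_edge 93 0; tree_edge 93 1;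
  tree_edge 94 8; tree_edge 95 8; tree_edge 96 0; tree_edge 97 5;
  tree_edge 97 8; tree_edge 98 0; tree_edge 99 5; tree_edge 100 3;
  tree_edge 100 8; tree_edge 101 1; tree_edge 102 4; tree_edge 102 6;
  tree_edge 102 8; tree_edge 103 0; tree_edge 104 1; tree_edge 105 0;
  tree_edge 105 3; tree_edge 106 0; tree_edge 106 1; tree_edge 107 0;
  tree_edge 108 5; tree_edge 109 0; tree_edge 109 8; tree_edge 110 0;
  tree_edge 111 5; tree_edge 112 6; tree_edge 113 8; tree_edge 114 8;
  tree_edge 116 5; tree_edge 116 8; tree_edge 118 8; tree_edge 120 5;
  tree_edge 120 8; tree_edge 122 8; tree_edge 124 6; tree_edge 124 8;
  tree_edge 125 0; tree_edge 126 8; tree_edge 128 4; tree_edge 128 6;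
  tree_edge 128 7; tree_edge 128 8; tree_edge 129 0; tree_edge 129 7;
  tree_edge 129 8; tree_edge 130 6; tree_edge 130 8; tree_edge 131 0;
  tree_edge 131 2; tree_edge 132 2; tree_edge 132 8; tree_edge 133 8;
  tree_edge 134 2; tree_edge 135 5; tree_edge 135 8; tree_edge 136 2;
  tree_edge 137 4; tree_edge 137 5; tree_edge 138 8; tree_edge 139 8;
  tree_edge 140 0; tree_edge 140 2; tree_edge 141 8; tree_edge 142 0;
  tree_edge 142 2; tree_edge 143 1; tree_edge 143 6; tree_edge 144 3;
  tree_edge 145 0; tree_edge 145 2; tree_edge 147 8; tree_edge 149 3;
  tree_edge 149 7; tree_edge 149 8; tree_edge 150 6; tree_edge 150 8;
  tree_edge 151 1; tree_edge 151 3; tree_edge 152 8; tree_edge 153 8;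
  tree_edge 155 5; tree_edge 155 8; tree_edge 157 6; tree_edge 157 7;
  tree_edge 157 8; tree_edge 158 1; tree_edge 158 7; tree_edge 158 8;
  tree_edge 159 8; tree_edge 160 0; tree_edge 160 1; tree_edge 161 0;
  tree_edge 161 8; tree_edge 162 8; tree_edge 163 0; tree_edge 164 5;
  tree_edge 164 8; tree_edge 165 0; tree_edge 166 5; tree_edge 167 6;
  tree_edge 167 8; tree_edge 168 1; tree_edge 168 8; tree_edge 169 8;
  tree_edge 170 1; tree_edge 170 2; tree_edge 171 3; tree_edge 171 7;
  tree_edge 171 8; tree_edge 172 6; tree_edge 172 8; tree_edge 173 0;
  tree_edge 173 3; tree_edge 174 8; tree_edge 175 0; tree_edge 175 1;
  tree_edge 176 0; tree_edge 176 1; tree_edge 177 2; tree_edge 178 0;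
  tree_edge 178 6; tree_edge 179 8; tree_edge 180 8; tree_edge 181 0;
  tree_edge 181 1; tree_edge 182 0; tree_edge 182 1; tree_edge 183 5;
  tree_edge 184 5; tree_edge 185 0; tree_edge 185 1; tree_edge 185 8;
  tree_edge 186 0; tree_edge 186 1; tree_edge 187 5; tree_edge 188 5;
  tree_edge 189 2; tree_edge 189 6; tree_edge 190 0; tree_edge 190 6;
  tree_edge 191 8; tree_edge 193 8; tree_edge 195 0; tree_edge 195 1;
  tree_edge 196 1; tree_edge 197 0; tree_edge 197 3; tree_edge 197 6;
  tree_edge 198 0; tree_edge 198 1; tree_edge 199 0; tree_edge 200 5;
  tree_edge 201 0; tree_edge 201 8; tree_edge 202 0; tree_edge 203 5;
  tree_edge 204 6; tree_edge 205 6; tree_edge 205 8; tree_edge 207 3;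
  tree_edge 208 6; tree_edge 208 8; tree_edge 209 8; tree_edge 210 0;
  tree_edge 210 5; tree_edge 212 3; tree_edge 213 3; tree_edge 214 4;
  tree_edge 214 6; tree_edge 216 3; tree_edge 219 8; tree_edge 220 0;
  tree_edge 220 1; tree_edge 221 5; tree_edge 222 6; tree_edge 223 1;
  tree_edge 223 7; tree_edge 224 0; tree_edge 224 1; tree_edge 226 8;
  tree_edge 229 8; tree_edge 231 0; tree_edge 232 5; tree_edge 232 8;
  tree_edge 233 0; tree_edge 234 5; tree_edge 236 6; tree_edge 236 7;
  tree_edge 236 8; tree_edge 237 0; tree_edge 237 7; tree_edge 237 8;
  tree_edge 238 6; tree_edge 238 8; tree_edge 239 0; tree_edge 240 8;
  tree_edge 241 8; tree_edge 242 0; tree_edge 242 2; tree_edge 243 8;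
  tree_edge 244 0; tree_edge 244 2; tree_edge 245 1; tree_edge 245 6;
  tree_edge 247 8; tree_edge 248 0; tree_edge 249 2; tree_edge 250 4;
  tree_edge 250 5; tree_edge 251 2; tree_edge 251 8; tree_edge 252 2;
  tree_edge 253 4; tree_edge 253 5; tree_edge 256 1; tree_edge 257 0;
  tree_edge 258 1; tree_edge 258 2; tree_edge 259 1; tree_edge 260 0;
  tree_edge 261 1; tree_edge 261 6; tree_edge 262 3; tree_edge 263 3;
  tree_edge 264 1; tree_edge 264 7; tree_edge 265 4; tree_edge 268 0;
  tree_edge 268 2; tree_edge 269 4; tree_edge 269 7; tree_edge 269 8;
  tree_edge 270 8; tree_edge 271 3; tree_edge 272 3; tree_edge 272 8;
  tree_edge 273 1; tree_edge 274 3; tree_edge 276 1; tree_edge 276 3;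
  tree_edge 278 8; tree_edge 280 1; tree_edge 280 7; tree_edge 281 8;
  tree_edge 283 7; tree_edge 283 8; tree_edge 284 8; tree_edge 286 1;
  tree_edge 288 6; tree_edge 289 8; tree_edge 290 1; tree_edge 291 0;
  tree_edge 292 5; tree_edge 293 0; tree_edge 293 8; tree_edge 294 0;
  tree_edge 297 3; tree_edge 297 8; tree_edge 299 8; tree_edge 301 2;
  tree_edge 303 1; tree_edge 304 4; tree_edge 305 8; tree_edge 306 1;
  tree_edge 307 8; tree_edge 308 0; tree_edge 308 3; tree_edge 311 0;
  tree_edge 318 3; tree_edge 318 7; tree_edge 320 0; tree_edge 325 2;
  tree_edge 327 8; tree_edge 328 8; tree_edge 330 5; tree_edge 331 5;
  tree_edge 333 0; tree_edge 350 8; tree_edge 351 0; tree_edge 352 5;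
  tree_edge 353 6; tree_edge 355 8; tree_edge 358 1; tree_edge 360 0;
  tree_edge 360 1; tree_edge 361 5; tree_edge 367 4; tree_edge 377 0;
  tree_edge 377 1; tree_edge 378 0; tree_edge 379 2; tree_edge 380 0;
  tree_edge 380 8; tree_edge 381 0; tree_edge 382 5; tree_edge 384 7;
  tree_edge 385 8; tree_edge 388 5; tree_edge 401 7; tree_edge 403 2;
  tree_edge 407 4; tree_edge 408 0; tree_edge 425 1; tree_edge 439 7;
  tree_edge 451 8; tree_edge 459 7; tree_edge 480 7; tree_edge 489 8;
  tree_edge 503 6].

(* The edges outside the tree whose holonomies are the generators gamma, a, c, t, e;
   a exchanges the two long arms of the initial quiver. *)
Definition T442_generators : seq generator_edge := [::
  gen_edge 1 1 1 [:: 1; 0; 2; 3; 4; 5; 6; 7; 8];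
  gen_edge 1 5 2 [:: 0; 1; 5; 6; 7; 2; 3; 4; 8];
  gen_edge 5 0 5 [:: 1; 8; 2; 3; 4; 5; 6; 7; 0];
  gen_edge 6 1 14 [:: 1; 2; 0; 3; 4; 5; 6; 7; 8];
  gen_edge 177 1 296 [:: 6; 1; 3; 2; 4; 0; 5; 8; 7]].

(* In this order, each cell has one edge (j, k) not yet in the table, and
   determines its holonomy. *)
Definition T442_cells : seq (positive * nat * nat) := [::
  cell 2 1 2; cell 3 0 3; cell 3 5 3; cell 4 0 4; cell 4 2 4; cell 4 5 4;
  cell 5 2 8; cell 5 3 8; cell 5 4 8; cell 5 5 8; cell 6 4 1; cell 7 0 3;
  cell 8 0 4; cell 8 1 0; cell 9 2 5; cell 9 3 5; cell 9 4 5; cell 9 6 2;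
  cell 9 7 2; cell 10 0 6; cell 10 1 2; cell 10 3 6; cell 10 4 6; cell 11 0 7;
  cell 11 1 2; cell 11 3 7; cell 11 4 7; cell 11 5 2; cell 12 1 2; cell 12 3 8;
  cell 12 4 8; cell 12 5 8; cell 12 6 8; cell 12 7 8; cell 13 3 2; cell 13 5 2;
  cell 14 0 2; cell 14 3 4; cell 14 5 4; cell 15 0 6; cell 15 2 6; cell 15 4 6;
  cell 16 0 7; cell 16 2 7; cell 16 4 7; cell 16 5 7; cell 17 0 3; cell 17 2 8;
  cell 17 4 8; cell 17 5 3; cell 17 6 8; cell 17 7 8; cell 18 0 3; cell 18 5 3;
  cell 19 0 7; cell 19 2 7; cell 19 3 7; cell 19 4 2; cell 19 5 4; cell 19 6 4;
  cell 20 0 4; cell 20 2 4; cell 20 3 8; cell 20 5 4; cell 20 7 8; cell 21 1 3;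
  cell 21 2 3; cell 21 4 3; cell 22 0 5; cell 22 1 5; cell 22 2 5; cell 22 3 5;
  cell 22 4 1; cell 23 1 6; cell 23 3 6; cell 23 4 1; cell 24 1 7; cell 24 3 7;
  cell 24 4 1; cell 24 5 7; cell 25 0 8; cell 25 1 8; cell 25 2 0; cell 25 3 8;
  cell 25 4 1; cell 25 5 8; cell 25 6 8; cell 25 7 8; cell 26 2 1; cell 26 4 2;
  cell 27 0 3; cell 28 2 3; cell 28 4 5; cell 29 0 3; cell 29 1 6; cell 29 2 6;
  cell 29 4 6; cell 30 0 3; cell 30 1 7; cell 30 2 7; cell 30 4 7; cell 30 5 7;
  cell 31 2 8; cell 31 4 8; cell 31 5 8; cell 31 6 8; cell 31 7 8; cell 32 3 5;
  cell 32 6 2; cell 33 0 4; cell 33 1 0; cell 33 3 0; cell 34 0 4; cell 34 1 0;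
  cell 34 3 0; cell 34 5 4; cell 35 1 2; cell 35 3 8; cell 35 5 8; cell 35 6 8;
  cell 35 7 8; cell 36 3 0; cell 36 4 0; cell 36 5 0; cell 36 6 0; cell 36 7 0;
  cell 37 0 1; cell 37 4 1; cell 37 5 1; cell 37 7 1; cell 38 3 8; cell 38 4 8;
  cell 38 5 2; cell 38 6 2; cell 38 7 2; cell 39 0 2; cell 39 1 2; cell 39 3 5;
  cell 39 4 5; cell 40 0 7; cell 40 1 2; cell 40 3 7; cell 40 4 7; cell 40 6 2;
  cell 41 1 2; cell 41 3 6; cell 41 4 6; cell 41 5 8; cell 41 7 8; cell 42 0 6;
  cell 42 1 2; cell 42 3 6; cell 42 4 6; cell 43 1 2; cell 43 3 7; cell 43 4 7;
  cell 43 5 2; cell 43 6 8; cell 44 3 0; cell 44 4 0; cell 44 6 0; cell 44 7 0;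
  cell 46 5 2; cell 47 0 4; cell 47 1 0; cell 47 5 2; cell 47 6 8; cell 47 7 8;
  cell 48 0 2; cell 49 0 2; cell 49 3 7; cell 49 5 4; cell 50 0 2; cell 50 3 4;
  cell 50 5 4; cell 50 6 8; cell 50 7 8; cell 51 0 6; cell 51 2 6; cell 51 4 6;
  cell 52 0 6; cell 52 2 6; cell 52 4 6; cell 53 0 7; cell 53 2 7; cell 53 4 7;
  cell 53 5 7; cell 53 6 8; cell 54 3 2; cell 54 5 2; cell 55 0 3; cell 55 2 7;
  cell 55 5 3; cell 56 0 3; cell 56 2 8; cell 56 5 3; cell 56 7 8; cell 57 0 4;
  cell 57 2 4; cell 57 3 8; cell 57 5 4; cell 57 6 4; cell 57 7 2; cell 58 0 3;
  cell 58 1 3; cell 58 4 3; cell 59 2 0; cell 59 4 3; cell 60 1 3; cell 60 2 0;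
  cell 60 4 3; cell 60 5 7; cell 61 0 3; cell 61 1 3; cell 61 4 3; cell 61 5 8;
  cell 61 6 8; cell 61 7 8; cell 62 1 6; cell 62 3 6; cell 62 4 1; cell 62 5 6;
  cell 63 0 5; cell 63 1 5; cell 63 2 0; cell 63 3 5; cell 63 4 1; cell 64 1 5;
  cell 64 3 5; cell 64 4 1; cell 64 6 8; cell 64 7 8; cell 65 0 5; cell 65 2 0;
  cell 65 3 5; cell 65 4 5; cell 65 7 0; cell 66 1 7; cell 66 3 7; cell 66 4 7;
  cell 66 5 0; cell 66 6 0; cell 67 0 6; cell 67 1 6; cell 67 2 0; cell 67 3 6;
  cell 67 4 1; cell 67 5 8; cell 67 7 8; cell 68 1 6; cell 68 3 6; cell 68 4 1;
  cell 69 0 7; cell 69 1 7; cell 69 2 0; cell 69 3 7; cell 69 4 1; cell 69 5 7;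
  cell 69 6 8; cell 70 0 2; cell 70 1 5; cell 70 3 5; cell 70 4 0; cell 71 0 2;
  cell 71 4 2; cell 72 0 2; cell 72 4 0; cell 72 5 7; cell 73 0 2; cell 73 1 8;
  cell 73 3 8; cell 73 4 0; cell 73 5 8; cell 73 6 8; cell 73 7 8; cell 74 1 5;
  cell 75 0 3; cell 76 0 3; cell 76 5 7; cell 77 1 8; cell 77 5 8; cell 77 6 8;
  cell 77 7 8; cell 78 2 3; cell 78 4 0; cell 79 0 1; cell 79 2 1; cell 79 4 1;
  cell 80 0 6; cell 80 2 6; cell 80 3 2; cell 80 4 6; cell 80 5 3; cell 80 7 3;
  cell 81 0 7; cell 81 1 7; cell 81 2 3; cell 81 4 5; cell 81 6 3; cell 82 2 3;
  cell 82 4 5; cell 82 6 8; cell 82 7 8; cell 83 2 3; cell 83 4 5; cell 84 0 3;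
  cell 84 1 7; cell 84 2 7; cell 84 4 7; cell 84 6 3; cell 85 2 6; cell 85 4 6;
  cell 85 5 8; cell 85 7 8; cell 86 0 3; cell 86 1 6; cell 86 2 6; cell 86 4 6;
  cell 87 2 7; cell 87 4 7; cell 87 5 7; cell 87 6 8; cell 88 1 3; cell 88 2 1;
  cell 88 4 0; cell 88 6 0; cell 88 7 0; cell 89 0 1; cell 89 2 0; cell 89 4 1;
  cell 89 6 1; cell 89 7 1; cell 90 6 0; cell 91 3 0; cell 91 6 5; cell 92 0 7;
  cell 92 1 7; cell 92 3 7; cell 92 4 2; cell 92 5 2; cell 92 6 2; cell 93 3 5;
  cell 93 6 2; cell 93 7 8; cell 94 0 2; cell 94 1 2; cell 94 3 5; cell 95 0 4;
  cell 95 1 2; cell 95 3 0; cell 95 6 2; cell 96 1 2; cell 96 3 6; cell 96 5 8;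
  cell 96 7 8; cell 97 0 4; cell 97 1 0; cell 97 3 0; cell 98 1 2; cell 98 3 7;
  cell 98 5 4; cell 98 6 8; cell 99 6 0; cell 99 7 0; cell 100 2 0;
  cell 100 4 0; cell 101 0 8; cell 101 2 8; cell 101 3 8; cell 101 4 8;
  cell 101 5 8; cell 101 6 8; cell 101 7 8; cell 102 0 3; cell 102 1 3;
  cell 102 2 1; cell 102 5 1; cell 102 7 2; cell 103 1 8; cell 103 2 8;
  cell 103 3 8; cell 103 4 8; cell 103 5 8; cell 103 7 8; cell 104 2 0;
  cell 104 3 0; cell 104 4 0; cell 104 5 0; cell 104 6 0; cell 104 7 0;
  cell 105 2 1; cell 105 4 1; cell 105 5 1; cell 105 7 1; cell 106 3 5;
  cell 106 4 5; cell 107 1 2; cell 107 3 7; cell 107 4 7; cell 107 6 2;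
  cell 108 3 0; cell 108 4 0; cell 108 7 0; cell 109 3 5; cell 109 4 5;
  cell 110 1 2; cell 110 3 6; cell 110 4 6; cell 110 5 8; cell 111 3 0;
  cell 111 4 0; cell 111 6 0; cell 112 1 2; cell 112 3 5; cell 112 4 5;
  cell 112 7 5; cell 112 8 0; cell 113 0 4; cell 113 1 0; cell 113 2 6;
  cell 113 3 2; cell 113 7 2; cell 114 2 3; cell 114 5 0; cell 114 6 0;
  cell 115 0 4; cell 115 1 0; cell 115 5 8; cell 115 7 8; cell 117 0 4;
  cell 117 1 0; cell 117 5 2; cell 117 6 8; cell 118 0 2; cell 118 4 2;
  cell 118 5 2; cell 118 6 2; cell 119 0 2; cell 119 5 8; cell 119 7 8;
  cell 120 0 2; cell 120 3 6; cell 121 0 2; cell 121 3 7; cell 121 5 4;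
  cell 121 6 8; cell 122 2 5; cell 122 3 6; cell 122 4 5; cell 122 7 3;
  cell 123 0 6; cell 123 2 6; cell 123 4 6; cell 123 5 8; cell 124 0 3;
  cell 124 5 2; cell 125 1 2; cell 125 5 2; cell 125 6 8; cell 125 7 8;
  cell 126 0 4; cell 126 2 6; cell 126 3 6; cell 126 5 3; cell 126 7 3;
  cell 127 0 3; cell 127 2 7; cell 127 5 3; cell 127 6 8; cell 128 0 2;
  cell 128 1 2; cell 129 1 3; cell 129 2 6; cell 129 4 3; cell 129 5 3;
  cell 130 0 3; cell 130 1 3; cell 130 2 7; cell 130 4 3; cell 131 1 3;
  cell 131 4 3; cell 131 6 8; cell 131 7 8; cell 132 0 3; cell 132 1 3;
  cell 132 4 3; cell 132 7 0; cell 133 1 3; cell 133 2 0; cell 133 4 3;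
  cell 133 5 0; cell 133 6 0; cell 134 0 3; cell 134 1 6; cell 134 4 3;
  cell 134 5 8; cell 134 7 8; cell 135 1 3; cell 135 2 0; cell 135 4 3;
  cell 136 0 3; cell 136 1 3; cell 136 4 3; cell 136 5 7; cell 136 6 8;
  cell 137 1 0; cell 137 6 2; cell 137 7 2; cell 138 1 5; cell 138 3 0;
  cell 138 4 0; cell 139 1 7; cell 139 2 7; cell 139 3 7; cell 139 4 1;
  cell 139 5 1; cell 139 6 7; cell 140 1 6; cell 140 3 6; cell 140 4 1;
  cell 140 5 6; cell 140 7 8; cell 141 0 2; cell 141 1 2; cell 141 3 6;
  cell 141 4 1; cell 141 5 6; cell 142 1 5; cell 142 3 5; cell 142 4 1;
  cell 142 6 8; cell 143 2 5; cell 143 3 0; cell 143 4 0; cell 143 7 0;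
  cell 144 0 5; cell 144 1 5; cell 144 4 2; cell 144 6 2; cell 144 7 2;
  cell 145 1 5; cell 145 3 5; cell 145 4 1; cell 145 7 8; cell 146 0 7;
  cell 146 1 7; cell 146 2 0; cell 146 3 7; cell 146 4 7; cell 146 5 4;
  cell 146 6 7; cell 147 0 5; cell 147 1 5; cell 147 2 6; cell 147 3 5;
  cell 147 4 1; cell 147 7 0; cell 148 0 6; cell 148 1 6; cell 148 2 0;
  cell 148 3 6; cell 148 4 1; cell 148 5 8; cell 149 0 2; cell 149 1 6;
  cell 149 4 0; cell 149 5 2; cell 150 0 2; cell 150 1 5; cell 150 3 5;
  cell 150 4 0; cell 151 0 2; cell 151 4 0; cell 151 6 8; cell 151 7 8;
  cell 152 0 2; cell 152 1 5; cell 152 3 5; cell 152 4 0; cell 153 0 2;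
  cell 153 4 0; cell 153 6 1; cell 154 0 2; cell 154 1 6; cell 154 3 6;
  cell 154 4 0; cell 154 5 8; cell 154 7 8; cell 155 0 2; cell 155 4 0;
  cell 156 0 2; cell 156 1 7; cell 156 3 7; cell 156 4 0; cell 156 5 7;
  cell 156 6 8; cell 157 1 5; cell 157 2 0; cell 158 0 6; cell 158 5 2;
  cell 159 0 7; cell 159 1 5; cell 159 6 4; cell 160 6 8; cell 160 7 8;
  cell 161 1 5; cell 162 0 3; cell 162 6 2; cell 163 1 8; cell 163 5 8;
  cell 163 7 8; cell 164 0 3; cell 165 1 8; cell 165 5 7; cell 165 6 8;
  cell 166 1 4; cell 166 2 0; cell 166 6 0; cell 166 7 0; cell 167 3 0;
  cell 167 4 0; cell 167 5 0; cell 167 7 2; cell 168 2 6; cell 168 3 0;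
  cell 168 4 0; cell 168 5 3; cell 168 7 0; cell 169 1 3; cell 169 2 1;
  cell 169 4 0; cell 169 6 0; cell 170 0 3; cell 170 4 8; cell 170 5 3;
  cell 170 6 8; cell 170 7 8; cell 171 0 6; cell 171 1 6; cell 171 4 2;
  cell 172 0 1; cell 172 2 0; cell 172 3 0; cell 172 4 1; cell 173 1 8;
  cell 173 2 8; cell 173 4 2; cell 173 5 8; cell 173 6 8; cell 173 7 8;
  cell 174 0 1; cell 174 2 1; cell 174 4 1; cell 174 5 1; cell 174 6 1;
  cell 174 7 1; cell 175 2 3; cell 175 4 8; cell 175 5 3; cell 175 6 2;
  cell 175 7 3; cell 176 2 3; cell 176 4 5; cell 176 6 3; cell 177 4 0;
  cell 177 5 0; cell 177 6 0; cell 177 7 0; cell 178 2 1; cell 178 4 1;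
  cell 178 5 1; cell 178 7 1; cell 179 1 2; cell 179 4 0; cell 179 6 0;
  cell 180 0 1; cell 180 2 0; cell 180 4 1; cell 181 2 3; cell 181 4 5;
  cell 182 2 3; cell 182 4 7; cell 182 6 3; cell 183 1 3; cell 183 2 1;
  cell 183 4 0; cell 183 7 0; cell 184 0 1; cell 184 2 0; cell 184 4 1;
  cell 184 7 1; cell 185 2 3; cell 185 4 5; cell 186 2 6; cell 186 4 6;
  cell 186 5 8; cell 187 1 3; cell 187 2 1; cell 187 4 0; cell 187 6 0;
  cell 188 0 1; cell 188 2 0; cell 188 4 1; cell 188 6 1; cell 189 4 5;
  cell 189 7 5; cell 189 8 0; cell 190 2 5; cell 190 3 5; cell 190 4 2;
  cell 190 7 5; cell 190 8 1; cell 191 2 0; cell 191 3 0; cell 191 4 0;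
  cell 192 0 4; cell 192 1 8; cell 192 2 4; cell 192 5 3; cell 192 6 4;
  cell 192 7 8; cell 193 2 0; cell 193 3 0; cell 193 4 0; cell 194 0 8;
  cell 194 1 4; cell 194 2 4; cell 194 3 8; cell 194 5 4; cell 194 6 8;
  cell 194 7 8; cell 195 2 4; cell 195 3 5; cell 195 6 2; cell 195 7 2;
  cell 196 2 0; cell 196 3 0; cell 196 5 0; cell 196 6 0; cell 196 7 0;
  cell 197 2 1; cell 197 5 1; cell 197 7 1; cell 198 3 5; cell 199 1 2;
  cell 199 3 7; cell 199 6 2; cell 200 7 0; cell 201 1 2; cell 201 3 5;
  cell 202 1 2; cell 202 3 6; cell 202 5 8; cell 203 6 0; cell 204 1 2;
  cell 204 7 5; cell 204 8 0; cell 206 0 8; cell 206 1 8; cell 206 3 8;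
  cell 206 5 4; cell 206 7 2; cell 207 0 1; cell 207 2 1; cell 207 4 1;
  cell 207 5 0; cell 207 7 1; cell 208 0 2; cell 208 1 2; cell 208 3 0;
  cell 208 5 0; cell 208 7 0; cell 209 0 6; cell 209 1 6; cell 209 2 6;
  cell 209 3 2; cell 209 4 6; cell 209 5 3; cell 209 7 3; cell 210 1 8;
  cell 210 2 3; cell 210 4 8; cell 210 6 8; cell 210 7 3; cell 211 1 0;
  cell 211 2 0; cell 211 3 0; cell 211 4 0; cell 211 5 0; cell 211 7 0;
  cell 212 0 1; cell 212 2 1; cell 212 4 1; cell 212 7 1; cell 213 2 0;
  cell 213 4 0; cell 213 7 0; cell 214 0 3; cell 214 1 3; cell 214 2 3;
  cell 214 5 1; cell 214 7 3; cell 214 8 1; cell 215 1 2; cell 215 3 0;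
  cell 215 4 0; cell 215 5 0; cell 215 6 0; cell 216 0 2; cell 216 4 1;
  cell 216 5 1; cell 217 3 0; cell 217 4 0; cell 217 5 0; cell 217 6 0;
  cell 218 1 2; cell 218 3 5; cell 218 4 5; cell 218 6 2; cell 218 7 0;
  cell 218 8 0; cell 219 2 1; cell 219 3 0; cell 219 4 0; cell 220 3 5;
  cell 220 4 5; cell 221 3 0; cell 221 4 0; cell 222 1 2; cell 222 3 5;
  cell 222 4 5; cell 222 8 0; cell 223 0 5; cell 223 3 6; cell 223 4 6;
  cell 223 8 6; cell 224 5 3; cell 224 6 2; cell 224 7 2; cell 225 0 4;
  cell 225 1 0; cell 225 6 3; cell 226 0 4; cell 226 1 0; cell 227 0 4;
  cell 227 1 0; cell 227 5 8; cell 228 0 4; cell 228 2 4; cell 228 3 4;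
  cell 228 6 2; cell 228 7 2; cell 229 0 2; cell 229 3 4; cell 230 0 2;
  cell 230 3 6; cell 230 5 8; cell 231 1 5; cell 231 2 5; cell 231 4 5;
  cell 232 0 3; cell 233 1 2; cell 233 5 2; cell 233 6 8; cell 234 1 3;
  cell 234 4 0; cell 234 6 0; cell 234 7 0; cell 234 8 1; cell 235 0 3;
  cell 235 2 8; cell 235 4 7; cell 235 5 3; cell 235 6 2; cell 237 1 2;
  cell 237 4 6; cell 237 5 6; cell 238 1 0; cell 238 4 7; cell 239 1 8;
  cell 239 2 8; cell 239 3 8; cell 239 4 8; cell 239 5 8; cell 239 6 8;
  cell 239 7 8; cell 240 1 5; cell 240 2 0; cell 240 4 0; cell 240 7 3;
  cell 241 0 3; cell 241 1 3; cell 241 2 7; cell 241 4 3; cell 241 5 0;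
  cell 241 6 3; cell 242 1 3; cell 242 4 3; cell 242 5 3; cell 242 7 8;
  cell 243 0 3; cell 243 1 3; cell 243 2 3; cell 243 4 3; cell 243 5 3;
  cell 244 1 3; cell 244 4 3; cell 244 6 8; cell 245 4 0; cell 245 7 0;
  cell 246 1 2; cell 246 3 2; cell 246 5 2; cell 246 6 2; cell 246 7 2;
  cell 247 1 0; cell 247 4 1; cell 247 6 2; cell 248 1 3; cell 248 4 3;
  cell 248 7 3; cell 249 0 3; cell 249 1 3; cell 249 4 3; cell 249 5 7;
  cell 249 6 3; cell 250 1 0; cell 250 7 2; cell 251 0 3; cell 251 1 3;
  cell 251 4 3; cell 251 7 0; cell 252 0 3; cell 252 1 3; cell 252 4 3;
  cell 252 5 8; cell 253 1 0; cell 253 6 2; cell 254 0 3; cell 254 1 0;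
  cell 254 5 3; cell 254 6 1; cell 254 7 1; cell 254 8 0; cell 255 0 5;
  cell 255 1 5; cell 255 4 5; cell 255 6 4; cell 255 7 5; cell 255 8 2;
  cell 256 0 8; cell 256 2 8; cell 256 3 8; cell 256 4 8; cell 256 6 8;
  cell 256 7 8; cell 257 1 7; cell 257 3 7; cell 257 4 1; cell 257 5 1;
  cell 257 6 7; cell 258 3 0; cell 258 4 0; cell 258 5 0; cell 258 6 0;
  cell 258 7 0; cell 259 4 2; cell 259 5 6; cell 260 1 6; cell 260 2 8;
  cell 260 3 6; cell 260 4 1; cell 260 5 6; cell 261 2 5; cell 261 3 0;
  cell 261 4 0; cell 262 0 5; cell 262 1 5; cell 262 4 2; cell 262 6 2;
  cell 263 6 5; cell 263 7 1; cell 264 2 5; cell 264 3 6; cell 264 4 6;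
  cell 264 8 0; cell 265 1 3; cell 265 7 3; cell 265 8 2; cell 266 1 7;
  cell 266 2 1; cell 266 3 0; cell 266 4 0; cell 267 0 5; cell 267 1 0;
  cell 267 4 2; cell 267 6 2; cell 268 1 5; cell 268 3 5; cell 268 4 1;
  cell 268 7 1; cell 269 0 3; cell 269 1 3; cell 269 2 3; cell 270 0 2;
  cell 270 1 7; cell 270 3 7; cell 270 4 0; cell 270 6 2; cell 271 0 2;
  cell 271 4 0; cell 271 5 2; cell 271 7 8; cell 272 0 4; cell 272 1 6;
  cell 272 2 0; cell 272 5 2; cell 272 7 2; cell 273 0 2; cell 273 4 0;
  cell 273 6 8; cell 274 4 1; cell 274 7 1; cell 275 0 3; cell 275 2 3;
  cell 275 4 5; cell 275 6 4; cell 275 7 6; cell 276 0 2; cell 276 4 0;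
  cell 277 0 2; cell 277 1 7; cell 277 3 7; cell 277 4 0; cell 277 6 2;
  cell 278 0 2; cell 278 1 5; cell 278 3 5; cell 278 4 0; cell 279 0 2;
  cell 279 1 6; cell 279 3 6; cell 279 4 0; cell 279 5 8; cell 280 2 0;
  cell 280 5 3; cell 280 8 0; cell 281 1 4; cell 281 2 0; cell 281 6 0;
  cell 282 0 3; cell 282 5 3; cell 282 6 8; cell 282 7 8; cell 283 0 1;
  cell 283 3 1; cell 283 5 1; cell 284 0 7; cell 284 1 7; cell 284 2 6;
  cell 284 3 2; cell 284 4 2; cell 285 1 0; cell 285 5 2; cell 285 7 8;
  cell 286 6 4; cell 287 1 4; cell 287 2 1; cell 287 5 0; cell 287 6 0;
  cell 287 7 1; cell 288 0 1; cell 288 3 1; cell 288 5 1; cell 288 7 1;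
  cell 289 1 3; cell 289 2 0; cell 291 1 8; cell 291 6 2; cell 292 1 4;
  cell 292 2 0; cell 292 7 0; cell 293 1 5; cell 294 1 8; cell 294 5 8;
  cell 295 1 4; cell 295 2 0; cell 295 6 0; cell 296 6 1; cell 296 7 1;
  cell 297 1 0; cell 297 4 0; cell 297 5 0; cell 297 7 2; cell 298 0 8;
  cell 298 1 8; cell 298 2 8; cell 298 4 8; cell 298 5 4; cell 298 6 8;
  cell 298 7 8; cell 299 2 0; cell 299 3 0; cell 299 4 0; cell 299 5 0;
  cell 299 7 0; cell 300 0 3; cell 300 1 0; cell 300 4 0; cell 300 6 3;
  cell 300 7 3; cell 301 0 3; cell 301 1 0; cell 301 4 7; cell 301 5 3;
  cell 301 6 0; cell 302 2 0; cell 302 4 0; cell 302 5 0; cell 302 6 0;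
  cell 302 7 0; cell 303 0 2; cell 303 7 2; cell 304 0 3; cell 304 1 3;
  cell 304 2 1; cell 305 0 2; cell 305 1 7; cell 305 3 7; cell 305 4 2;
  cell 305 6 0; cell 306 0 5; cell 306 3 0; cell 306 4 2; cell 306 7 8;
  cell 307 0 1; cell 307 2 0; cell 307 3 0; cell 307 7 0; cell 308 1 7;
  cell 308 2 7; cell 308 4 7; cell 308 5 7; cell 308 6 8; cell 309 1 0;
  cell 309 2 0; cell 309 6 0; cell 309 7 0; cell 310 2 1; cell 310 5 3;
  cell 310 6 3; cell 310 7 3; cell 311 1 8; cell 311 2 8; cell 311 3 8;
  cell 311 4 8; cell 311 5 8; cell 311 6 8; cell 311 7 8; cell 312 3 0;
  cell 312 4 0; cell 313 0 1; cell 313 2 1; cell 313 3 1; cell 313 4 1;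
  cell 313 5 1; cell 313 6 1; cell 313 7 0; cell 314 2 1; cell 314 4 1;
  cell 314 5 0; cell 315 0 1; cell 315 2 1; cell 315 3 1; cell 315 4 1;
  cell 315 5 1; cell 316 1 2; cell 316 4 0; cell 316 5 0; cell 316 7 1;
  cell 317 2 1; cell 317 4 0; cell 317 5 0; cell 317 6 1; cell 317 7 0;
  cell 318 0 6; cell 318 2 6; cell 318 4 6; cell 318 5 4; cell 318 8 1;
  cell 319 0 3; cell 319 1 8; cell 319 2 7; cell 319 4 8; cell 319 5 3;
  cell 319 6 3; cell 320 1 6; cell 320 2 7; cell 320 3 7; cell 320 4 8;
  cell 320 5 8; cell 321 1 8; cell 321 2 1; cell 321 4 2; cell 321 5 0;
  cell 321 6 2; cell 322 0 1; cell 322 2 1; cell 322 3 1; cell 322 4 1;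
  cell 322 5 1; cell 323 1 3; cell 323 2 1; cell 323 4 0; cell 323 5 0;
  cell 323 6 0; cell 324 0 1; cell 324 2 0; cell 324 4 1; cell 324 5 1;
  cell 324 6 1; cell 325 1 0; cell 325 4 1; cell 325 6 1; cell 325 7 0;
  cell 325 8 0; cell 326 2 5; cell 326 3 5; cell 326 4 2; cell 326 6 1;
  cell 326 7 1; cell 326 8 1; cell 327 1 3; cell 327 2 1; cell 327 4 0;
  cell 328 0 1; cell 328 2 0; cell 328 4 1; cell 328 7 1; cell 329 0 6;
  cell 329 1 0; cell 329 2 3; cell 329 4 5; cell 330 1 3; cell 330 2 1;
  cell 330 4 0; cell 331 0 1; cell 331 2 0; cell 331 4 1; cell 332 1 0;
  cell 332 6 0; cell 332 8 0; cell 333 2 4; cell 333 3 4; cell 333 6 4;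
  cell 333 8 1; cell 334 1 2; cell 334 6 4; cell 334 7 4; cell 334 8 4;
  cell 335 0 5; cell 335 2 0; cell 335 7 2; cell 335 8 3; cell 336 2 0;
  cell 336 3 0; cell 336 4 1; cell 336 6 3; cell 336 7 0; cell 336 8 3;
  cell 337 0 4; cell 337 2 4; cell 337 3 0; cell 337 7 3; cell 337 8 3;
  cell 338 0 4; cell 338 1 4; cell 338 2 4; cell 338 3 4; cell 338 5 3;
  cell 338 7 2; cell 339 0 4; cell 339 1 4; cell 339 2 4; cell 339 3 0;
  cell 339 5 4; cell 339 7 2; cell 340 2 0; cell 340 3 0; cell 340 4 0;
  cell 340 5 0; cell 340 6 0; cell 341 2 1; cell 341 3 1; cell 341 4 1;
  cell 341 5 1; cell 341 6 1; cell 342 0 1; cell 342 7 3; cell 343 6 1;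
  cell 343 7 3; cell 344 2 3; cell 344 4 1; cell 344 6 0; cell 344 7 0;
  cell 344 8 1; cell 345 0 1; cell 345 2 1; cell 345 3 0; cell 345 5 4;
  cell 345 7 1; cell 345 8 1; cell 346 1 4; cell 346 2 0; cell 346 3 0;
  cell 346 5 0; cell 346 6 0; cell 347 0 4; cell 347 2 1; cell 347 5 1;
  cell 348 5 0; cell 348 6 0; cell 349 1 2; cell 349 6 2; cell 349 7 0;
  cell 349 8 0; cell 351 1 6; cell 351 3 5; cell 354 0 3; cell 354 1 0;
  cell 354 7 1; cell 354 8 3; cell 355 1 0; cell 355 2 0; cell 355 3 0;
  cell 355 4 0; cell 356 0 3; cell 356 6 8; cell 357 0 3; cell 357 1 3;
  cell 357 2 0; cell 357 5 3; cell 357 6 1; cell 357 7 0; cell 357 8 0;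
  cell 358 2 4; cell 358 5 0; cell 358 7 0; cell 359 0 3; cell 359 7 3;
  cell 360 6 8; cell 361 2 0; cell 361 4 0; cell 361 6 0; cell 361 7 0;
  cell 362 0 5; cell 362 1 2; cell 362 4 1; cell 362 6 1; cell 362 7 1;
  cell 363 1 0; cell 363 4 0; cell 363 5 1; cell 363 6 0; cell 364 5 0;
  cell 364 6 1; cell 364 7 0; cell 364 8 1; cell 365 2 4; cell 365 7 1;
  cell 365 8 0; cell 366 0 4; cell 366 1 4; cell 366 2 0; cell 366 3 2;
  cell 366 7 2; cell 366 8 0; cell 367 0 1; cell 367 5 1; cell 367 8 1;
  cell 368 0 6; cell 368 1 8; cell 368 2 7; cell 368 3 8; cell 368 4 8;
  cell 368 5 8; cell 369 1 6; cell 369 2 0; cell 369 3 0; cell 369 4 0;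
  cell 369 5 0; cell 370 0 1; cell 370 2 1; cell 370 3 6; cell 370 4 1;
  cell 370 5 1; cell 370 7 1; cell 371 1 2; cell 371 3 5; cell 371 4 5;
  cell 371 6 0; cell 371 7 0; cell 371 8 0; cell 372 1 0; cell 372 3 0;
  cell 372 4 6; cell 372 7 2; cell 372 8 0; cell 373 3 0; cell 373 7 0;
  cell 373 8 1; cell 374 0 2; cell 374 1 2; cell 374 3 0; cell 374 4 1;
  cell 374 5 6; cell 374 8 2; cell 375 2 0; cell 375 3 0; cell 375 4 0;
  cell 376 0 1; cell 376 2 1; cell 376 3 1; cell 376 4 0; cell 378 1 5;
  cell 378 3 4; cell 379 1 3; cell 379 4 0; cell 379 7 0; cell 379 8 1;
  cell 380 1 5; cell 380 2 5; cell 380 3 2; cell 380 4 2; cell 381 1 2;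
  cell 381 5 8; cell 382 1 2; cell 382 4 0; cell 382 6 0; cell 382 8 0;
  cell 383 0 4; cell 383 2 0; cell 383 3 0; cell 383 6 3; cell 383 7 5;
  cell 384 0 6; cell 384 5 1; cell 385 6 1; cell 386 2 3; cell 386 6 3;
  cell 386 7 8; cell 387 1 5; cell 387 3 0; cell 387 4 0; cell 387 6 0;
  cell 387 7 2; cell 388 0 2; cell 388 1 2; cell 388 4 7; cell 388 6 1;
  cell 389 1 6; cell 389 2 3; cell 389 4 3; cell 389 7 3; cell 390 4 1;
  cell 390 5 3; cell 391 0 8; cell 391 1 7; cell 391 2 7; cell 391 4 7;
  cell 391 6 3; cell 392 1 5; cell 392 2 1; cell 392 3 0; cell 392 4 1;
  cell 392 6 1; cell 392 7 0; cell 393 0 3; cell 393 1 5; cell 393 2 1;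
  cell 393 4 3; cell 393 7 1; cell 394 1 3; cell 394 2 3; cell 394 4 2;
  cell 394 5 3; cell 394 6 3; cell 395 1 8; cell 395 2 1; cell 395 4 0;
  cell 395 5 0; cell 395 6 0; cell 395 7 2; cell 396 0 1; cell 396 3 0;
  cell 396 4 0; cell 396 5 0; cell 396 7 0; cell 396 8 0; cell 397 1 3;
  cell 397 2 7; cell 397 4 2; cell 397 5 3; cell 398 1 5; cell 398 2 7;
  cell 398 4 0; cell 398 6 1; cell 399 1 2; cell 399 3 2; cell 399 4 3;
  cell 399 5 2; cell 399 6 2; cell 400 2 1; cell 400 3 0; cell 400 6 0;
  cell 400 7 1; cell 401 1 3; cell 401 2 0; cell 401 4 1; cell 402 0 7;
  cell 402 1 7; cell 402 3 2; cell 402 4 1; cell 402 5 8; cell 402 6 2;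
  cell 403 1 6; cell 403 4 0; cell 404 1 0; cell 404 5 2; cell 404 6 0;
  cell 405 0 3; cell 405 1 0; cell 405 7 5; cell 405 8 0; cell 406 0 2;
  cell 406 1 5; cell 406 3 2; cell 406 7 2; cell 406 8 2; cell 407 1 0;
  cell 407 6 0; cell 407 7 0; cell 408 1 3; cell 408 4 3; cell 408 7 3;
  cell 409 1 0; cell 409 5 6; cell 410 0 3; cell 410 1 0; cell 410 6 5;
  cell 410 8 0; cell 411 0 4; cell 411 1 5; cell 412 0 1; cell 412 2 1;
  cell 412 3 1; cell 412 4 0; cell 412 6 1; cell 413 1 8; cell 413 2 0;
  cell 413 3 2; cell 413 4 0; cell 413 6 2; cell 414 2 8; cell 414 3 1;
  cell 414 5 0; cell 414 6 1; cell 414 7 1; cell 415 1 2; cell 415 3 0;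
  cell 415 4 0; cell 415 7 0; cell 416 0 1; cell 416 3 0; cell 416 5 1;
  cell 416 7 1; cell 417 1 0; cell 417 3 2; cell 417 4 0; cell 417 5 0;
  cell 417 6 0; cell 417 7 0; cell 418 3 8; cell 419 1 2; cell 419 3 1;
  cell 419 4 2; cell 419 7 2; cell 420 1 0; cell 420 5 0; cell 420 8 0;
  cell 421 2 3; cell 421 7 3; cell 422 2 0; cell 422 4 0; cell 422 7 2;
  cell 422 8 0; cell 423 0 2; cell 423 1 2; cell 423 3 2; cell 423 4 1;
  cell 424 0 3; cell 424 1 0; cell 424 2 0; cell 424 5 0; cell 424 6 0;
  cell 424 8 0; cell 425 2 5; cell 425 3 0; cell 425 4 0; cell 425 7 0;
  cell 426 0 2; cell 426 1 5; cell 426 3 0; cell 426 4 2; cell 426 6 0;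
  cell 427 1 5; cell 427 6 0; cell 427 7 0; cell 427 8 3; cell 428 0 2;
  cell 428 1 2; cell 428 4 0; cell 428 6 7; cell 429 0 8; cell 429 1 5;
  cell 429 2 6; cell 429 3 1; cell 429 4 6; cell 429 7 6; cell 430 0 2;
  cell 430 4 0; cell 430 6 2; cell 431 0 3; cell 431 1 0; cell 431 2 0;
  cell 431 4 0; cell 431 5 3; cell 431 6 0; cell 431 8 0; cell 432 0 1;
  cell 432 4 2; cell 432 6 0; cell 432 7 3; cell 433 0 2; cell 433 1 7;
  cell 433 3 1; cell 433 4 0; cell 433 5 2; cell 433 6 0; cell 434 0 4;
  cell 434 6 0; cell 435 0 3; cell 435 1 0; cell 435 2 1; cell 435 5 0;
  cell 435 6 0; cell 435 7 1; cell 437 0 3; cell 437 1 3; cell 437 2 1;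
  cell 437 4 5; cell 438 0 2; cell 438 1 6; cell 438 3 2; cell 438 4 0;
  cell 439 2 0; cell 439 3 0; cell 440 1 7; cell 440 2 0; cell 440 3 0;
  cell 440 4 0; cell 440 5 0; cell 440 8 0; cell 441 2 0; cell 441 5 0;
  cell 441 6 0; cell 442 0 1; cell 442 3 1; cell 442 4 1; cell 442 5 1;
  cell 442 6 1; cell 442 8 2; cell 443 5 0; cell 443 6 0; cell 443 7 2;
  cell 444 1 0; cell 444 5 0; cell 444 6 0; cell 444 7 0; cell 446 7 0;
  cell 446 8 0; cell 447 5 3; cell 448 0 1; cell 448 3 1; cell 448 5 0;
  cell 449 1 7; cell 449 2 4; cell 449 5 0; cell 449 6 0; cell 450 7 0;
  cell 451 1 4; cell 451 2 0; cell 452 0 4; cell 452 1 0; cell 453 1 6;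
  cell 453 2 4; cell 453 5 1; cell 454 1 0; cell 454 4 1; cell 454 5 0;
  cell 454 7 2; cell 454 8 0; cell 455 2 1; cell 455 3 0; cell 455 4 0;
  cell 455 5 0; cell 455 7 1; cell 456 0 1; cell 456 2 1; cell 456 4 1;
  cell 456 6 1; cell 456 7 1; cell 457 6 0; cell 458 5 0; cell 458 6 0;
  cell 459 0 1; cell 459 6 0; cell 460 0 2; cell 460 1 3; cell 460 4 2;
  cell 460 6 2; cell 461 0 1; cell 461 4 0; cell 461 7 0; cell 462 0 2;
  cell 462 1 8; cell 462 4 2; cell 462 5 0; cell 462 6 1; cell 463 2 1;
  cell 463 4 0; cell 463 5 0; cell 463 6 0; cell 464 0 3; cell 464 5 1;
  cell 464 6 1; cell 465 3 0; cell 465 4 0; cell 465 5 0; cell 465 7 0;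
  cell 466 1 0; cell 466 2 0; cell 466 7 0; cell 466 8 0; cell 467 2 0;
  cell 467 3 0; cell 467 8 0; cell 469 8 0; cell 470 1 0; cell 470 4 1;
  cell 470 5 2; cell 471 0 1; cell 471 2 0; cell 471 4 0; cell 471 5 3;
  cell 472 1 0; cell 472 8 0; cell 473 2 0; cell 473 3 0; cell 473 7 0;
  cell 473 8 1; cell 474 8 0; cell 475 0 4; cell 475 1 4; cell 475 5 2;
  cell 476 1 4; cell 476 2 0; cell 476 3 0; cell 476 5 0; cell 476 6 0;
  cell 477 1 2; cell 477 6 1; cell 477 7 0; cell 477 8 0; cell 478 0 1;
  cell 479 0 2; cell 479 1 3; cell 479 4 1; cell 479 5 3; cell 479 6 1;
  cell 480 2 1; cell 480 8 0; cell 481 1 0; cell 481 2 1; cell 481 3 0;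
  cell 481 4 0; cell 481 7 1; cell 482 2 0; cell 482 6 0; cell 482 7 0;
  cell 484 0 1; cell 484 2 0; cell 484 3 0; cell 484 5 0; cell 484 6 0;
  cell 484 7 0; cell 485 2 0; cell 485 3 0; cell 486 2 1; cell 487 1 4;
  cell 487 2 0; cell 487 3 0; cell 487 7 0; cell 487 8 0; cell 488 0 1;
  cell 488 4 0; cell 488 5 0; cell 488 6 0; cell 489 1 3; cell 489 2 0;
  cell 489 4 0; cell 489 6 0; cell 489 7 0; cell 490 0 4; cell 490 1 3;
  cell 490 5 2; cell 490 6 2; cell 490 7 2; cell 491 1 2; cell 491 4 0;
  cell 491 5 3; cell 491 8 0; cell 492 0 1; cell 492 3 0; cell 492 8 0;
  cell 493 0 4; cell 493 5 1; cell 493 8 0; cell 494 2 0; cell 495 1 0;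
  cell 495 8 0; cell 497 0 1; cell 497 3 0; cell 497 5 0; cell 497 6 0;
  cell 497 7 0; cell 497 8 0; cell 498 0 3; cell 498 1 0; cell 498 5 0;
  cell 498 7 0; cell 498 8 1; cell 500 2 0; cell 500 6 0; cell 500 8 0;
  cell 501 2 0; cell 501 3 0; cell 501 4 0; cell 501 5 0; cell 501 6 0;
  cell 502 0 6; cell 502 1 0; cell 502 2 0; cell 502 3 0; cell 502 4 0;
  cell 502 5 0; cell 503 0 8; cell 503 3 2; cell 503 4 1; cell 503 5 1;
  cell 504 2 1; cell 504 3 0; cell 504 4 0; cell 504 5 0; cell 504 6 0;
  cell 505 1 2; cell 505 3 0; cell 505 4 0; cell 505 5 0; cell 505 6 0;
  cell 505 7 0; cell 506 0 5; cell 506 1 0; cell 506 2 0; cell 506 3 0;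
  cell 506 4 0; cell 506 7 0; cell 506 8 0; cell 1 6 2; cell 1 7 2; cell 4 6 2;
  cell 5 6 2; cell 5 7 2; cell 15 3 2; cell 15 5 2; cell 15 7 2; cell 18 6 2;
  cell 20 6 2; cell 37 6 1; cell 48 3 2; cell 51 3 2; cell 51 5 2; cell 51 7 2;
  cell 54 0 3; cell 56 6 2; cell 100 6 0; cell 103 6 2; cell 105 6 1;
  cell 118 3 2; cell 119 3 2; cell 122 0 2; cell 206 6 2; cell 207 6 1;
  cell 211 6 0; cell 212 6 1; cell 213 6 0; cell 246 0 1; cell 246 4 0;
  cell 274 6 0; cell 300 5 1; cell 303 6 0; cell 304 7 0; cell 312 2 0;
  cell 360 2 0; cell 360 7 0].

Definition T442_lists : arrow_lists :=
  [:: [:: 0; 0; 1; 0; 0; 1; 0; 0; 1];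
      [:: 2; 0; 0; 0; 0; 0; 0; 0; 0];
      [:: 0; 1; 0; 0; 0; 0; 0; 0; 0];
      [:: 0; 0; 1; 0; 1; 0; 0; 0; 0];
      [:: 0; 0; 0; 0; 0; 0; 0; 0; 0];
      [:: 0; 1; 0; 0; 0; 0; 0; 0; 0];
      [:: 0; 0; 0; 0; 0; 1; 0; 1; 0];
      [:: 0; 0; 0; 0; 0; 0; 0; 0; 0];
      [:: 0; 1; 0; 0; 0; 0; 0; 0; 0]].

Lemma T442_listsE : T442_lists = lists_of (n' := 8) T442.
Proof.
rewrite (@eq_lists_of 8 T442_arrows T442_lists) //.
by apply: forall_ord9; apply: forall_ord9.
Qed.

Definition T442_nodes := build_nodes 8 T442_lists T442_tree.

Definition T442_table := foldl (add_cell 8 T442_nodes)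
  (generator_table 8 (tree_table 8 T442_nodes T442_tree) T442_generators)
  T442_cells.

(** Each cell compares an edge of the table with the other sides of a square or pentagon. The nine
    holonomies, listed in [T442_words], imply all of [modular_relations]. *)
Definition T442_relators : seq (positive * nat * nat) :=
  [:: cell 1 3 7; cell 170 1 5; cell 1 1 8; cell 18 1 2; cell 5 6 0;
      cell 17 0 4; cell 428 0 5; cell 255 0 3; cell 293 8 0].

Definition arm_swap : seq nat := [:: 0; 1; 5; 6; 7; 2; 3; 4; 8].

Lemma T442_complete : complete 8 T442_nodes T442_table.
Proof. by vm_compute. Qed.

Lemma T442_generators_ok : all (generator_ok 8 T442_nodes) T442_generators.
Proof. by vm_compute. Qed.

Lemma T442_cells_ok : all (fun c : positive * nat * nat =>
  if PM.find c.1.1 T442_nodes is Some _ then true else false) T442_cells.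
Proof. by vm_compute. Qed.

Lemma T442_root_degrees : all (fun jx : positive * node => Pos.eqb jx.1 1%positive ||
    ~~ perm_eq (degrees 8 jx.2.2) (degrees 8 T442_lists)) (PM.elements T442_nodes).
Proof. by vm_compute. Qed.

Lemma T442_root : PM.find 1%positive T442_nodes = Some ([::], T442_lists).
Proof. by vm_compute. Qed.

Definition T442_words : seq word := ([::
    [:: (1, false); (1, false)];
    [:: (4, false); (4, false)];
    [:: (2, false); (2, false); (0, false)];
    [:: (3, false); (3, false); (3, false); (3, false); (0, false)];
    [:: (2, false); (1, false); (2, true); (1, true)];
    [:: (3, true); (1, true); (2, true); (1, false); (3, false); (2, false)];
    [:: (1, true); (3, false); (1, false); (3, false);
        (1, false); (3, true); (1, false); (3, true)];
    [:: (4, false); (1, false); (4, false); (3, true);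
        (3, true); (1, true); (2, false); (1, false)];
    [:: (4, false); (3, true); (1, false); (4, false); (3, true); (1, false);
        (4, false); (3, true); (1, false)]])%N.

Lemma T442_relators_ok :
  map (relation 8 T442_nodes T442_table) T442_relators = map some T442_words.
Proof. by vm_compute. Qed.
(** The exchange of the two long arms, a symmetry of the initial quiver with empty mutation path, is
    the inverse of the generator a. *)
Lemma T442_symmetry_ok :
  root_symmetry 8 T442_nodes T442_table (cell 1 0 3) = Some ([:: (1, true)], arm_swap).
Proof. by vm_compute. Qed.

Lemma T442_automorphisms :
  partial_automorphisms 8 T442_lists 9 = [:: identity_list 8; arm_swap].
Proof. by vm_compute. Qed.

Lemma T442_nodes_valid : nodes_valid T442 T442_nodes.
Proof. exact: (@build_nodes_valid 8 T442 T442_lists T442_tree T442_listsE). Qed.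

Lemma word_relation (G : groupType) (rho : nat -> G) w :
  word_at rho w = foldr (fun l x => letter_val (rho l.1, l.2) * x)%g 1%g w.
Proof.
by elim: w => [|l w IH]; rewrite ?word_at_nil // word_at_cons IH.
Qed.

Lemma neq_None (U : Type) (o : option U) : o <> None -> exists x, o = Some x.
Proof. by case: o => [x|//]; exists x. Qed.

Lemma map_some_in (U : Type) (T : eqType) (h : U -> option T) r s x :
  map h r = map some s -> x \in s -> exists y, h y = Some x.
Proof.
elim: r s => [|y r IH] [|x' s] //= [e1 e2]; rewrite inE => /orP[/eqP->|]; first by exists y.
exact: IH.
Qed.

(** The holonomies come as computed, some with conjugations by a; these disappear because a is an
    involution commuting with c. *)
Lemma modular_relations_intro (G : groupType) (r : nat -> G) :
  (forall w, w \in T442_words ->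
     foldr (fun l x => letter_val (r l.1, l.2) * x) 1 w = 1)%g ->
  modular_relations (r 0) (r 1) (r 2) (r 3) (r 4).
Proof.
move=> h.
have rel i : i < 9 -> foldr (fun l x => letter_val (r l.1, l.2) * x)%g 1%g
    (nth [::] T442_words i) = 1%g.
  by move=> lt_i; apply: h; apply: mem_nth.
have aa := rel 0 isT; have ee := rel 1 isT; have ccg := rel 2 isT.
have ttttg := rel 3 isT; have ca := rel 4 isT; have tact := rel 5 isT.
have tata := rel 6 isT; have eaet := rel 7 isT; have cubic := rel 8 isT.
rewrite /= /letter_val /= !mulg1 in aa ee ccg ttttg ca tact tata eaet cubic.
move: {rel h} (r 0) (r 1) (r 2) (r 3) (r 4) aa ee ccg ttttg ca tact tata eaet cubic.
move=> g a c t e aa ee ccg ttttg ca tact tata eaet cubic.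
have inv2 (x y : G) : (x * y = 1 -> x = y^-1)%g.
  by move=> e1; apply: (mulIg y); rewrite e1 mulVg.
have aV : (a^-1 = a)%g := esym (inv2 _ _ aa).
have ac : (a * c = c * a)%g.
  by apply/esym/divg1_eq; rewrite invgM -!mulgA.
have aca x : (a^-1 * (c * (a * x)) = c * x)%g.
  by rewrite [(c * (a * x))%g]mulgA -ac -mulgA mulKg.
have acVa x : (a^-1 * (c^-1 * (a * x)) = c^-1 * x)%g.
  by apply: (mulgI c); rewrite mulVKg -[LHS]aca !mulVKg mulKg.
split=> //.
- by rewrite -mulgA.
- rewrite (inv2 (c * c)%g g); last by rewrite -mulgA.
  by rewrite (inv2 (t * t * t * t)%g g) // -!mulgA.
- apply: invg_inj; apply: (inv2 (c * t)^-1%g (t * c)%g).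
  by rewrite invgM -!mulgA -[RHS]tact acVa.
- by apply/esym/divg1_eq; rewrite !invgM aV -!mulgA -[RHS]tata aV.
- rewrite (inv2 (e * a * e)%g (t^-1 * (t^-1 * c))%g) ?invgM ?invgK ?mulgA //.
  by rewrite -!mulgA -[RHS]eaet -[(c * a)%g]mulg1 -!mulgA aca mulg1.
- by rewrite -!mulgA.
Qed.

(** The relations solve for c = t^2 (e a e)^-1 and g = c^-2. *)
Lemma modular_relations_subgroup (G : groupType) (g a c t e : G) (H : G -> Prop) :
  modular_relations g a c t e -> is_subgroup H -> H a -> H t -> H e -> H c /\ H g.
Proof.
move=> R SH Ha Ht He.
have HV := @subgroupV _ _ SH; have HM := @subgroupM _ _ SH.
have cE : c = (t * t * (e * a * e)^-1)%g.
  have cz : (c * (e * a * e) = t * t)%g by rewrite (rel_eae R) -!mulgA mulVKg.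
  by rewrite -cz mulgK.
have gE : g = ((c * c)^-1)%g.
  by apply: (mulgI (c * c)%g); rewrite (rel_ccg R) mulgV.
have Hc : H c.
  by rewrite cE; exact: (HM _ _ (HM _ _ Ht Ht) (HV _ (HM _ _ (HM _ _ He Ha) He))).
by split=> //; rewrite gE; exact: (HV _ (HM _ _ Hc Hc)).
Qed.

Section Generators.
Local Open Scope group_scope.
Variable rho : nat -> cluster_modular_group T442.
Hypothesis rho_valid : forall l c0, l < size T442_generators ->
  generator_valid T442_nodes (rho l) (nth c0 T442_generators l).
Hypothesis rho_default : forall l, 5 <= l -> rho l = 1.

Let root_path : ref_path 8 T442_nodes 1%positive = [::].
Proof. by rewrite /ref_path T442_root. Qed.

Lemma T442_table_valid : edges_valid rho T442_nodes T442_table.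
Proof.
rewrite /T442_table; apply: (add_cells_valid T442_nodes_valid T442_cells_ok).
apply: generator_table_valid; last exact: rho_valid.
exact: tree_table_valid.
Qed.

Opaque T442_nodes T442_table.

Let ref_root x : @ref_seed 8 T442 T442_nodes x 1%positive = class_seed x.
Proof. by rewrite /ref_seed root_path. Qed.

Lemma generator_gamma : rho 0%N = gamma.
Proof.
have [//|_ [s es]] := rho_valid (l := 0%N) (cell 1 0 1%positive, [::]).
rewrite !ref_root class_seed1 => eS; apply: class_seed_inj.
have -> : class_seed gamma = relabel (tperm N_1 N_oo)
    (mutate (initial_seed T442) N_oo).
  by rewrite class_seedE -relabel_pair.
have -> : N_oo = inord 1 by apply: val_inj; rewrite /= inordK.
have s_swap : s = tperm N_1 (inord 1).
  by apply: (@perm_list_inj 8); rewrite es perm_list_swap inordK.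
by rewrite eS s_swap relabelM tperm2 relabel1.
Qed.

Lemma generator_relations :
  modular_relations gamma (rho 1%N) (rho 2) (rho 3) (rho 4).
Proof.
rewrite -generator_gamma; apply: modular_relations_intro => w inW.
have [cl] := map_some_in T442_relators_ok inW.
by move=> /(relationP T442_nodes_valid T442_table_valid); rewrite word_relation.
Qed.

(** The path of a representative ends at some position. Its quiver is isomorphic to the initial one,
    so the degrees identify its number as 1. The remaining permutation is an automorphism of the
    quiver: the identity, or the arm swap realised by a^-1. *)
Lemma T442_word_classes x :
  exists w, x = word_at rho w \/ x = word_at rho w * (rho 1%N)^-1.
Proof.
have n1 : PM.find 1%positive T442_nodes <> None by rewrite T442_root.
have [w [j [p [[s sp eS] jn]]]] := complete_reach T442_table_valid
  (pair_path (repr x)) T442_complete n1 root_path.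
pose r := pair_perm (repr x) * s.
have xE : class_seed x = relabel r (ref_seed T442_nodes (word_at rho w) j).
  rewrite -{1}[x]modular_classK class_seedE -relabel_pair eS relabelM.
  by [].
have : j = 1%positive.
  have [[P q] e] := neq_None jn.
  have : Pos.eqb j 1%positive || ~~ perm_eq (degrees 8 q) (degrees 8 T442_lists) :=
    all_In (PM.elements_correct _ _ e) T442_root_degrees.
  case/orP=> [/Pos.eqb_eq|/negP[]]; first exact.
  have arr : seed_arrows (ref_seed T442_nodes (word_at rho w) j) =
      foldl (@mutate_arrows 9) T442 (map inord P).
    by rewrite /ref_seed seed_arrows_path /ref_path e.
  have aE : lists_of (n' := 8) (fun a b => foldl (@mutate_arrows 9) T442
      (map inord P) (r a) (r b)) = T442_lists.
    rewrite T442_listsE -arr; congr lists_of.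
    exact: esym (congr1 (@seed_arrows _ _) xE).
  rewrite -aE (T442_nodes_valid e) perm_sym.
  exact: (@degrees_relabel 8 (foldl (@mutate_arrows 9) T442 (map inord P)) r).
move=> ej; move: xE; rewrite {}ej ref_root => xE; exists w.
have aut : perm_list r \in partial_automorphisms 8 T442_lists 9.
  rewrite T442_listsE; apply: (automorphism_in (n' := 8)) => u v.
  by have := congr1 (fun S => seed_arrows S u v) xE; rewrite /relabel /= => <-.
move: aut; rewrite T442_automorphisms !inE => /orP[] /eqP er.
  left; apply: class_seed_inj; rewrite xE.
  suff -> : r = 1%g by rewrite relabel1.
  by apply: (@perm_list_inj 8); rewrite perm_list1.
right; apply: class_seed_inj; rewrite xE.
have := T442_symmetry_ok; rewrite -er.
move=> /(root_symmetryP T442_nodes_valid T442_table_valid (word_at rho w) root_path) ->.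
by rewrite word_at_cons word_at_nil mulg1.
Qed.

Lemma generators_generate (H : cluster_modular_group T442 -> Prop) :
  is_subgroup H -> H (rho 1%N) -> H (rho 3) -> H (rho 4) -> forall x, H x.
Proof.
move=> SH Ha Ht He.
have HV := @subgroupV _ _ SH; have HM := @subgroupM _ _ SH.
have [Hc Hg] := modular_relations_subgroup generator_relations SH Ha Ht He.
have Hr l : H (rho l).
  move: l => [|[|[|[|[|l]]]]].
  - by rewrite generator_gamma; exact: Hg.
  - exact: Ha.
  - exact: Hc.
  - exact: Ht.
  - exact: He.
  - by rewrite rho_default; [exact: SH.1|].
have Hw w : H (word_at rho w).
  elim: w => [|[l b] w IH]; first by rewrite word_at_nil; case: SH.
  rewrite word_at_cons; apply: (HM _ _ _ IH).
  by case: b; rewrite /letter_at /letter_val /=; [apply: HV|].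
move=> x; have [w [->|->]] := T442_word_classes x; first exact: Hw.
exact: (HM _ _ (Hw w) (HV _ Ha)).
Qed.

End Generators.

Lemma T442_presentation : exists rho : nat -> cluster_modular_group T442,
  [/\ modular_relations gamma (rho 1%N) (rho 2) (rho 3) (rho 4),
      forall H, is_subgroup H -> H (rho 1%N) -> H (rho 3) -> H (rho 4) ->
        forall x, H x
    & forall l c0, l < size T442_generators ->
        generator_valid T442_nodes (rho l) (nth c0 T442_generators l)].
Proof.
have [s sz sv] := generators_exist T442_nodes_valid T442_generators_ok.
pose rho := nth 1%g s.
have rho_default l : 5 <= l -> rho l = 1%g.
  by move=> le_l; rewrite /rho nth_default // sz.
exists rho; split; last exact: sv.
  exact: (generator_relations sv).
exact: (generators_generate sv rho_default).
Qed.

(** * Tropical points *)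

Section Tropical.
Variable n : nat.
Local Open Scope ring_scope.
Local Notation field := (ambient_field n).
Local Notation "x %:F" := (FracField.tofrac x).
Implicit Types (y : 'I_n -> nat) (f : field) (m : 'I_n -> int).

Definition monomial_path y : {mpoly rat[n]} -> {poly rat} :=
  mmap (@polyC rat) (fun i => 'X^(y i)).

Lemma monomial_pathD y a b : monomial_path y (a + b) = monomial_path y a + monomial_path y b.
Proof. exact: mmapD. Qed.

Lemma monomial_pathM y a b : monomial_path y (a * b) = monomial_path y a * monomial_path y b.
Proof. by rewrite /monomial_path rmorphM. Qed.

(** Positive leading coefficients exclude cancellation, so that the degree of a sum is the maximum
    of the degrees. *)
Definition leading y (a : {mpoly rat[n]}) := 0 < lead_coef (monomial_path y a).

(** One more than the degree, whence the -1 in [orderM]; the shift cancels in the quotient used by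
    [tropical]. *)
Definition order y (a : {mpoly rat[n]}) : int := (size (monomial_path y a))%:Z.

Lemma leadingM y a b : leading y a -> leading y b -> leading y (a * b).
Proof. by rewrite /leading monomial_pathM lead_coefM; apply: mulr_gt0. Qed.

Lemma leading_neq0 y a : leading y a -> monomial_path y a != 0.
Proof. by rewrite /leading -lead_coef_eq0; move=> /gt_eqF ->. Qed.

Lemma leading_tofrac y a : leading y a -> a%:F != 0 :> field.
Proof.
move=> /leading_neq0; rewrite tofrac_eq0; apply: contraNneq => ->.
by rewrite /monomial_path raddf0.
Qed.

Lemma orderM y a b : leading y a -> leading y b ->
  order y (a * b) = order y a + order y b - 1.
Proof.
move=> /leading_neq0 a0 /leading_neq0 b0; rewrite /order monomial_pathM size_mul //.
move: a0 b0; rewrite -!size_poly_gt0; move: (size _) (size _) => i j; lia.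
Qed.

Lemma leadingD y a b : leading y a -> leading y b ->
  leading y (a + b) /\ order y (a + b) = Num.max (order y a) (order y b).
Proof.
rewrite /leading /order monomial_pathD; move: (monomial_path y a) (monomial_path y b).
move=> p q p0 q0; case: (ltngtP (size p) (size q)) => s.
- rewrite addrC lead_coefDl // size_polyDl //; split=> //; lia.
- rewrite lead_coefDl // size_polyDl //; split=> //; lia.
have p_gt0 : (0 < size p)%N by rewrite size_poly_gt0 -lead_coef_eq0 gt_eqF.
have cD : (p + q)`_(size p).-1 = lead_coef p + lead_coef q.
  by rewrite coefD /lead_coef s.
have pos : 0 < (p + q)`_(size p).-1 by rewrite cD addr_gt0.
have sD : size (p + q) = size p.
  apply/eqP; rewrite eqn_leq (leq_trans (size_polyD _ _)) ?s ?maxnn //=.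
  rewrite -s -[size p]prednK //; apply: contraTltn pos => le_s.
  by rewrite nth_default // ltxx.
by rewrite /lead_coef sD; split=> //; lia.
Qed.

(* The degree in X of f at the point (X^(y 0), ..., X^(y (n - 1))). *)
Definition tropical y f (v : int) := exists a b : {mpoly rat[n]},
  [/\ f = a%:F / b%:F, leading y a, leading y b & v = order y a - order y b].

Lemma tropical_inj y f v w : tropical y f v -> tropical y f w -> v = w.
Proof.
move=> [a [b [-> a0 b0 ->]]] [c [d [/eqP e c0 d0 ->]]].
have [bF dF] := (leading_tofrac b0, leading_tofrac d0).
move: e; rewrite (eqr_div _ _ bF dF) -!tofracM tofrac_eq => /eqP e.
have := orderM a0 d0; rewrite e orderM // => /esym; lia.
Qed.

Lemma tropicalM y f g v w :
  tropical y f v -> tropical y g w -> tropical y (f * g) (v + w).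
Proof.
move=> [a [b [-> a0 b0 ->]]] [c [d [-> c0 d0 ->]]].
exists (a * c), (b * d); rewrite mulf_div !tofracM !orderM //.
by split; rewrite // ?leadingM //; lia.
Qed.

Lemma tropicalV y f v : tropical y f v -> tropical y f^-1 (- v).
Proof.
move=> [a [b [-> a0 b0 ->]]]; exists b, a; rewrite invf_div; split=> //; lia.
Qed.

Lemma tropicalD y f g v w :
  tropical y f v -> tropical y g w -> tropical y (f + g) (Num.max v w).
Proof.
move=> [a [b [-> a0 b0 ->]]] [c [d [-> c0 d0 ->]]].
have [bF dF] := (leading_tofrac b0, leading_tofrac d0).
have [l o] := leadingD (leadingM a0 d0) (leadingM c0 b0).
exists (a * d + c * b), (b * d); rewrite (addf_div _ _ bF dF) tofracD !tofracM.
split=> //; first exact: leadingM.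
by rewrite o !orderM //; lia.
Qed.

Lemma leading1 y : leading y 1.
Proof. by rewrite /leading /monomial_path rmorph1 lead_coef1. Qed.

Lemma order1 y : order y 1 = 1.
Proof. by rewrite /order /monomial_path rmorph1 size_poly1. Qed.

Lemma tropical1 y : tropical y 1 0.
Proof. by exists 1, 1; rewrite tofrac1 divr1 subrr leading1. Qed.

Lemma tropicalX y f v k : tropical y f v -> tropical y (f ^+ k) (k%:Z * v).
Proof.
move=> h; elim: k => [|k IH]; first by rewrite mul0r; apply: tropical1.
by rewrite exprS intS mulrDl mul1r; apply: tropicalM.
Qed.

Lemma tropical_initial y i : tropical y (initial_var i) (y i)%:Z.
Proof.
have e : monomial_path y 'X_i = 'X^(y i) by rewrite /monomial_path mmapX mmap1U.
exists 'X_i, 1; rewrite tofrac1 divr1 order1 leading1 /leading /order e.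
by rewrite lead_coefXn size_polyXn; split=> //; lia.
Qed.

Implicit Types (q : arrows n) (k : 'I_n).

Definition tropical_mutate q m k : 'I_n -> int := fun i =>
  if i == k then
    Num.max (\sum_j (q j k)%:Z * m j) (\sum_j (q k j)%:Z * m j) - m k
  else m i.

Fixpoint tropical_path q m (P : seq 'I_n) : 'I_n -> int :=
  if P is k :: P' then tropical_path (mutate_arrows q k) (tropical_mutate q m k) P'
  else m.

Lemma tropical_seed y (S : seed n field) m P :
  (forall i, tropical y (seed_var S i) (m i)) ->
  forall i, tropical y (seed_var (mutate_path S P) i)
    (tropical_path (seed_arrows S) m P i).
Proof.
elim: P S m => //= k P IH S m Sm; apply: IH => i /=.
rewrite /tropical_mutate; case: eqP => // _.
have prod (r : 'I_n -> nat) : tropical y (\prod_j seed_var S j ^+ r j) (\sum_j (r j)%:Z * m j).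
  by elim/big_ind2: _ => *; [exact: tropical1|exact: tropicalM|exact: tropicalX].
by apply: tropicalM (tropicalV (Sm k)); apply: tropicalD.
Qed.

Lemma eq_tropical_path q m m' P : m =1 m' -> tropical_path q m P =1 tropical_path q m' P.
Proof. by move=> /functional_extensionality ->. Qed.

(** A tropical mutation can be undone: without loops, the sums in it do not involve the coordinate
    being changed. *)
Lemma tropical_path_inj q m m' P : no2cycle q ->
  tropical_path q m P =1 tropical_path q m' P -> m =1 m'.
Proof.
elim: P q m m' => //= k P IH q m m' q0 e.
have {}e := IH _ _ _ (no2cycle_mutate k q0) e.
have eN i : i != k -> m i = m' i.
  by move=> /negPf ik; have := e i; rewrite /tropical_mutate ik.
have loop := no2cycle_loop k q0.
have sum (r : 'I_n -> nat) : r k = 0%N -> \sum_j (r j)%:Z * m j = \sum_j (r j)%:Z * m' j.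
  move=> rk; apply: eq_bigr => j _.
  by case: (eqVneq j k) => [->|/eN ->]; rewrite ?rk ?mul0r.
move=> i; case: (eqVneq i k) => [->|/eN //].
have := e k; rewrite /tropical_mutate eqxx (sum (q^~ k)) // (sum (q k)) //; lia.
Qed.

End Tropical.

(** * Slope vectors along the mutation paths that define t and e *)

Section T442Slopes.
Local Open Scope ring_scope.
Implicit Types (v x : int * int) (V : seq (int * int)).

Definition cross x v : int := x.1 * v.2 - x.2 * v.1.

(* Each node of a seed carries a vector of Z^2, defined up to sign: the rank and degree
   of the corresponding rigid sheaf on a weighted projective line of type (4, 4, 2).
   The tropical points that we use are v |-> |det (x, v)|. *)
Definition slopes V v : 'I_9 -> int := fun i => `|cross (nth (0, 0) V i) v|.

Definition column_sum V v (r : nat -> nat) : int :=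
  foldr (fun j s => (r j)%:Z * `|cross (nth (0, 0) V j) v| + s) 0 (iota 0 9).

(** Each step proposes the vector x of the new variable. The tropical exchange relation must then
    hold for all v, a statement about absolute values of linear forms. *)
Fixpoint slope_path (qs : arrow_lists) V (steps : seq (nat * (int * int))) : Prop :=
  if steps is (k, x) :: steps' then
    [/\ (k < 9)%N,
        forall v, Num.max (column_sum V v (fun j => entry qs j k))
          (column_sum V v (fun j => entry qs k j)) =
          `|cross (nth (0, 0) V k) v| + `|cross x v|
      & slope_path (mutate_lists 8 qs k) (set_nth (0, 0) V k x) steps']
  else True.

Definition slope_end V (steps : seq (nat * (int * int))) :=
  foldl (fun V s => set_nth (0, 0) V s.1 s.2) V steps.

Lemma slope_pathP (q : arrows 9) V steps v : slope_path (lists_of (n' := 8) q) V steps ->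
  tropical_path q (slopes V v) (map inord (unzip1 steps)) =1 slopes (slope_end V steps) v.
Proof.
elim: steps q V => //= -[k x] steps IH q V [lt_k step].
set kk : 'I_9 := inord k; have kkE : kk = k :> nat by rewrite inordK.
rewrite -{1}kkE -mutate_listsE => /IH {}IH i; rewrite -{}IH.
move: i; apply: eq_tropical_path => i; rewrite /tropical_mutate /slopes nth_set_nth /=.
rewrite -kkE (inj_eq val_inj); case: eqP => // _.
have sumE (r : nat -> nat) : \sum_(j < 9) (r j)%:Z * `|cross (nth (0, 0) V j) v| =
    column_sum V v r.
  pose F (j : nat) := (r j)%:Z * `|cross (nth (0, 0) V j) v|.
  by rewrite -[LHS]/(\sum_(j < 9) F j) -(big_mkord xpredT F) unlock.
have inE (j : 'I_9) : entry (lists_of (n' := 8) q) j kk = q j kk := entry_lists_of q j kk.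
have outE (j : 'I_9) : entry (lists_of (n' := 8) q) kk j = q kk j := entry_lists_of q kk j.
have := step v; rewrite -kkE -!sumE.
have -> : \sum_(j < 9) (entry (lists_of (n' := 8) q) j kk)%:Z * `|cross (nth (0, 0) V j) v| =
    \sum_(j < 9) (q j kk)%:Z * `|cross (nth (0, 0) V j) v|.
  by apply: eq_bigr => j _; rewrite inE.
have -> : \sum_(j < 9) (entry (lists_of (n' := 8) q) kk j)%:Z * `|cross (nth (0, 0) V j) v| =
    \sum_(j < 9) (q kk j)%:Z * `|cross (nth (0, 0) V j) v|.
  by apply: eq_bigr => j _; rewrite outE.
move=> ->; lia.
Qed.

(** These match two line bundles of degrees 0 and 4, torsion sheaves of lengths 3, 2, 1 in two tubes
    of rank 4, and one of length 1, hence degree 2, in a tube of rank 2. *)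
Definition T442_slopes : seq (int * int) :=
  [:: (1, 0); (1, 4); (0, 3); (0, 2); (0, 1); (0, 3); (0, 2); (0, 1); (0, 2)].

(** The two ends of a generator edge, with the new vector at each mutation. For t: the path to
    quiver 6 followed by mutation at 1, and the path to quiver 14. For e: likewise with quivers 177
    and 296. *)
Definition shift_steps1 : seq (nat * (int * int)) :=
  [:: (2%N, (1, 1)); (0%N, (1, 5)); (1%N, (0, 3))].
Definition shift_steps2 : seq (nat * (int * int)) :=
  [:: (3%N, (0, 2)); (4%N, (0, 1))].
Definition flip_steps1 : seq (nat * (int * int)) :=
  [:: (2%N, (1, 1)); (3%N, (1, 3)); (5%N, (1, 1)); (8%N, (1, 2)); (0%N, (2, 4)); (1%N, (2, 3))].
Definition flip_steps2 : seq (nat * (int * int)) :=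
  [:: (2%N, (1, 1)); (3%N, (1, 3)); (4%N, (1, 2)); (8%N, (1, 2)); (0%N, (1, 3)); (5%N, (2, 4))].

Ltac slope_step :=
  split; [by []
  | by move=> [p q]; rewrite /column_sum /= /entry /= /cross /=; lia
  | match goal with |- context [mutate_lists ?m ?r ?k] =>
      let r' := eval vm_compute in (mutate_lists m r k) in
      change (mutate_lists m r k) with r' end; rewrite [set_nth _ _ _ _]/= ].

Lemma shift_slopes1 : slope_path T442_lists T442_slopes shift_steps1.
Proof. by rewrite /T442_slopes /shift_steps1; do !slope_step. Qed.

Lemma shift_slopes2 : slope_path T442_lists T442_slopes shift_steps2.
Proof. by rewrite /T442_slopes /shift_steps2; do !slope_step. Qed.

Lemma flip_slopes1 : slope_path T442_lists T442_slopes flip_steps1.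
Proof. by rewrite /T442_slopes /flip_steps1; do !slope_step. Qed.

Lemma flip_slopes2 : slope_path T442_lists T442_slopes flip_steps2.
Proof. by rewrite /T442_slopes /flip_steps2; do !slope_step. Qed.

Definition same_slopes V V' (p : seq nat) (h : int * int -> int * int) :=
  forall v i, (i < 9)%N ->
    `|cross (nth (0, 0) V i) v| = `|cross (nth (0, 0) V' (nth 0%N p i)) (h v)|.

Lemma shift_same : same_slopes (slope_end T442_slopes shift_steps1)
  (slope_end T442_slopes shift_steps2) [:: 1%N; 2; 0%N; 3; 4; 5; 6; 7; 8]
  (fun v => (v.1, v.2 - v.1)).
Proof.
move=> [p q] i; rewrite /slope_end /=.
by do 9![case: i => [|i]; first by rewrite /cross /=; lia].
Qed.

Lemma flip_same : same_slopes (slope_end T442_slopes flip_steps1)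
  (slope_end T442_slopes flip_steps2) [:: 6; 1%N; 3; 2; 4; 0%N; 5; 8; 7]
  (fun v => (2 * v.1 - v.2, 5 * v.1 - 2 * v.2)).
Proof.
move=> [p q] i; rewrite /slope_end /=.
by do 9![case: i => [|i]; first by rewrite /cross /=; lia].
Qed.

(** Three nodes suffice: [n1_4] and [N_1] give the absolute values of the two coordinates, and
    [N_oo] their relative sign. *)
Lemma slopes_inj v w : slopes T442_slopes v =1 slopes T442_slopes w ->
  v = w \/ v = (- w.1, - w.2).
Proof.
case: v w => [p q] [p' q'] h.
have := h n1_4; have := h N_1; have := h N_oo; rewrite /slopes /cross /=.
move=> e1 e2 e3.
have [[-> ->]|[-> ->]] : (p = p' /\ q = q') \/ (p = - p' /\ q = - q') by lia.
  by left.
by right.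
Qed.

End T442Slopes.

(** * Free families *)

Section FreeFamilies.
Variable I : eqType.
Local Open Scope group_scope.
Implicit Types (l m : I * bool) (u v w : seq (I * bool)).

Definition reduced_word w := sorted (fun l m => m != flip l) w.

Definition free_family (G : groupType) (rho : I -> G) :=
  forall w, reduced_word w -> word_at rho w = 1 -> w = [::].

Lemma reduced_push l w : reduced_word w -> reduced_word (push l w).
Proof.
case: w => [|m w] //= rw; case: eqP => [_|/eqP ne]; last by rewrite /reduced_word /= ne.
by case: w rw => //= m' w /andP[].
Qed.

Definition reduce w := mul_word w [::].

Lemma reduced_reduce w : reduced_word (reduce w).
Proof. by elim: w => //= l w IH; apply: reduced_push. Qed.

Lemma word_at_reduce (G : groupType) (rho : I -> G) w :
  word_at rho (reduce w) = word_at rho w.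
Proof. by rewrite word_at_mul word_at_nil mulg1. Qed.

Lemma reduced_rcons l w : reduced_word (rcons w l) ->
  reduced_word w /\ (w != [::] -> l != flip (last l w)).
Proof.
by case: w => [|m w] //=; rewrite rcons_path => /andP[rw lw]; split=> // _.
Qed.

Lemma reduced_quotient l m u v : reduced_word (l :: u) -> reduced_word (m :: v) ->
  l != m -> reduced_word (inv_word (l :: u) ++ m :: v).
Proof.
move=> ru rv lm; rewrite /inv_word /= rev_cons /reduced_word cat_rcons sorted_cat_cons.
apply/andP; split; last by rewrite /= flipK eq_sym lm.
rewrite -rev_cons -map_cons rev_sorted sorted_map.
by apply: sub_sorted ru => a b; rewrite /= flipK eq_sym.
Qed.

(** Strip the common prefix; if the next letters differ, the quotient of the two words is reduced
    and nonempty, yet has value 1. *)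
Lemma free_family_inj (G : groupType) (rho : I -> G) u v : free_family rho ->
  reduced_word u -> reduced_word v -> word_at rho u = word_at rho v -> u = v.
Proof.
move=> free; elim: u v => [|l u IH] v ru rv.
  by rewrite word_at_nil => /esym /(free _ rv).
case: v rv => [|m v] rv; first by rewrite word_at_nil => /(free _ ru).
case: (eqVneq l m) => [<-|lm] e; last first.
  have := free _ (reduced_quotient ru rv lm).
  rewrite word_at_cat word_at_inv e mulVg => /(_ erefl).
  by move/(congr1 size); rewrite size_cat addnS.
move: e; rewrite !word_at_cons => /mulgI /IH -> //; first exact: path_sorted ru.
exact: path_sorted rv.
Qed.

(** Words with equal values have the same reduction, so an element determines the value of its words
    under any other assignment of the generators. *)
Lemma free_family_transfer (G K : groupType) (rho : I -> G) (rho' : I -> K) u v :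
  free_family rho -> word_at rho u = word_at rho v -> word_at rho' u = word_at rho' v.
Proof.
move=> free; rewrite -(word_at_reduce rho u) -(word_at_reduce rho v).
move=> /(free_family_inj free (reduced_reduce u) (reduced_reduce v)) e.
by rewrite -(word_at_reduce rho' u) e word_at_reduce.
Qed.

Lemma free_family_injective (G : groupType) (rho : I -> G) :
  free_family rho -> injective rho.
Proof.
move=> free i j e.
have [] // : [:: (i, false)] = [:: (j, false)].
by apply: (free_family_inj free) => //; rewrite !word_at_cons /letter_at /= e.
Qed.

Lemma free_family_basis (G : groupType) (rho : I -> G) (H : G -> Prop) :
  free_family rho -> (forall x, H x <-> exists w, x = word_at rho w) -> is_free H.
Proof.
move=> free HE; pose value (w : seq (I * bool)) := [seq (rho l.1, l.2) | l <- w].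
have rho_inj := free_family_injective free.
have reducedE w : reduced (value w) = reduced_word w.
  rewrite /reduced /value sorted_map; apply: eq_sorted => -[i b] [j c] /=.
  by rewrite (inj_eq rho_inj) xpair_eqE negb_and eq_sym; case: b; case: c.
have over w : word_over (fun x => exists i, x = rho i) (value w).
  by move=> l /mapP[l' _ ->]; exists l'.1.
have lift (w : seq (G * bool)) :
    word_over (fun x => exists i, x = rho i) w -> exists w', w = value w'.
  elim: w => [|[x b] w IH] ov; first by exists [::].
  have [i /= ei] := ov _ (mem_head _ _).
  have [|w' ->] := IH; first by move=> l lw; apply: ov; rewrite inE lw orbT.
  by exists ((i, b) :: w'); rewrite /= ei.
exists (fun x => exists i, x = rho i); split=> [w /lift[w' ->]|h /HE[w ->]].
  by apply/HE; exists w'.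
exists (value (reduce w)); split.
  split; [exact: over | by rewrite reducedE reduced_reduce | exact: word_at_reduce].
move=> _ [/lift[w' ->]]; rewrite reducedE => rw' e; congr value.
apply: (free_family_inj free _ rw'); first exact: reduced_reduce.
by rewrite word_at_reduce -e.
Qed.

(** The map chooses a word for each element and evaluates it in the other group. Freeness of the
    source makes it independent of the choice, and freeness of the target makes it injective. *)
Lemma free_families_isomorphic (G K : groupType) (rho : I -> G) (rho' : I -> K)
    (H : G -> Prop) (L : K -> Prop) : free_family rho -> free_family rho' ->
    (forall x, H x <-> exists w, x = word_at rho w) ->
    (forall x, L x <-> exists w, x = word_at rho' w) ->
  subgroup_isomorphic H L.
Proof.
move=> free free' HE LE.
pose word x := epsilon (inhabits [::]) (fun w => x = word_at rho w).
have wordP x : H x -> x = word_at rho (word x) by move=> /HE /epsilon_spec; exact.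
have fE w : word_at rho' (word (word_at rho w)) = word_at rho' w.
  by apply: (free_family_transfer rho' free); rewrite -wordP //; apply/HE; exists w.
exists (fun x => word_at rho' (word x)); split.
- move=> _ _ /HE[u ->] /HE[v ->]; by rewrite -word_at_cat !fE word_at_cat.
- move=> x y Hx Hy /(free_family_transfer rho free') e.
  by rewrite (wordP x Hx) (wordP y Hy).
move=> z; split=> [/LE[w ->]|[_ /HE[w ->] <-]]; last by apply/LE; exists (word (word_at rho w)).
by exists (word_at rho w); [apply/HE; exists w | exact: fE].
Qed.

End FreeFamilies.

Section Morphisms.
Local Open Scope group_scope.
Variables (G K : groupType) (phi : G -> K).
Hypothesis phiM : forall x y, phi (x * y) = phi x * phi y.

Lemma morphism1 : phi 1 = 1.
Proof. by apply: (mulgI (phi 1)); rewrite -phiM !mulg1. Qed.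

Lemma morphismV x : phi x^-1 = (phi x)^-1.
Proof. by apply: (mulgI (phi x)); rewrite -phiM !mulgV morphism1. Qed.

Lemma morphismX x n : phi (x ^+ n) = phi x ^+ n.
Proof. by elim: n => [|n IH]; rewrite ?morphism1 // !expgS phiM IH. Qed.

Lemma morphism_word (I : eqType) (rho : I -> G) (rho' : I -> K) w :
  (forall i, phi (rho i) = rho' i) -> phi (word_at rho w) = word_at rho' w.
Proof.
move=> e; elim: w => [|[i b] w IH]; first by rewrite !word_at_nil morphism1.
rewrite !word_at_cons phiM IH; congr (_ * _).
by case: b; rewrite /letter_at /letter_val /= ?morphismV e.
Qed.

Lemma morphism_parabolic t e i : phi (parabolic t e i) = parabolic (phi t) (phi e) i.
Proof. by rewrite /parabolic; case: (val i) => *; rewrite !(phiM, morphismV, morphismX). Qed.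

End Morphisms.

(** * The action of SL(2, Z) on slopes *)

Section LinearAction.
Local Open Scope ring_scope.
Implicit Types (A B : SL2Z) (v w : int * int).

(** Row vectors give a right action, which matches the order of multiplication in Gamma
    ([acts_on_slopesM]). *)
Definition row_act A v : int * int :=
  (v.1 * val A 0 0 + v.2 * val A 1 0, v.1 * val A 0 1 + v.2 * val A 1 1).

Lemma sum_ord2 (F : 'I_2 -> int) : \sum_i F i = F 0 + F 1.
Proof.
by rewrite !big_ord_recl big_ord0 addr0; congr (_ + F _); apply: val_inj.
Qed.

Lemma row_actM A B v : row_act (A * B)%g v = row_act B (row_act A v).
Proof. by rewrite /row_act /= !mxE !sum_ord2; congr pair; ring. Qed.

Lemma row_act1 v : row_act 1%g v = v.
Proof. by case: v => p q; rewrite /row_act /= !mxE /=; congr pair; ring. Qed.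

Lemma row_actV A v w : row_act A v = w -> row_act A^-1%g w = v.
Proof. by move=> <-; rewrite -row_actM mulgV row_act1. Qed.

Lemma row_actX A n v : row_act (A ^+ n)%g v = iter n (row_act A) v.
Proof.
elim: n v => [|n IH] v; first by rewrite expg0 row_act1.
by rewrite expgSr row_actM IH.
Qed.

Lemma row_act_opp A v : row_act (SL2Z_opp A) v = (- (row_act A v).1, - (row_act A v).2).
Proof. by rewrite /row_act /= !mxE; congr pair; ring. Qed.

Lemma ord2E (k : 'I_2) : k = 0 \/ k = 1.
Proof. by case: k => -[|[|//]] lt_k; [left|right]; apply: val_inj. Qed.

Lemma row_act_inj A B : row_act A =1 row_act B -> A = B.
Proof.
move=> e; apply: val_inj; apply/matrixP => i j.
have := e (1, 0); have := e (0, 1); rewrite /row_act /= !mul1r !mul0r !add0r !addr0.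
move=> [e1 e2] [e3 e4].
by case: (ord2E i) => ->; case: (ord2E j) => ->.
Qed.

Lemma det_ord2 (M : 'M[int]_2) : \det M = M 0 0 * M 1 1 - M 0 1 * M 1 0.
Proof.
rewrite (expand_det_row _ 0) sum_ord2 /cofactor !det_mx11 !mxE /= expr0 expr1.
have -> : lift (0 : 'I_2) 0 = 1 by apply: val_inj.
have -> : lift (1 : 'I_2) 0 = 0 by apply: val_inj.
by ring.
Qed.

Definition sl2_mx (a b c d : int) : 'M[int]_2 :=
  \matrix_(i < 2, j < 2) nth 0 (nth [::] [:: [:: a; b]; [:: c; d]] i) j.

Fact sl2_subproof a b c d : a * d - b * c = 1 -> \det (sl2_mx a b c d) == 1.
Proof. by move=> e; rewrite det_ord2 !mxE /= e. Qed.

Definition sl2 a b c d (e : a * d - b * c = 1) : SL2Z :=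
  exist _ (sl2_mx a b c d) (sl2_subproof e).

Definition shift_matrix : SL2Z := @sl2 1 (- 1) 0 1 erefl.
Definition flip_matrix : SL2Z := @sl2 2 5 (- 1) (- 2) erefl.

Definition shift_vector v := (v.1, v.2 - v.1).
Definition flip_vector v := (2 * v.1 - v.2, 5 * v.1 - 2 * v.2).

Lemma row_act_shift v : row_act shift_matrix v = shift_vector v.
Proof. by rewrite /row_act /shift_vector /= !mxE /=; congr pair; ring. Qed.

Lemma row_act_flip v : row_act flip_matrix v = flip_vector v.
Proof. by rewrite /row_act /flip_vector /= !mxE /=; congr pair; ring. Qed.

Lemma row_act_shiftV v : row_act shift_matrix^-1%g v = (v.1, v.2 + v.1).
Proof.
by case: v => p q; apply: row_actV; rewrite row_act_shift /shift_vector /=; congr pair; ring.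
Qed.

Lemma row_act_shiftX n v : row_act (shift_matrix ^+ n)%g v = (v.1, v.2 - n%:Z * v.1).
Proof.
case: v => p q; rewrite row_actX; elim: n => [|n IH]; first by rewrite mul0r subr0.
by rewrite iterS IH row_act_shift /shift_vector /=; congr pair; rewrite intS; ring.
Qed.

Lemma row_act_shiftVX n v : row_act (shift_matrix ^- n)%g v = (v.1, v.2 + n%:Z * v.1).
Proof. by case: v => p q; apply: row_actV; rewrite row_act_shiftX /=; congr pair; ring. Qed.

(** The vector fixed up to sign by the i-th parabolic matrix: slope oo for i = 0, and slope i + 1
    otherwise. *)
Definition cusp (i : nat) : int * int := if i is j.+1 then (1, j.+2%:Z) else (0, 1).

Definition transvect (s : int) (u v : int * int) : int * int :=
  (v.1 + s * cross u v * u.1, v.2 + s * cross u v * u.2).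

Local Notation rho := (parabolic shift_matrix flip_matrix).

(** The sign for i > 0 comes from the two factors [flip_matrix], whose square is -1. *)
Lemma row_act_parabolic (i : 'I_5) v :
  row_act (rho i) v = let: w := transvect (- 4) (cusp i) v in
    if val i == 0%N then w else (- w.1, - w.2).
Proof.
case: v => p q.
rewrite /parabolic /transvect /cross /=; case: (nat_of_ord i) => [|j] /=.
  rewrite row_act_shiftVX /=; congr pair; ring.
rewrite (row_actM _ (shift_matrix ^- j)%g) (row_actM _ flip_matrix).
rewrite (row_actM _ (shift_matrix ^- 4)%g) (row_actM _ flip_matrix).
rewrite !(row_act_shiftVX, row_act_shiftX) !row_act_flip /flip_vector /=.
have -> : j.+2%:Z = 2 + j%:Z by []. congr pair; ring.
Qed.

Lemma row_act_letter (i : 'I_5) b v :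
  let w := transvect (if b then 4 else - 4) (cusp i) v in
  row_act (letter_at rho (i, b)) v = w \/ row_act (letter_at rho (i, b)) v = (- w.1, - w.2).
Proof.
case: b; rewrite /letter_at /letter_val /=; last first.
  by rewrite row_act_parabolic /=; case: eqP => _; [left|right].
set w := transvect 4 _ _.
have h x y : row_act (rho i) (x, y) = v -> row_act (rho i)^-1%g v = (x, y) by exact: row_actV.
case: (eqVneq (val i) 0%N) => [i0|/negPf i0]; [left|right]; last first.
  apply: h; rewrite row_act_parabolic i0 /= /w /transvect /cross.
  by case: (v) => p q /=; congr pair; ring.
rewrite [w in RHS]surjective_pairing; apply: h.
rewrite row_act_parabolic i0 /= /w /transvect /cross.
by case: (v) => p q /=; congr pair; ring.
Qed.

(* The sides of an ideal decagon in the projective line, which are paired by the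
   parabolic elements; its vertices are the slopes 3/2, 2, 5/2, ..., 5, 11/2, oo. *)
Definition ray (k : nat) : int * int := nth (0, 0)
  [:: (2, 3); (1, 2); (2, 5); (1, 3); (2, 7); (1, 4); (2, 9); (1, 5); (2, 11); (0, 1);
      (- 2, - 3)] k.

(** For u and w in counterclockwise order: v or -v lies in the closed cone that they span. [cone]
    and [cocone] are then complementary closed arcs of the projective line. *)
Definition between u w v : bool :=
  (0 <= cross u v) && (0 <= cross v w) || (cross u v <= 0) && (cross v w <= 0).

Definition cone k v := between (ray k) (ray k.+1) v.

Definition cocone k v := between (ray k.+1) (- (ray k).1, - (ray k).2) v.

(** Sides 2j and 2j + 1 meet at the slope j + 2, and sides 8 and 9 at oo: a letter and its inverse
    get the two sides at its cusp. *)
Definition side (l : 'I_5 * bool) : nat :=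
  if val l.1 is j.+1 then (2 * j + l.2)%N else (8 + l.2)%N.

Lemma side_lt l : (side l < 10)%N.
Proof. by case: l => -[[|[|[|[|[|//]]]]] lt_i] []. Qed.

Lemma side_inj : injective side.
Proof.
move=> [i b] [j c]; rewrite /side /= => e.
have [eij ->] : nat_of_ord i = j /\ b = c.
  by case: i j e => -[|i] lt_i [[|j] lt_j] /=; case: b; case: c; lia.
by congr pair; apply: val_inj.
Qed.

Lemma cone_cocone k k' v : (k < 10)%N -> (k' < 10)%N -> k != k' ->
  cone k v -> cocone k' v.
Proof.
case: v => p q; rewrite /cone /cocone /between /cross.
do 10?[case: k => [|k] //]; do 10?[case: k' => [|k'] //]; move=> _ _ _; rewrite /=; lia.
Qed.

Lemma cone_opp k v : cone k (- v.1, - v.2) = cone k v.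
Proof. by rewrite /cone /between /cross /=; apply/idP/idP; lia. Qed.

(** The ping-pong step: the parabolic element at the common vertex of two paired sides moves
    everything beyond neither its source side into the arc cut off by its target side. *)
Lemma cone_letter l v : cocone (side (flip l)) v -> cone (side l) (row_act (letter_at rho l) v).
Proof.
case: l => i b h; set k := side _.
suff : cone k (transvect (if b then 4 else - 4) (cusp i) v).
  by have [->|->] := row_act_letter i b v; rewrite ?cone_opp.
move: h; rewrite {}/k /side /cusp /cone /cocone /between /transvect /cross /=.
case: v => p q /=; case: i => -[|[|[|[|[|//]]]]] lt_i /=; case: b => /=; lia.
Qed.

Lemma cone_word (w : seq ('I_5 * bool)) l v :
  (forall k, (k < 10)%N -> cocone k v) -> reduced_word (rcons w l) ->
  cone (side l) (row_act (word_at rho (rcons w l)) v).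
Proof.
move=> v0; elim/last_ind: w l => [|w m IH] l.
  rewrite word_at_cons word_at_nil mulg1 => _; apply: cone_letter.
  by apply: v0; apply: side_lt.
move=> /reduced_rcons[rw lm].
rewrite -cats1 word_at_cat row_actM word_at_cons word_at_nil mulg1.
apply: cone_letter; apply: cone_cocone (IH _ rw); rewrite ?side_lt //.
rewrite (inj_eq side_inj) eq_sym (inv_eq (@flipK 'I_5)).
by move: lm; rewrite last_rcons; apply; case: (w).
Qed.

(** A nonempty reduced word sends a vector lying in all the cocones into the arc of its last letter,
    so it cannot act as a sign. *)
Lemma parabolic_words_free (w : seq ('I_5 * bool)) : reduced_word w ->
  (forall v, row_act (word_at rho w) v = v) \/
    (forall v, row_act (word_at rho w) v = (- v.1, - v.2)) -> w = [::].
Proof.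
case/lastP: w => // w l rw h; exfalso.
(* The slopes 2 and 4 are vertices of the decagon, hence lie in every closed cocone, but no single
   side has both in its arc. *)
have cc v : v = (1, 2) \/ v = (1, 4) -> cone (side l) v.
  move=> v12; have : cone (side l) (row_act (word_at rho (rcons w l)) v).
    apply: cone_word rw => k lt_k; case: v12 => ->;
    by do 10![case: k lt_k => [|k] lt_k //].
  by case: h => ->; rewrite ?cone_opp.
have := cc _ (or_introl erefl); have := cc _ (or_intror erefl).
by have := side_lt l; move: (side l); do 10![case=> [//|]].
Qed.

End LinearAction.

(** * The level 4 congruence subgroup *)

Section Projective.
Local Open Scope ring_scope.
Implicit Types (A B : SL2Z) (v : int * int).

Lemma SL2Z_classM A B : SL2Z_class (A * B)%g = (SL2Z_class A * SL2Z_class B)%g.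
Proof. exact/esym/PSL2Z_mulE. Qed.

Lemma SL2Z_class_eqP A B : SL2Z_class A = SL2Z_class B <->
  row_act A =1 row_act B \/ (forall v, row_act A v = (- (row_act B v).1, - (row_act B v).2)).
Proof.
split=> [/SL2Z_classP/orP[]/eqP->|[/row_act_inj -> //|e]]; first by left.
  by right=> v; rewrite row_act_opp.
suff -> : A = SL2Z_opp B by apply/SL2Z_classP; rewrite /eq_up_to_sign eqxx orbT.
by apply: row_act_inj => v; rewrite e row_act_opp.
Qed.

Definition projective_shift := SL2Z_class shift_matrix.
Definition projective_flip := SL2Z_class flip_matrix.

(** With a = 1 the kernel of order 16 collapses, and the rewriting and coset arguments apply
    verbatim to PSL(2, Z). *)
Lemma projective_relations : modular_relations (projective_shift ^- 4)%g 1%g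
  (projective_shift ^+ 2)%g projective_shift projective_flip.
Proof.
have shiftE : projective_shift = SL2Z_class shift_matrix by [].
have class1 : SL2Z_class 1%g = 1%g by [].
have ee : (projective_flip * projective_flip = 1)%g.
  rewrite -class1 -SL2Z_classM; apply/SL2Z_class_eqP; right=> -[p q].
  by rewrite row_actM !row_act_flip row_act1 /flip_vector /=; congr pair; ring.
have ete : (projective_flip * projective_shift^-1 * projective_flip *
    projective_shift^-1 * projective_flip * projective_shift^-1 = 1)%g.
  have <- : SL2Z_class (flip_matrix * shift_matrix^-1 * flip_matrix * shift_matrix^-1 *
      flip_matrix * shift_matrix^-1)%g = (projective_flip * projective_shift^-1 *
      projective_flip * projective_shift^-1 * projective_flip * projective_shift^-1)%g.
    by rewrite !SL2Z_classM (morphismV SL2Z_classM).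
  rewrite -class1.
  apply/SL2Z_class_eqP; left=> -[p q].
  by rewrite !(row_actM, row_act_flip, row_act_shiftV) row_act1 /flip_vector /=; congr pair; ring.
move: projective_shift projective_flip ee ete {shiftE} => t e ee ete.
split; rewrite ?mulg1 ?mul1g //.
- by rewrite -expgD mulgV.
- by rewrite !expgS expg0 mulg1 !mulgA.
- exact/commute_sym/commuteX.
- by rewrite ee -mulgA -expg2 mulVg.
Qed.

Lemma projective_free : free_family (parabolic projective_shift projective_flip).
Proof.
move=> w rw; have wE := morphism_word SL2Z_classM w
  (fun i => morphism_parabolic SL2Z_classM shift_matrix flip_matrix i).
rewrite -/projective_shift -/projective_flip in wE.
have class1 : SL2Z_class 1%g = 1%g by [].
rewrite -wE -class1 => /SL2Z_class_eqP h; apply: (parabolic_words_free rw).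
by case: h => h; [left|right] => v; rewrite h row_act1.
Qed.

Definition rotation : SL2Z := (shift_matrix ^- 2 * flip_matrix * shift_matrix ^+ 2)%g.

Definition shift_power (k : int) : SL2Z :=
  match k with Posz n => shift_matrix ^+ n | Negz n => shift_matrix ^- n.+1 end%g.

Lemma row_act_shift_power k v : row_act (shift_power k) v = (v.1, v.2 - k * v.1).
Proof.
case: k => n; rewrite /shift_power ?row_act_shiftX ?row_act_shiftVX //.
by rewrite NegzE; congr pair; ring.
Qed.

Lemma row_act_rotation v : row_act rotation v = (- v.2, v.1).
Proof.
rewrite /rotation (row_actM _ (shift_matrix ^+ 2)%g) (row_actM _ flip_matrix).
rewrite row_act_shiftX row_act_shiftVX row_act_flip /flip_vector /=.
by congr pair; lia.
Qed.

(** Euclid's algorithm on the first row: a power of the shift reduces its second entry modulo the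
    first, and [rotation] exchanges the two up to sign. *)
Lemma projective_generated (H : PSL2Z -> Prop) : is_subgroup H ->
  H projective_shift -> H projective_flip -> forall x, H x.
Proof.
move=> SH Ht He; have HV := @subgroupV _ _ SH; have HM := @subgroupM _ _ SH.
have class1 : SL2Z_class 1%g = 1%g by [].
have HX A n : H (SL2Z_class A) -> H (SL2Z_class (A ^+ n)%g).
  move=> HA; elim: n => [|n IH]; first by rewrite expg0 class1; case: SH.
  by rewrite expgS SL2Z_classM; apply: HM.
have Hsh k : H (SL2Z_class (shift_power k)).
  by case: k => n; rewrite ?(morphismV SL2Z_classM); [|apply: HV]; apply: HX.
have Hrot : H (SL2Z_class rotation).
  rewrite /rotation (SL2Z_classM _ (shift_matrix ^+ 2)%g) (SL2Z_classM _ flip_matrix).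
  exact: (HM _ _ (HM _ _ (Hsh (Negz 1)) He) (Hsh (Posz 2))).
have det A : (row_act A (1, 0)).1 * (row_act A (0, 1)).2 -
    (row_act A (1, 0)).2 * (row_act A (0, 1)).1 = 1.
  rewrite -[RHS](SL2Z_det A) det_ord2 /row_act /=; ring.
have linear A v : row_act A v =
    (v.1 * (row_act A (1, 0)).1 + v.2 * (row_act A (0, 1)).1,
     v.1 * (row_act A (1, 0)).2 + v.2 * (row_act A (0, 1)).2).
  by rewrite /row_act /=; congr pair; ring.
have HA (n : nat) A : (`|(row_act A (1, 0)%R).1| <= n)%N -> H (SL2Z_class A).
  elim: n A => [|n IH] A.
    move: (det A) (linear A); case: (row_act A (1, 0)) => a b; case: (row_act A (0, 1)) => c d /=.
    move=> dA lin; rewrite leqn0 absz_eq0 => /eqP a0.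
    have [s1 cE] : (b = 1 \/ b = - 1) /\ c = - b.
      have bc : - (b * c) = 1 by rewrite -dA a0 mul0r sub0r.
      have : (`|b| * `|c| == 1)%N by rewrite -abszM; lia.
      by rewrite muln_eq1 => /andP[/eqP b1 /eqP c1]; case: (b) (c) bc b1 c1 => [x|x] [y|y]; lia.
    have -> : SL2Z_class A = SL2Z_class (rotation * shift_power (d * b))%g; last first.
      by rewrite SL2Z_classM; apply: HM.
    apply/SL2Z_class_eqP; case: s1 => bE; [left|right] => -[p q];
      rewrite lin row_actM row_act_rotation row_act_shift_power a0 cE bE /=; congr pair; ring.
  move=> le_n; set a := (row_act A (1, 0)).1; set b := (row_act A (1, 0)).2.
  have [/eqP a0|a0] := boolP (a == 0); first by apply: IH; rewrite -/a a0.
  have : H (SL2Z_class (A * shift_power (b %/ a)%Z * rotation)%g).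
    apply: IH; rewrite (row_actM _ rotation) (row_actM A) row_act_rotation row_act_shift_power.
    rewrite /= -/a -/b.
    have := ltz_mod b a0; have := modz_ge0 b a0.
    have -> : - (b - (b %/ a)%Z * a) = - (b %% a)%Z by rewrite /modz.
    move: le_n a0; rewrite -/a; lia.
  rewrite (SL2Z_classM _ rotation) (SL2Z_classM A) => HAr.
  have := HM _ _ (HM _ _ HAr (HV _ Hrot)) (HV _ (Hsh (b %/ a)%Z)).
  by rewrite !mulgK.
by move=> x; rewrite -[x]SL2Z_classK; apply: HA (leqnn _).
Qed.

Definition congruent_vectors (N : nat) v w : bool :=
  (N %| w.1 - v.1)%Z && (N %| w.2 - v.2)%Z.

Lemma congruent_vectors_trans N u v w :
  congruent_vectors N u v -> congruent_vectors N v w -> congruent_vectors N u w.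
Proof.
move=> /andP[a b] /andP[c d]; apply/andP; split.
  by rewrite -(subrK v.1 w.1) -addrA rpredD.
by rewrite -(subrK v.2 w.2) -addrA rpredD.
Qed.

Lemma congruent_vectors_sym N v w : congruent_vectors N v w -> congruent_vectors N w v.
Proof. by rewrite /congruent_vectors -!(opprB w.1) -!(opprB w.2) !rpredN. Qed.

Lemma principal_congruenceP N A :
  principal_congruence N A <-> forall v, congruent_vectors N v (row_act A v).
Proof.
split=> [h v|h i j].
  have d i j : (N %| val A i j - (1%:M : 'M[int]_2) i j)%Z.
    by rewrite -eqz_mod_dvd; apply/eqP; exact: h.
  have := (d 0 0, d 0 1, d 1 0, d 1 1); rewrite !mxE /= => -[[[d1 d2] d3] d4].
  rewrite !subr0 in d2 d3; rewrite /congruent_vectors /row_act /=.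
  rewrite (_ : _ - v.1 = v.1 * (val A 0 0 - 1) + v.2 * val A 1 0); last by ring.
  rewrite (_ : _ - v.2 = v.1 * val A 0 1 + v.2 * (val A 1 1 - 1)); last by ring.
  by rewrite !rpredD ?dvdz_mull.
apply/eqP; rewrite eqz_mod_dvd.
have /andP[d1 d2] := h (1, 0); have /andP[d3 d4] := h (0, 1).
rewrite /row_act /= !(mul0r, mul1r, addr0, add0r) in d1 d2 d3 d4.
case: (ord2E i) => ->; case: (ord2E j) => ->; rewrite !mxE /=.
all: by rewrite ?subr0.
Qed.

Lemma projective_congruence_subgroup N : is_subgroup (projective_congruence N).
Proof.
split.
  by exists (1%g : SL2Z).
move=> _ _ [A /principal_congruenceP cA <-] [B /principal_congruenceP cB <-].
exists (A * B^-1)%g; last by rewrite SL2Z_classM (morphismV SL2Z_classM).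
apply/principal_congruenceP => v.
apply: (congruent_vectors_trans (cA v)); rewrite row_actM.
have := cB (row_act B^-1%g (row_act A v)); rewrite -(row_actM B^-1%g B) mulVg row_act1.
exact: congruent_vectors_sym.
Qed.

Lemma parabolic_congruence i :
  projective_congruence 4 (parabolic projective_shift projective_flip i).
Proof.
rewrite -(morphism_parabolic SL2Z_classM).
set A := parabolic _ _ i.
have tr v : congruent_vectors 4 v (transvect (- 4) (cusp i) v).
  rewrite /congruent_vectors /transvect /= !(addrC _ (_ * _)) !addrK.
  by rewrite !mulNr !rpredN -!mulrA !dvdz_mulr.
case: (eqVneq (val i) 0%N) => [i0|/negPf i0].
  exists A => //; apply/principal_congruenceP => v.
  by rewrite row_act_parabolic i0; exact: tr.
exists (SL2Z_opp A); last first.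
  by apply/SL2Z_class_eqP; right=> v; rewrite row_act_opp.
apply/principal_congruenceP => v.
by rewrite row_act_opp row_act_parabolic i0 /= !opprK; exact: tr.
Qed.

Local Notation value := (modular_value 1%g projective_shift projective_flip).

(** The letters u, z and a have value 1 here, whence the default [id]. *)
Definition letter_vector (i : nat) : int * int -> int * int :=
  nth id [:: flip_vector; fun v => flip_vector (v.1, v.2 + v.1);
             fun v => shift_vector (flip_vector v)] i.

Definition string_vector (r : seq nat) v := foldl (fun v i => letter_vector i v) v r.

Lemma string_vectorP r : exists2 A, SL2Z_class A = string_val value r &
  forall v, row_act A v = string_vector r v.
Proof.
elim: r => [|i r [A eA hA]].
  by exists 1%g; [rewrite string_val_nil | exact: row_act1].
suff [B eB hB] : exists2 B, SL2Z_class B = value i & forall v, row_act B v = letter_vector i v.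
  exists (B * A)%g; first by rewrite SL2Z_classM eA eB string_val_cons.
  by move=> v; rewrite row_actM hA hB.
have one : value i = 1%g -> letter_vector i = id ->
    exists2 B, SL2Z_class B = value i & forall v, row_act B v = letter_vector i v.
  by move=> -> ->; exists 1%g => //; exact: row_act1.
case: i one => [|[|[|[|[|[|i]]]]]] one.
- by exists flip_matrix => // v; rewrite row_act_flip.
- exists (shift_matrix^-1 * flip_matrix)%g => [|v].
    by rewrite SL2Z_classM (morphismV SL2Z_classM).
  by rewrite row_actM row_act_shiftV row_act_flip.
- exists (flip_matrix * shift_matrix)%g => [|v]; first by rewrite SL2Z_classM.
  by rewrite row_actM row_act_shift row_act_flip.
- by apply: one => //; rewrite /modular_value /= mul1g mulg1 mulgV.
- by apply: one => //; rewrite /modular_value /= mulg1 (rel_ee projective_relations).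
- exact: one.
- by apply: one => //; rewrite /modular_value nth_default.
Qed.

Definition congruent_sign (w1 w2 : int * int) : bool :=
  congruent_vectors 4 (1, 0) w1 && congruent_vectors 4 (0, 1) w2 ||
  congruent_vectors 4 (- 1, 0) w1 && congruent_vectors 4 (0, - 1) w2.

(** A representative congruent to 1 modulo 4 up to sign consists of the letters u, z, a alone, whose
    values in PSL(2, Z) are 1. *)
Lemma coset_strings_distinct : all (fun r =>
  congruent_sign (string_vector r (1, 0)) (string_vector r (0, 1)) ==>
  all (leq 3) r) coset_strings.
Proof. by vm_compute. Qed.

(** Write x as a parabolic product times a coset representative. If x has level 4, so does the
    representative, which is then 1 by [coset_strings_distinct]. *)
Lemma projective_congruence_parabolic x : projective_congruence 4 x <->
  parabolic_subgroup projective_shift projective_flip x.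
Proof.
have SC := projective_congruence_subgroup 4.
have sub y : parabolic_subgroup projective_shift projective_flip y -> projective_congruence 4 y.
  move=> [w ->]; elim: w => [|[i b] w IH]; first by rewrite word_at_nil; case: SC.
  rewrite word_at_cons; apply: (subgroupM SC) IH.
  by case: b; [apply: (subgroupV SC)|]; exact: parabolic_congruence.
split=> [cx|]; last exact: sub.
have gen (H : PSL2Z -> Prop) : is_subgroup H -> H 1%g -> H projective_shift ->
    H projective_flip -> forall y, H y.
  by move=> SH _; apply: projective_generated.
have [r rL xr] := parabolic_cosets projective_relations gen x.
have [B cB eB] : projective_congruence 4 (string_val value r).
  have := subgroupM SC (subgroupV SC (sub _ xr)) cx.
  by rewrite invgM invgK mulgKV.
have [A eA hA] := string_vectorP r.
have {eA eB} : SL2Z_class A = SL2Z_class B by rewrite eA eB.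
move/principal_congruenceP: cB => cB /SL2Z_class_eqP AB.
have r3 : all (leq 3) r.
  have := allP coset_strings_distinct r rL; rewrite -!hA => /implyP; apply.
  apply/orP; case: AB => AB; [left|right]; rewrite !AB; first by rewrite !cB.
  have N v w : congruent_vectors 4 v w -> congruent_vectors 4 (- v.1, - v.2) (- w.1, - w.2).
    by rewrite /congruent_vectors -!opprD !rpredN.
  by rewrite (N (1, 0)) ?(N (0, 1)).
have r1 : string_val value r = 1%g.
  elim: r {rL xr AB hA} r3 => [|i r IH] /=; first by rewrite string_val_nil.
  case/andP=> le_i /IH {}IH; rewrite string_val_cons IH mulg1.
  move: le_i; rewrite /modular_value; case: i => [|[|[|[|[|[|i]]]]]] //= _.
  - by rewrite mul1g mulg1 mulgV.
  - by rewrite mulg1 (rel_ee projective_relations).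
  - by rewrite nth_default.
by move: xr; rewrite r1 invg1 mulg1.
Qed.

End Projective.

(** * The slope action of the cluster modular group *)

Section SlopeAction.
Local Open Scope ring_scope.
Local Notation Gamma := (cluster_modular_group T442).
Implicit Types (x y : Gamma) (A B : SL2Z) (v : int * int).

Definition slope_weights v (i : 'I_9) : nat := absz (slopes T442_slopes v i).

(** A relation in place of a map to PSL(2, Z): it is checked for t and e only and then passes to
    products and inverses. *)
Definition acts_on_slopes x A := forall v i,
  tropical (slope_weights v) (seed_var (class_seed x) i) (slopes T442_slopes (row_act A v) i).

Lemma tropical_initial_slopes v i :
  tropical (slope_weights v) (seed_var (initial_seed T442) i) (slopes T442_slopes v i).
Proof.
have -> : slopes T442_slopes v i = (slope_weights v i)%:Z.
  by rewrite /slope_weights /slopes gez0_abs.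
exact: tropical_initial.
Qed.

Definition slope_image x (m : 'I_9 -> int) : 'I_9 -> int :=
  fun i => tropical_path T442 m (pair_path (repr x)) (pair_perm (repr x) i).

Lemma tropical_mul x y (w : 'I_9 -> nat) m :
  (forall i, tropical w (seed_var (class_seed x) i) (m i)) ->
  forall i, tropical w (seed_var (class_seed (x * y)%g) i) (slope_image y m i).
Proof.
move=> xm i; rewrite -{1}[y]modular_classK class_seedM /relabel /=.
exact: (tropical_seed _ xm).
Qed.

Lemma tropical_class x v i :
  tropical (slope_weights v) (seed_var (class_seed x) i)
    (slope_image x (slopes T442_slopes v) i).
Proof.
rewrite -{1}[x]mul1g; apply: tropical_mul => {}i; rewrite class_seed1.
exact: tropical_initial_slopes.
Qed.

Lemma acts_on_slopesP x A : acts_on_slopes x A <->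
  forall v, slope_image x (slopes T442_slopes v) =1 slopes T442_slopes (row_act A v).
Proof.
split=> h v i; first exact: tropical_inj (tropical_class x v i) (h v i).
by rewrite -h; apply: tropical_class.
Qed.

Lemma acts_on_slopesM x y A B :
  acts_on_slopes x A -> acts_on_slopes y B -> acts_on_slopes (x * y)%g (A * B)%g.
Proof.
move=> xA /acts_on_slopesP yB v i; rewrite row_actM -yB.
by apply: tropical_mul => {}i; apply: xA.
Qed.

Lemma acts_on_slopes1 : acts_on_slopes 1%g 1%g.
Proof. by move=> v i; rewrite row_act1 class_seed1; apply: tropical_initial_slopes. Qed.

Lemma acts_on_slopesV x A : acts_on_slopes x A -> acts_on_slopes x^-1%g A^-1%g.
Proof.
move=> xA; apply/acts_on_slopesP => v i; set w := row_act A^-1%g v.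
have vE : row_act A w = v by rewrite -row_actM mulVg row_act1.
have := tropical_mul x^-1%g (xA w) i; rewrite mulgV class_seed1 vE.
move/tropical_inj; apply; exact: tropical_initial_slopes.
Qed.

(** A priori the sign depends on v; comparing (1, 0), (0, 1) and (1, 1) makes it constant. *)
Lemma acts_on_slopes_eq1 A : acts_on_slopes 1%g A ->
  (forall v, row_act A v = v) \/ (forall v, row_act A v = (- v.1, - v.2)).
Proof.
move=> A1; have pm v : v = row_act A v \/ v = (- (row_act A v).1, - (row_act A v).2).
  apply: slopes_inj => i; apply: tropical_inj (A1 v i).
  by rewrite class_seed1; apply: tropical_initial_slopes.
have := (pm (1, 0), pm (0, 1), pm (1, 1)); rewrite /row_act /=.
move: (val A 0 0) (val A 0 1) (val A 1 0) (val A 1 1) => a b c d.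
rewrite !(mul0r, mul1r, add0r, addr0) => -[[e1 e2] e3].
have [[-> [-> [-> ->]]]|[-> [-> [-> ->]]]] :
    (a = 1 /\ b = 0 /\ c = 0 /\ d = 1) \/ (a = - 1 /\ b = 0 /\ c = 0 /\ d = - 1).
- by case: e1 => -[]; case: e2 => -[]; case: e3 => -[]; lia.
- by left=> -[p q] /=; congr pair; ring.
by right=> -[p q] /=; congr pair; ring.
Qed.

Lemma acts_on_slopesX x A n : acts_on_slopes x A -> acts_on_slopes (x ^+ n)%g (A ^+ n)%g.
Proof.
move=> xA; elim: n => [|n IH]; first exact: acts_on_slopes1.
by rewrite !expgS; apply: acts_on_slopesM.
Qed.

Lemma acts_on_slopes_parabolic t e A B i : acts_on_slopes t A -> acts_on_slopes e B ->
  acts_on_slopes (parabolic t e i) (parabolic A B i).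
Proof.
move=> tA eB; rewrite /parabolic; have tX n := acts_on_slopesX n tA.
have tV n := acts_on_slopesV (tX n).
case: (val i) => [|j]; first exact: tV.
exact: (acts_on_slopesM (acts_on_slopesM (acts_on_slopesM (acts_on_slopesM (tX j) eB) (tV 4))
  eB) (tV j)).
Qed.

Lemma acts_on_slopes_word (I : eqType) (rho : I -> Gamma) (rho' : I -> SL2Z) w :
  (forall i, acts_on_slopes (rho i) (rho' i)) ->
  acts_on_slopes (word_at rho w) (word_at rho' w).
Proof.
move=> h; elim: w => [|[i b] w IH]; first by rewrite !word_at_nil; apply: acts_on_slopes1.
rewrite !word_at_cons; apply: acts_on_slopesM IH.
by case: b; rewrite /letter_at /letter_val /=; [apply: acts_on_slopesV|].
Qed.

(** Tropicalize the two descriptions of the seed at the end of the generator edge. Both are slope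
    systems followed along explicit paths, and injectivity of the second path carries the comparison
    back to the initial quiver. *)
Lemma acts_on_slopes_generator x (j j' : positive) k p steps1 steps2 A
    (h : int * int -> int * int) :
  generator_valid T442_nodes x (j, k, j', p) ->
  ref_path 8 T442_nodes j ++ [:: inord k] = map inord (unzip1 steps1) ->
  ref_path 8 T442_nodes j' = map inord (unzip1 steps2) ->
  slope_path T442_lists T442_slopes steps1 -> slope_path T442_lists T442_slopes steps2 ->
  same_slopes (slope_end T442_slopes steps1) (slope_end T442_slopes steps2) p h ->
  (forall v, row_act A v = h v) -> acts_on_slopes x A.
Proof.
move=> [lt_k [s sp eS]] path1 path2 run1 run2 same hA.
rewrite T442_listsE in run1 run2.
have {}eS : mutate_path (initial_seed T442) (map inord (unzip1 steps1)) =
    relabel s (mutate_path (class_seed x) (map inord (unzip1 steps2))).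
  rewrite -path1 -path2 mutate_path_cat -class_seed1; exact: eS.
apply/acts_on_slopesP => v.
apply: (tropical_path_inj (P := map inord (unzip1 steps2)) (quiver_no2cycle T442)) => i.
rewrite (slope_pathP _ run2).
have {}eS := congr1 (fun S => seed_var S (s^-1%g i)) eS; rewrite /= permKV in eS.
have h1 := tropical_seed (map inord (unzip1 steps1)) (tropical_initial_slopes v) (s^-1%g i).
have h2 := tropical_seed (map inord (unzip1 steps2)) (tropical_class x v) i.
rewrite eS in h1; have := tropical_inj h2 h1 => ->.
rewrite (slope_pathP _ run1) /slopes.
rewrite (same v (s^-1%g i) (ltn_ord _)) -sp nth_perm_list permKV -hA //.
Qed.

End SlopeAction.

(** * Freeness in the cluster modular group and the conclusion *)

Section Conclusion.
Local Open Scope group_scope.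
Local Notation Gamma := (cluster_modular_group T442).
Implicit Types (x y : Gamma).

Lemma T442_ref_paths :
  [/\ ref_path 8 T442_nodes 6%positive = map inord [:: 2; 0%N],
      ref_path 8 T442_nodes 14%positive = map inord [:: 3; 4],
      ref_path 8 T442_nodes 177%positive = map inord [:: 2; 3; 5; 8; 0%N]
    & ref_path 8 T442_nodes 296%positive = map inord [:: 2; 3; 4; 8; 0%N; 5] ].
Proof.
have path j P : omap fst (PM.find j T442_nodes) = Some P -> ref_path 8 T442_nodes j = map inord P.
  by rewrite /ref_path; case: PM.find => [[P' q]|] //= [->].
by split; apply: path; vm_compute.
Qed.

Lemma T442_slope_actions (t e : Gamma) c0 :
  generator_valid T442_nodes t (nth c0 T442_generators 3) ->
  generator_valid T442_nodes e (nth c0 T442_generators 4) ->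
  acts_on_slopes t shift_matrix /\ acts_on_slopes e flip_matrix.
Proof.
have [r1 r2 r3 r4] := T442_ref_paths.
move=> tv ev; split.
  apply: (acts_on_slopes_generator tv _ _ shift_slopes1 shift_slopes2 shift_same row_act_shift).
    by rewrite r1.
  exact: r2.
apply: (acts_on_slopes_generator ev _ _ flip_slopes1 flip_slopes2 flip_same row_act_flip).
  by rewrite r3.
exact: r4.
Qed.

(** A word with value 1 in Gamma acts on slopes by a sign, which ping-pong excludes for nonempty
    reduced words. *)
Lemma parabolic_free (t e : Gamma) :
  acts_on_slopes t shift_matrix -> acts_on_slopes e flip_matrix ->
  free_family (parabolic t e).
Proof.
move=> tA eA w rw w1; apply: (parabolic_words_free rw).
apply: acts_on_slopes_eq1; rewrite -w1; apply: acts_on_slopes_word => i.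
exact: acts_on_slopes_parabolic.
Qed.

End Conclusion.

Theorem claim6p7 :
  [/\ finite_index (normal_closure gamma),
      is_free (normal_closure gamma)
    & subgroup_isomorphic (normal_closure gamma) (projective_congruence 4)].
Proof.
have [rho [R generated valid]] := T442_presentation.
have [tA eA] := T442_slope_actions
  (valid 3 (1%positive, 0%N, 1%positive, [::]) isT)
  (valid 4 (1%positive, 0%N, 1%positive, [::]) isT).
have free := parabolic_free tA eA.
have closureE := normal_closure_parabolic R generated.
split.
- exists [seq string_val (modular_value (rho 1%N) (rho 3) (rho 4)) r | r <- coset_strings] => x.
  have [r rL xr] := parabolic_cosets R generated x.
  exists (string_val (modular_value (rho 1%N) (rho 3) (rho 4)) r); first exact: map_f.
  exact/closureE.
- exact: (free_family_basis free closureE).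
exact: (free_families_isomorphic free projective_free closureE projective_congruence_parabolic).
Qed.
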